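(* If $K\subset\mathbb{C}^n$ is a $\lambda$-circular compact set, then $$\hat K=\hat K_\lambda=\{z\in\mathbb{C}^n:\Psi_{K,\lambda}(z)\le1\},$$ and this set contains the origin. Here $\hat K=\{z\in\mathbb{C}^n:|q(z)|\le\sup_K|q|\ \forall q\in\mathbb{C}[z_1,\dots,z_n]\}$ and $\hat K_\lambda=\{z\in\mathbb{C}^n:|q_m(z)|\le\sup_K|q_m|\text{ for all }m\text{ and all }q_m\in\mathcal{H}_\lambda\text{ of bidegree }(\rho_m,0)\}$.
   Context: Fix $\lambda=(\lambda_1,\dots,\lambda_n)$ with $\lambda_1=1$, $\lambda_k>0$. $\Phi^X(z,t)=(z_1e^{-\lambda_1t},\dots,z_ne^{-\lambda_nt})$; $\mathbb{H}=\{\operatorname{Re}t>0\}$. A set $E$ is $\lambda$-circular if $\Phi^X(z,t)\in E$ for all $z\in E$ and $t\in\mathbb{C}$ with $\operatorname{Re}t=0$. $\{\rho_m\}_{m\ge0}$ is the strictly increasing enumeration of $\{\lambda_1k_1+\dots+\lambda_nk_n:k\in\mathbb{Z}^n_{\ge0}\}$. A polynomial $q\in\mathbb{C}[z,\bar z]$ is quasi-homogeneous of type $\lambda$ with bidegree $(d_1,d_2)$ if $q(\Phi^X(z,t))=e^{-d_1t}e^{-d_2\bar t}q(z)$ for all $t\in\mathbb{H}$, $z\in\mathbb{C}^n$; $\mathcal{H}_\lambda$ is the set of such polynomials. $H_\lambda$ is the set of nonconstant plurisubharmonic functions $u\ge0$ on $\mathbb{C}^n$ with $u(\Phi^X(z,t))=e^{-\operatorname{Re}t}u(z)$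 for all $z\in\mathbb{C}^n$, $t\in\mathbb{C}$. For bounded $E$, $\Psi_{E,\lambda}(z)=\sup\{u(z):u\in H_\lambda,\ u\le1\text{ on }E\}$. *)

(* Defs.v *)
(* C := R[i] (mathcomp-real-closed complex numbers
   over R : realType), C^n := 'rV[C]_n with the product (matrix) topology. *)
From HB Require Import structures.
From mathcomp Require Import all_boot all_order all_algebra.
From mathcomp Require Import all_classical all_reals all_analysis.
From mathcomp.real_closed Require Import complex.
Import Order.TTheory GRing.Theory Num.Theory.
Import numFieldTopology.Exports numFieldNormedType.Exports.

Set Implicit Arguments.
Unset Strict Implicit.
Unset Printing Implicit Defensive.

Local Open Scope classical_set_scope.
Local Open Scope ring_scope.
Local Open Scope complex_scope.

(* the usual (norm) topology on the complex numbers *)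
HB.instance Definition _ (R : realType) :=
  PseudoPointedMetric.copy R[i] (R[i])^o.

Section Defs.
Variable R : realType.
Local Notation C := R[i].

(* complex exponential: e^(a + ib) = e^a (cos b + i sin b) *)
Definition cexp (w : C) : C :=
  let: a +i* b := w in (expR a)%:C * (cos b +i* sin b).

(* modulus |w| as a real number *)
Definition cabs (w : C) : R := Normc.normc w.

Variable n : nat.
Local Notation Cn := 'rV[C]_n.

(* Phi^X(z,t) = (z_1 e^{-lambda_1 t}, ..., z_n e^{-lambda_n t}) *)
Definition Phi (lam : 'I_n -> R) (z : Cn) (t : C) : Cn :=
  \row_k (z 0 k * cexp (- ((lam k)%:C * t))).

(* lambda-circular sets *)
Definition lam_circular (lam : 'I_n -> R) (E : set Cn) :=
  forall z t, E z -> complex.Re t = 0 -> E (Phi lam z t).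

(* upper semicontinuity *)
Definition usc (u : Cn -> R) :=
  forall a c, u a < c -> \forall z \near a, u z < c.

(* plurisubharmonic (real-valued) functions on C^n: upper semicontinuous and
   satisfying the sub-mean value inequality on every complex circle
   { a + e^{i theta} b : theta in [0, 2 pi] }. *)
Definition psh (u : Cn -> R) :=
  usc u /\
  forall a b : Cn,
    ((u a)%:E <= ((2 * (pi : R))^-1)%:E *
      \int[lebesgue_measure]_(th in `[0%R, (2 * pi)%R]) (u (a + cexp (th *i) *: b))%:E)%E.

(* the class H_lambda *)
Definition H_lam (lam : 'I_n -> R) (u : Cn -> R) :=
  [/\ psh u, (exists z w, u z <> u w), (forall z, 0 <= u z) &
      forall z t, u (Phi lam z t) = expR (- complex.Re t) * u z].

(* Psi_{E,lambda}(z) = sup { u(z) : u in H_lambda, u <= 1 on E } *)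
Definition Psi (lam : 'I_n -> R) (E : set Cn) (z : Cn) : \bar R :=
  ereal_sup [set (u z)%:E | u in [set u | H_lam lam u /\ forall w, E w -> u w <= 1]].

(* monomial z^alpha *)
Definition monom (a : 'I_n -> nat) (z : Cn) : C := \prod_i z 0 i ^+ a i.

(* polynomial functions in C[z_1, ..., z_n] *)
Definition is_poly (q : Cn -> C) :=
  exists s : seq (C * ('I_n -> nat)),
    forall z, q z = \sum_(p <- s) p.1 * monom p.2 z.

(* polynomial functions in C[z, zbar] *)
Definition is_poly_zzbar (q : Cn -> C) :=
  exists s : seq (C * ('I_n -> nat) * ('I_n -> nat)),
    forall z, q z = \sum_(p <- s) p.1.1 * monom p.1.2 z * monom p.2 (map_mx conjc z).

(* quasi-homogeneous polynomials of type lambda with bidegree (d1, d2) *)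
Definition quasi_hom (lam : 'I_n -> R) (d1 d2 : R) (q : Cn -> C) :=
  is_poly_zzbar q /\
  forall t z, 0 < complex.Re t ->
    q (Phi lam z t) = cexp (- (d1%:C * t)) * cexp (- (d2%:C * t^*)) * q z.

(* { lambda_1 k_1 + ... + lambda_n k_n : k in Z_{>=0}^n } = { rho_m : m >= 0 } *)
Definition weights (lam : 'I_n -> R) : set R :=
  [set d | exists k : 'I_n -> nat, d = \sum_i (k i)%:R * lam i].

(* sup_E |q| *)
Definition supnorm (E : set Cn) (q : Cn -> C) : \bar R :=
  ereal_sup [set (cabs (q z))%:E | z in E].

(* polynomially convex hull *)
Definition poly_hull (E : set Cn) : set Cn :=
  [set z | forall q, is_poly q -> ((cabs (q z))%:E <= supnorm E q)%E].

(* hat E_lambda *)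
Definition lam_hull (lam : 'I_n -> R) (E : set Cn) : set Cn :=
  [set z | forall d, weights lam d -> forall q, quasi_hom lam d 0 q ->
     ((cabs (q z))%:E <= supnorm E q)%E].

End Defs.

(* Main.v *)
(* Three inclusions carry the proof.

   lam_hull K is contained in the polynomial hull: if |q| <= S on the circular set K, averaging over
   the circle action bounds each quasi-homogeneous part of q by S on K, so |q| <= c S on lam_hull K,
   where c is the number of weights of q. Applied to q^k, the constant grows polynomially in k, and
   k-th roots remove it.

   {Psi <= 1} is contained in lam_hull K: a polynomial that is quasi-homogeneous of bidegree (d,0) is
   holomorphic (independence of characters), and for d > 0 the function (|q| / S)^(1/d) lies in H_lam.

   The polynomial hull is contained in {Psi <= 1}: this is the maximum principle for a
   plurisubharmonic u >= 0 on the hull of K, proved without the d-bar equation. Write X for the hull.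
   - A spectral radius argument in the ring of polynomials, with the Cauchy integral replaced by means
     over roots of unity, shows: if |q| <= e on X where f = w, then some power of q is H + (w - f) G
     with |H| <= (e + small)^k on K. Gluing these decompositions over a circle of values w gives Rossi's
     local maximum principle, first for strips in one coordinate and then for polydiscs.
   - u is dominated by Lipschitz functions w, its sup-convolutions, which still satisfy the sub-mean
     inequality on discrete circles. Finite averages v of w are approximated near each point by
     c + Re G + Q, with G a holomorphic quadratic polynomial and Q a Hermitian form which the sub-mean
     inequality makes almost nonnegative.
   - Perturb v by eps |z|^2. If w were large at a point of X but not on K, then at a near-maximum p over X
     one would get Re G < 0 on the part of X near the boundary of a small polydisc around p, while
     G(p) = 0; the polynomial 1 + ka G contradicts the local maximum principle. *)
Require Import Defs.
From HB Require Import structures.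
From mathcomp Require Import all_boot all_order all_algebra.
From mathcomp Require Import all_classical all_reals all_analysis.
From mathcomp.real_closed Require Import complex.
From Stdlib Require List.
From mathcomp Require Import measurable_realfun ring lra.
Import Order.TTheory GRing.Theory Num.Theory.
Import numFieldTopology.Exports numFieldNormedType.Exports.

Set Implicit Arguments.
Unset Strict Implicit.
Unset Printing Implicit Defensive.

Local Open Scope classical_set_scope.
Local Open Scope ring_scope.
Local Open Scope complex_scope.

(** * Complex exponentials and roots of unity *)

(** The hull need not contain any analytic disc, so the sub-mean inequality cannot be used along it:
    a plurisubharmonic function can only be compared with polynomials near one point. The comparison
    needs a second-order expansion with error $o(s^2)$ on a polydisc of radius $s$, because the
    perturbation by a multiple of $|z|^2$ gains only a multiple of $s^2$. This dictates the
    smoothing. Three averages in every real direction, at a scale $h$ fixed before $s$, give bounded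
    third differences and hence a remainder of order $(s/h)^3$. All these averages are finite sums,
    so nothing is ever differentiated. Integrals enter only through [psh], and are compared with
    step functions over equal arcs.

    On the algebraic side no ring is complete. Inverses are therefore only approximate and every
    estimate carries an error term. Quotient algebras are represented by smaller seminorms on the
    same ring, and finitely many quotients suffice because the coordinates generate the
    polynomials. *)

Section ComplexModulus.
Variable R : realType.
Local Notation C := R[i].
Implicit Types (x y : C) (r s t : R).

Lemma cabs_ge0 x : 0 <= cabs x.
Proof. by case: x => a b; rewrite /cabs /= sqrtr_ge0. Qed.

Lemma cabs0 : cabs (0 : C) = 0.
Proof. exact: Normc.normc0. Qed.

Lemma cabs1 : cabs (1 : C) = 1.
Proof. exact: Normc.normc1. Qed.

Lemma cabs_eq0 x : (cabs x == 0) = (x == 0).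
Proof.
apply/eqP/eqP => [/Normc.eq0_normc //|->]; exact: cabs0.
Qed.

Lemma cabs_gt0 x : (0 < cabs x) = (x != 0).
Proof. by rewrite lt0r cabs_ge0 andbT cabs_eq0. Qed.

Lemma cabsM x y : cabs (x * y) = cabs x * cabs y.
Proof. exact: Normc.normcM. Qed.

Lemma cabsV x : cabs x^-1 = (cabs x)^-1.
Proof. exact: Normc.normcV. Qed.

Lemma cabsX x k : cabs (x ^+ k) = cabs x ^+ k.
Proof. by elim: k => [|k IH]; rewrite ?expr0 ?cabs1 // !exprS cabsM IH. Qed.

Lemma cabsN x : cabs (- x) = cabs x.
Proof. exact: normcN. Qed.

Lemma cabsB x y : cabs (x - y) = cabs (y - x).
Proof. by rewrite -cabsN opprB. Qed.

Lemma cabsD x y : cabs (x + y) <= cabs x + cabs y.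
Proof. exact: le_normcD. Qed.

Lemma cabs_lD x y : cabs x - cabs y <= cabs (x + y).
Proof. by have := cabsD (x + y) (- y); rewrite addrK cabsN; lra. Qed.

Lemma cabs_lB x y : cabs x - cabs y <= cabs (x - y).
Proof. by have := cabs_lD x (- y); rewrite cabsN. Qed.

Lemma cabs_sum (I : Type) (s : seq I) (P : pred I) (F : I -> C) :
  cabs (\sum_(i <- s | P i) F i) <= \sum_(i <- s | P i) cabs (F i).
Proof.
elim/big_rec2: _ => [|i y1 y2 _ le12]; first by rewrite cabs0.
by apply: le_trans (cabsD _ _) _; rewrite lerD2l.
Qed.

Lemma cabs_prod (I : Type) (s : seq I) (P : pred I) (F : I -> C) :
  cabs (\prod_(i <- s | P i) F i) = \prod_(i <- s | P i) cabs (F i).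
Proof.
elim/big_rec2: _ => [|i y1 y2 _ <-]; first by rewrite cabs1.
by rewrite cabsM.
Qed.

Lemma realcD r s : (r + s)%:C = r%:C + s%:C :> C.
Proof. exact: (rmorphD (real_complex R)). Qed.

Lemma realcB r s : (r - s)%:C = r%:C - s%:C :> C.
Proof. exact: (rmorphB (real_complex R)). Qed.

Lemma realcM r s : (r * s)%:C = r%:C * s%:C :> C.
Proof. exact: (rmorphM (real_complex R)). Qed.

Lemma cabsE (a b : R) : cabs (a +i* b) = Num.sqrt (a ^+ 2 + b ^+ 2).
Proof. by []. Qed.

Lemma cabs_real r : cabs r%:C = `|r|.
Proof. by rewrite cabsE expr0n addr0 sqrtr_sqr. Qed.

Lemma cabs_nat (k : nat) : cabs (k%:R : C) = k%:R.
Proof.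
have -> : (k%:R : C) = (k%:R : R)%:C by rewrite rmorph_nat.
by rewrite cabs_real ger0_norm.
Qed.

Lemma cabs_Re x : `|complex.Re x| <= cabs x.
Proof.
by case: x => a b; rewrite /cabs /= -sqrtr_sqr ler_wsqrtr // lerDl sqr_ge0.
Qed.

Lemma cabs_Im x : `|complex.Im x| <= cabs x.
Proof.
by case: x => a b; rewrite /cabs /= -sqrtr_sqr ler_wsqrtr // lerDr sqr_ge0.
Qed.

Lemma cabs_le_ReIm x : cabs x <= `|complex.Re x| + `|complex.Im x|.
Proof.
case: x => a b; rewrite /cabs /=.
rewrite -[leRHS]ger0_norm ?addr_ge0 // -sqrtr_sqr ler_wsqrtr //.
by rewrite sqrrD !real_normK ?num_real // lerD2r lerDl mulrn_wge0 // mulr_ge0.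
Qed.

Lemma cabs_sqr x : cabs x ^+ 2 = complex.Re x ^+ 2 + complex.Im x ^+ 2.
Proof. by case: x => a b; rewrite /cabs /= sqr_sqrtr // addr_ge0 ?sqr_ge0. Qed.

Lemma ReD x y : complex.Re (x + y) = complex.Re x + complex.Re y.
Proof. by case: x y => a b []. Qed.

Lemma ImD x y : complex.Im (x + y) = complex.Im x + complex.Im y.
Proof. by case: x y => a b []. Qed.

Lemma ReN x : complex.Re (- x) = - complex.Re x.
Proof. by case: x. Qed.

Lemma Re_realM r x : complex.Re (r%:C * x) = r * complex.Re x.
Proof. by case: x => a b /=; rewrite mul0r subr0. Qed.

Lemma Re_sum (I : Type) (s : seq I) (P : pred I) (F : I -> C) :
  complex.Re (\sum_(i <- s | P i) F i) = \sum_(i <- s | P i) complex.Re (F i).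
Proof. by elim/big_rec2: _ => // i y1 y2 _ <-; rewrite ReD. Qed.

Lemma cexpD x y : cexp (x + y) = cexp x * cexp y.
Proof.
case: x y => a b [c d] /=; rewrite expRD cosD sinD.
by apply/eqP; rewrite eq_complex /=; apply/andP; split; apply/eqP; ring.
Qed.

Lemma cexp0 : cexp (0 : C) = 1.
Proof. by rewrite /cexp /= expR0 cos0 sin0 mul1r. Qed.

Lemma cexpMn x k : cexp (x *+ k) = cexp x ^+ k.
Proof. by elim: k => [|k IH]; rewrite ?mulr0n ?cexp0 // mulrS exprS cexpD IH. Qed.

Lemma cexp_sum (I : Type) (s : seq I) (P : pred I) (F : I -> C) :
  cexp (\sum_(i <- s | P i) F i) = \prod_(i <- s | P i) cexp (F i).
Proof.
by elim/big_rec2: _ => [|i y1 y2 _ <-]; rewrite ?cexp0 // cexpD.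
Qed.

Lemma cabs_cexp x : cabs (cexp x) = expR (complex.Re x).
Proof.
case: x => a b; rewrite /cexp cabsM cabs_real cabsE cos2Dsin2 sqrtr1 mulr1 /=.
by rewrite ger0_norm // expR_ge0.
Qed.

Lemma cexp_neq0 x : cexp x != 0.
Proof. by rewrite -cabs_gt0 cabs_cexp expR_gt0. Qed.

Definition expi (t : R) : C := cexp (t *i).

Lemma expiE t : expi t = cos t +i* sin t.
Proof. by rewrite /expi /cexp expR0 mul1r. Qed.

Lemma expiD s t : expi (s + t) = expi s * expi t.
Proof. by rewrite /expi -cexpD; congr cexp; apply/eqP; rewrite eq_complex /= addr0 !eqxx. Qed.

Lemma expi0 : expi 0 = 1.
Proof. by rewrite expiE cos0 sin0. Qed.

Lemma expiMn t k : expi (t *+ k) = expi t ^+ k.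
Proof. by elim: k => [|k IH]; rewrite ?mulr0n ?expi0 // mulrS exprS expiD IH. Qed.

Lemma cabs_expi t : cabs (expi t) = 1.
Proof. by rewrite /expi cabs_cexp /= expR0. Qed.

Lemma expi2pi : expi (2 * pi) = 1.
Proof. by rewrite expiE mulr_natl cos2pi sin2pi. Qed.

Lemma expi_neq1 t : 0 < t < 2 * pi -> expi t != 1.
Proof.
move=> /andP[t0 t2]; apply/eqP => h.
have hc : cos t = 1 by move: h; rewrite expiE => -[].
have st : 0 < sin (t / 2) by apply: sin_gt0_pi; apply/andP; split; lra.
have : cos (t / 2 + t / 2) = 1 by have -> : t / 2 + t / 2 = t by lra.
rewrite cosD => h1; have h2 := cos2Dsin2 (t / 2).
have h3 : 0 < sin (t / 2) * sin (t / 2) by rewrite mulr_gt0.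
by move: h2; rewrite !expr2; lra.
Qed.

Lemma lip1_of_derive (f df : R -> R) :
  (forall u : R, is_derive u (1 : R) f (df u)) -> (forall u, `|df u| <= 1) ->
  forall s t, `|f s - f t| <= `|s - t|.
Proof.
move=> fd df1 s t; wlog st : s t / t <= s.
  by move=> H; case/orP: (le_total t s) => /H //; rewrite distrC (distrC t).
have fc : {within `[t, s], continuous f}.
  by apply: derivable_within_continuous => u _; case: (fd u).
have [x _ ->] := MVT_segment st (fun u _ => fd u) fc.
by rewrite normrM ler_piMl.
Qed.

Lemma expi_lip s t : cabs (expi s - expi t) <= 2 * `|s - t|.
Proof.
apply: le_trans (cabs_le_ReIm _) _; rewrite !expiE /= mulr_natl mulr2n.
apply: lerD.
  apply: (@lip1_of_derive cos (fun u => - sin u)) => u.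
  by rewrite normrN sin_max.
by apply: (@lip1_of_derive sin cos) => u; exact: cos_max.
Qed.

End ComplexModulus.

(** * Growth of powers, and uniform bounds on a segment *)

Section RealPowers.
Variable R : realType.
Implicit Types (x y B : R).

Lemma exprn_ge_eventually y B : 1 < y ->
  exists j0, forall j, (j0 <= j)%N -> B <= y ^+ j.
Proof.
move=> y1; have bern j : 1 + j%:R * (y - 1) <= y ^+ j.
  elim: j => [|j IH]; first by rewrite mul0r addr0 expr0.
  rewrite exprS -natr1; have j0 : 0 <= j%:R :> R by [].
  have h1 : y * (1 + j%:R * (y - 1)) <= y * y ^+ j by rewrite ler_pM2l //; lra.
  have h2 : 0 <= j%:R * ((y - 1) * (y - 1)) by rewrite !mulr_ge0 //; lra.
  by lra.
pose m := Num.truncn (`|B| / (y - 1)); exists m.+1 => j mj; apply: le_trans (bern j).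
have h : `|B| / (y - 1) < m.+1%:R by exact: truncnS_gt.
have h2 : m.+1%:R <= j%:R :> R by rewrite ler_nat.
have y10 : 0 < y - 1 by lra.
move: h; rewrite ltr_pdivrMr // => h.
have : m.+1%:R * (y - 1) <= j%:R * (y - 1) by rewrite ler_pM2r.
by have := ler_norm B; lra.
Qed.

Lemma exprn_le_eventually x B : 0 <= x < 1 -> 0 < B ->
  exists j0, forall j, (j0 <= j)%N -> x ^+ j <= B.
Proof.
case/andP; rewrite le_eqVlt => /orP[/eqP <- _ B0|x0 x1 B0].
  by exists 1%N => j j1; rewrite expr0n gtn_eqF // ltW.
have [|j0 H] := @exprn_ge_eventually x^-1 B^-1; first by rewrite invf_gt1.
exists j0 => j /H; rewrite exprVn lef_pV2 //; rewrite qualifE /= ?exprn_gt0 //.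
Qed.

(** Heine-Borel for a property that depends monotonically on a bound [M]: the supremum of the points
    up to which one bound suffices cannot lie before [b], since the local bound there would carry it
    further. *)
Lemma segment_uniform (P : R -> R -> Prop) (a b : R) :
  (forall M M' x, M <= M' -> P M x -> P M' x) ->
  (forall x, a <= x <= b -> exists M d, 0 < d /\ forall y, `|y - x| < d -> P M y) ->
  exists M, forall x, a <= x <= b -> P M x.
Proof.
move=> mono loc; have [ab|ba] := lerP a b; last first.
  by exists 0 => x /andP[ax xb]; lra.
pose S := [set x | a <= x <= b /\ exists M, forall y, a <= y <= x -> P M y].
have Sa : S a.
  split; first by rewrite lexx.
  have [|M [d [d0 H]]] := loc a; first by rewrite lexx.
  exists M => y /andP[ay ya]; have -> : y = a by lra.
  by apply: H; rewrite subrr normr0.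
have hS : has_sup S by split; [exists a | exists b => x [/andP[]]].
have sa : a <= sup S by apply: sup_upper_bound.
have sb : sup S <= b by apply: ge_sup => [|x [/andP[]]]; first by exists a.
have [|M [d [d0 H]]] := loc (sup S); first by rewrite sa.
have [x [/andP[ax xb] [M1 HM1]] xs] := sup_adherent d0 hS.
have key y : a <= y < sup S + d -> P (Order.max M M1) y.
  move=> /andP[ay ys]; have [yx|xy] := lerP y x.
    by apply: mono (HM1 y _); rewrite ?ay // le_max lexx orbT.
  by apply: mono (H y _); rewrite ?le_max ?lexx // ltr_norml; apply/andP; split; lra.
exists (Order.max M M1) => y /andP[ay yb]; apply: (key y); rewrite ay /=.
suff -> : sup S = b by lra.
apply/eqP; rewrite eq_le sb /= leNgt; apply/negP => sltb.
have : S (Order.min b (sup S + d / 2)).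
  split; first by apply/andP; split; rewrite ?le_min ?ge_min ?lexx ?ab /=; lra.
  exists (Order.max M M1) => z /andP[az]; rewrite le_min => /andP[zb zs].
  by apply: (key z); rewrite az; lra.
move=> /(sup_upper_bound hS); rewrite ge_min => /orP[]; lra.
Qed.

End RealPowers.

Section RootsOfUnity.
Variable R : realType.
Local Notation C := R[i].

Definition omega (m : nat) : C := expi (2 * pi / m%:R).

Lemma cabs_omega m : cabs (omega m) = 1.
Proof. exact: cabs_expi. Qed.

Lemma omegaX m k : omega m ^+ k = expi (2 * pi * k%:R / m%:R).
Proof. by rewrite /omega -expiMn -[_ *+ k]mulr_natr mulrAC. Qed.

Lemma omegaXm m : (0 < m)%N -> omega m ^+ m = 1.
Proof. by move=> m0; rewrite omegaX mulfK ?expi2pi // pnatr_eq0 -lt0n. Qed.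

Lemma omegaX_neq1 m k : (0 < k < m)%N -> omega m ^+ k != 1.
Proof.
move=> /andP[k0 km]; rewrite omegaX; apply: expi_neq1.
have m0 : 0 < m%:R :> R by rewrite ltr0n (leq_trans _ km).
have p0 := pi_gt0 R.
have kp : 0 < k%:R :> R by rewrite ltr0n.
apply/andP; split; first by rewrite divr_gt0 ?mulr_gt0.
by rewrite ltr_pdivrMr // ltr_pM2l ?mulr_gt0 // ltr_nat.
Qed.

Lemma sum_omegaX m k : (0 < k < m)%N -> \sum_(l < m) omega m ^+ (l * k) = 0.
Proof.
move=> km; have m0 : (0 < m)%N by case/andP: km => _; apply: leq_trans.
have := subrX1 (omega m ^+ k) m.
rewrite -exprM mulnC exprM omegaXm // expr1n subrr => /esym/eqP.
rewrite mulf_eq0 subr_eq0 (negPf (omegaX_neq1 km)) /= => /eqP h0; rewrite -[RHS]h0.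
by apply: eq_bigr => i _; rewrite -exprM mulnC.
Qed.

End RootsOfUnity.

(** * Algebra seminorms *)

Section Seminorms.
Variables (R : realType) (A : comPzRingType) (k : {rmorphism R[i] -> A}).
Local Notation C := R[i].
Implicit Types (N : A -> R) (x y a c : A) (z : C).

(** Submultiplicative, but neither definite nor complete. Only an inequality is asked of [snZ],
    because nonzero scalars are invertible and [snZE] recovers equality; this makes the axioms easy
    to check for quotients. *)
Record seminorm N : Prop := Seminorm {
  sn_ge0 : forall x, 0 <= N x;
  snD : forall x y, N (x + y) <= N x + N y;
  snM : forall x y, N (x * y) <= N x * N y;
  snZ : forall z x, N (k z * x) <= cabs z * N x;
  sn1 : N 1 = 1 }.

Variable N : A -> R.
Hypothesis sN : seminorm N.

Lemma sn0 : N 0 = 0.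
Proof.
apply/eqP; rewrite eq_le (sn_ge0 sN) andbT.
by have := snZ sN 0 0; rewrite rmorph0 mul0r cabs0 mul0r.
Qed.

Lemma snN x : N (- x) = N x.
Proof.
have h y : N (- y) <= N y.
  by have := snZ sN (-1) y; rewrite rmorphN1 mulN1r cabsN cabs1 mul1r.
by apply/eqP; rewrite eq_le h /= -{1}(opprK x) h.
Qed.

Lemma snB x y : N (x - y) <= N x + N y.
Proof. by apply: le_trans (snD sN _ _) _; rewrite snN. Qed.

Lemma snX x m : N (x ^+ m) <= N x ^+ m.
Proof.
elim: m => [|m IH]; first by rewrite !expr0 (sn1 sN).
by rewrite !exprS (le_trans (snM sN _ _)) // ler_wpM2l // (sn_ge0 sN).
Qed.

Lemma sn_scal z : N (k z) = cabs z.
Proof.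
have le w : N (k w) <= cabs w by have := snZ sN w 1; rewrite mulr1 (sn1 sN) mulr1.
apply/eqP; rewrite eq_le le /=.
have [->|z0] := eqVneq z 0; first by rewrite cabs0 (sn_ge0 sN).
have := snM sN (k z) (k z^-1); rewrite -rmorphM divff // rmorph1 (sn1 sN) => h.
have zp : 0 < cabs z by rewrite cabs_gt0.
have : N (k z) * N (k z^-1) <= N (k z) * (cabs z)^-1.
  by rewrite ler_wpM2l ?(sn_ge0 sN) // -cabsV le.
by rewrite ler_pdivlMr // => h2; nra.
Qed.

Lemma snZE z x : N (k z * x) = cabs z * N x.
Proof.
apply/eqP; rewrite eq_le (snZ sN) /=.
have [->|z0] := eqVneq z 0; first by rewrite cabs0 mul0r (sn_ge0 sN).
have := snZ sN z^-1 (k z * x).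
by rewrite mulrA -rmorphM mulVf // rmorph1 mul1r cabsV mulrC ler_pdivlMr ?cabs_gt0 // mulrC.
Qed.

Lemma sn_sum (I : Type) (s : seq I) (P : pred I) (F : I -> A) :
  N (\sum_(i <- s | P i) F i) <= \sum_(i <- s | P i) N (F i).
Proof.
elim/big_rec2: _ => [|i y1 y2 _ le12]; first by rewrite sn0.
by apply: le_trans (snD sN _ _) _; rewrite lerD2l.
Qed.

Lemma sn_mean m (F : 'I_m -> A) (B : R) : (0 < m)%N ->
  (forall i, N (F i) <= B) -> N (k m%:R^-1 * \sum_(i < m) F i) <= B.
Proof.
move=> m0 FB; apply: le_trans (snZ sN _ _) _.
have mp : 0 < m%:R :> R by rewrite ltr0n.
rewrite cabsV cabs_nat mulrC ler_pdivrMr //.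
apply: le_trans (sn_sum _ _ _) _.
apply: le_trans (_ : \sum_(i < m) B <= _); first exact: ler_sum.
by rewrite sumr_const card_ord mulr_natr.
Qed.

End Seminorms.
Global Opaque omega expi.

(** * Points of the spectrum in a seminormed algebra *)

Section SpectralPoint.
Variables (R : realType) (A : comPzRingType) (k : {rmorphism R[i] -> A}).
Local Notation C := R[i].
Variable N : A -> R.
Hypothesis sN : seminorm k N.
Implicit Types (x y a c e r : A) (z u : C).

Local Lemma N_ge0 x : 0 <= N x. Proof. exact: sn_ge0 sN x. Qed.

Lemma neumann e th m : N e <= th -> 0 <= th < 1 ->
  N (\sum_(i < m) e ^+ i) <= (1 - th)^-1.
Proof.
move=> eth /andP[t0 t1]; apply: le_trans (sn_sum sN _ _ _) _.
apply: le_trans (_ : \sum_(i < m) th ^+ i <= _).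
  by apply: ler_sum => i _; apply: le_trans (snX sN _ _) _; rewrite lerXn2r ?nnegrE ?N_ge0.
have h := subrX1 th m; have t1' : 0 < 1 - th by lra.
rewrite -(ler_pM2l t1') divff ?gt_eqF //.
have -> : (1 - th) * (\sum_(i < m) th ^+ i) = 1 - th ^+ m by lra.
by rewrite lerBlDr lerDl exprn_ge0.
Qed.

(* If [N (1 - b * r) < 1], a Neumann series turns [r] into an inverse of [b] modulo an arbitrarily small error. *)
Lemma refine_inverse b r th m : N (1 - b * r) <= th -> 0 <= th < 1 ->
  exists r', N r' <= N r / (1 - th) /\ N (1 - b * r') <= th ^+ m.
Proof.
move=> brth th01; exists (r * \sum_(i < m) (1 - b * r) ^+ i); split.
  by apply: le_trans (snM sN _ _) _; rewrite ler_wpM2l ?N_ge0 // neumann.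
have -> : 1 - b * (r * \sum_(i < m) (1 - b * r) ^+ i) = (1 - b * r) ^+ m.
  have := subrX1 (1 - b * r) m; set S := \sum_(i < m) _ => h.
  have -> : (1 - b * r) ^+ m = 1 + (1 - b * r - 1) * S by rewrite -h; ring.
  by ring.
apply: le_trans (snX sN _ _) _; rewrite lerXn2r ?nnegrE ?N_ge0 //.
by case/andP: th01.
Qed.

(** The resolvent identity $r_1-r_2=(u_1-u_2)\,a\,r_1r_2$, with the defects [e1] and [e2] of the
    approximate inverses carried along. *)
Lemma resolvent_diff a u1 u2 r1 r2 M d :
  N r1 <= M -> N r2 <= M ->
  N (1 - (1 - k u1 * a) * r1) <= d -> N (1 - (1 - k u2 * a) * r2) <= d ->
  N (r1 - r2) <= M * M * (cabs (u1 - u2) * N a) + 2 * M * d.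
Proof.
move=> M1 M2 d1 d2.
set e1 := 1 - _ in d1; set e2 := 1 - _ in d2.
have -> : r1 - r2 = r1 * r2 * (k (u1 - u2) * a) + (r1 * e2 - r2 * e1).
  by rewrite /e1 /e2 rmorphB; ring.
have M0 : 0 <= M by apply: le_trans (N_ge0 r1) M1.
apply: le_trans (snD sN _ _) _; apply: lerD.
  apply: le_trans (snM sN _ _) _; apply: ler_pM; rewrite ?N_ge0 //; last exact: snZ.
  by apply: le_trans (snM sN _ _) _; apply: ler_pM; rewrite ?N_ge0.
apply: le_trans (snB sN _ _) _.
rewrite -mulrA mulr_natl mulr2n.
by apply: lerD; apply: le_trans (snM sN _ _) _; apply: ler_pM; rewrite ?N_ge0.
Qed.

(** Averaging over the roots of unity kills every power [j] with [0 < j < n] and leaves the constant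
    term. *)
Lemma mean_geometric a u n : (0 < n)%N ->
  k n%:R^-1 * \sum_(l < n) \sum_(j < n) (k (u * omega R n ^+ l) * a) ^+ j = 1.
Proof.
case: n => // n _; rewrite exchange_big /= big_ord_recl /=.
rewrite [X in _ + X]big1 ?addr0; last first.
  move=> j _; rewrite (eq_bigr (fun l : 'I_n.+1 => (k (u ^+ (bump 0 j)) * a ^+ (bump 0 j)) *
    k (omega R n.+1 ^+ (l * bump 0 j)))); last first.
    by move=> l _; rewrite exprMn -rmorphXn exprMn -exprM rmorphM; ring.
  rewrite -mulr_sumr -rmorph_sum sum_omegaX ?rmorph0 ?mulr0 //.
  by rewrite /bump /= add1n ltnS ltn_ord.
rewrite (eq_bigr (fun _ => 1)); last by move=> l _; rewrite expr0.
rewrite sumr_const card_ord -(rmorph_nat k) -rmorphM mulVf ?rmorph1 //.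
Qed.

(** The partial fraction identity: the mean of $(1-u\omega^l a)^{-1}$ over $l$ is $(1-(ua)^n)^{-1}$.
    It does the work of a Cauchy integral, relating resolvents on a circle to large powers of
    [a]. *)
Lemma mean_resolvent a u n (r : 'I_n -> A) (d B : R) : (0 < n)%N ->
  (forall l : 'I_n, N (1 - (1 - k (u * omega R n ^+ l) * a) * r l) <= d) ->
  (forall l : 'I_n, N (\sum_(j < n) (k (u * omega R n ^+ l) * a) ^+ j) <= B) ->
  N (1 - (k n%:R^-1 * \sum_(l < n) r l) * (1 - (k u * a) ^+ n)) <= d * B.
Proof.
move=> n0 rd pB.
pose v (l : 'I_n) := k (u * omega R n ^+ l) * a.
have -> : 1 - (k n%:R^-1 * \sum_(l < n) r l) * (1 - (k u * a) ^+ n) =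
  k n%:R^-1 * \sum_(l < n) ((1 - (1 - v l) * r l) * \sum_(j < n) v l ^+ j).
  rewrite -{1}(mean_geometric a u n0) -mulrA -mulrBr; congr (_ * _).
  rewrite mulr_suml -sumrB; apply: eq_bigr => l _.
  have h := subrX1 (v l) n.
  have vn : v l ^+ n = (k u * a) ^+ n.
    by rewrite /v exprMn -rmorphXn exprMn -exprM mulnC exprM omegaXm // expr1n mulr1 rmorphXn -exprMn.
  rewrite -/(v l) -vn.
  have -> : 1 - v l ^+ n = (1 - v l) * (\sum_(j < n) v l ^+ j).
    by rewrite -opprB h; ring.
  by ring.
apply: (sn_mean sN) => // l; apply: le_trans (snM sN _ _) _.
by apply: ler_pM; rewrite ?N_ge0 // ?rd ?pB.
Qed.

(** An approximate inverse at one point, once refined, still works at nearby points; compactness of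
    the circle gives one bound [M], valid also on a thin annulus. The variable is $u=1/z$, so the
    circle has radius [rho^-1]. *)
Lemma circle_inverse a rho : 0 < rho ->
  (forall z, cabs z = rho -> exists c, N (1 - (k z - a) * c) < 1) ->
  exists M kap, [/\ 0 < M, 0 < kap < rho^-1 & forall th t, 0 <= th <= 2 * pi ->
    `|t - rho^-1| <= kap -> exists r, N r <= M /\ N (1 - (1 - k (t%:C * expi th) * a) * r) <= 7 / 8].
Proof.
move=> rho0 H.
pose P M th := exists r, N r <= M /\ N (1 - (1 - k (rho^-1%:C * expi th) * a) * r) <= 3 / 4.
have [|th|M HM] := @segment_uniform R P 0 (2 * pi).
- by move=> M M' th MM' [r [rM re]]; exists r; split => //; apply: le_trans rM MM'.
- move=> _; pose u := rho^-1%:C * expi th.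
  have u0 : u != 0.
    rewrite -cabs_gt0 cabsM cabs_expi cabs_real mulr1 normr_gt0 invr_neq0 //.
    by rewrite gt_eqF.
  have [|c Hc] := H u^-1.
    by rewrite cabsV cabsM cabs_expi mulr1 cabs_real ger0_norm ?invrK // invr_ge0 ltW.
  have e : 1 - (k u^-1 - a) * c = 1 - (1 - k u * a) * (k u^-1 * c).
    have kk : k u * k u^-1 = 1 by rewrite -rmorphM divff // rmorph1.
    have -> : (1 - k u * a) * (k u^-1 * c) = (k u^-1 - (k u * k u^-1) * a) * c by ring.
    by rewrite kk mul1r.
  rewrite e in Hc; set r := _ * c in Hc.
  set th0 := N _ in Hc; have t0 : 0 <= th0 < 1 by rewrite N_ge0.
  (* Refining the defect to 1/2 leaves 1/4 for moving along the circle (hence 3/4 in [P]) and a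
     further 1/8 for moving radially (hence 7/8). *)
  have [|m Hm] := @exprn_le_eventually R th0 (1/2) t0; first by lra.
  have [r' [r'N r'e]] := @refine_inverse _ r th0 m (lexx _) t0.
  have {}r'e := le_trans r'e (Hm _ (leqnn _)).
  set D := 2 * rho^-1 * N a * N r'.
  have D0 : 0 <= D by rewrite !mulr_ge0 ?N_ge0 // invr_ge0 ltW.
  exists (N r'), (1 / 4 / (D + 1)); split; first by rewrite divr_gt0 //; lra.
  move=> th' Hth'; exists r'; split => //.
  rewrite -/u in r'e; set u' := _ * expi th'.
  have -> : 1 - (1 - k u' * a) * r' = (1 - (1 - k u * a) * r') + k (u' - u) * (a * r').
    by rewrite rmorphB; ring.
  apply: le_trans (snD sN _ _) _.
  suff : N (k (u' - u) * (a * r')) <= 1 / 4 by lra.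
  apply: le_trans (snZ sN _ _) _.
  rewrite /u' /u -mulrBr cabsM cabs_real ger0_norm ?invr_ge0 ?(ltW rho0) //.
  have h1 := expi_lip th' th; have h2 := snM sN a r'.
  have D1 : 0 < D + 1 by lra.
  move: Hth'; rewrite ltr_pdivlMr // => Hth'.
  apply: le_trans (_ : rho^-1 * (2 * `|th' - th|) * (N a * N r') <= _).
    by rewrite ler_pM ?N_ge0 ?mulr_ge0 ?cabs_ge0 ?invr_ge0 ?(ltW rho0) // ler_wpM2l // invr_ge0 ltW.
  have -> : rho^-1 * (2 * `|th' - th|) * (N a * N r') = `|th' - th| * D by rewrite /D; ring.
  have := normr_ge0 (th' - th); lra.
have M1 : 0 < Order.max M 1 by rewrite lt_max ltr01 orbT.
have [M' M'0 MM'] : exists2 M', 0 < M' & M <= M'.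
  by exists (Order.max M 1) => //; rewrite le_max lexx.
have ri : 0 < rho^-1 by rewrite invr_gt0.
pose D := N a * M'.
have D0 : 0 <= D by rewrite mulr_ge0 ?N_ge0 // ltW.
exists M', (Order.min (rho^-1 / 2) (1 / 8 / (D + 1))); split => //.
  rewrite lt_min !divr_gt0 //=; last by lra.
  by rewrite gt_min; apply/orP; left; lra.
move=> th t /HM [r [rM re]] ht.
exists r; split; first exact: le_trans rM MM'.
have -> : 1 - (1 - k (t%:C * expi th) * a) * r = (1 - (1 - k (rho^-1%:C * expi th) * a) * r) +
   k ((t - rho^-1)%:C * expi th) * (a * r).
  by rewrite realcB [(_ - _) * expi _]mulrBl rmorphB; ring.
apply: le_trans (snD sN _ _) _.
suff : N (k ((t - rho^-1)%:C * expi th) * (a * r)) <= 1 / 8 by lra.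
apply: le_trans (snZ sN _ _) _; rewrite cabsM cabs_expi mulr1 cabs_real.
move: ht; rewrite le_min => /andP[_]; rewrite ler_pdivlMr => [ht|]; last by lra.
apply: le_trans (_ : `|t - rho^-1| * D <= _).
  rewrite ler_wpM2l //; apply: le_trans (snM sN _ _) _.
  by rewrite ler_wpM2l ?N_ge0 //; apply: le_trans rM MM'.
have := normr_ge0 (t - rho^-1); lra.
Qed.

(** Rickart's argument. If [z - a] were approximately invertible on the whole circle $|z|=\rho$,
    compare the mean resolvents [R1] and [R2] at radii [t1] and [t2] just below and above $1/\rho$.
    Since $(t_1a)^n$ is small, [R1] is near 1; [R2] is near [R1] by the resolvent identity; so
    $1-(t_2a)^n$ is bounded, although $(t_2a)^n$ is at least $(t_2\rho)^n$ in norm. *)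
Lemma rickart a rho : 0 < rho ->
  (forall m, rho ^+ m <= N (a ^+ m)) ->
  (forall s, rho < s -> exists m, (0 < m)%N /\ N (a ^+ m) < s ^+ m) ->
  exists z, cabs z = rho /\ forall c, 1 <= N (1 - (k z - a) * c).
Proof.
move=> rho0 lo up; apply: contrapT => nex.
have [|M [kap [M0 /andP[kap0 kaprho] HM]]] := @circle_inverse a rho rho0.
  move=> z zr; apply: contrapT => nc; apply: nex; exists z; split => // c.
  by rewrite leNgt; apply/negP => h; apply: nc; exists c.
pose M8 := M / (1 - 7 / 8).
have M80 : 0 < M8 by rewrite divr_gt0 //; lra.
have ri : 0 < rho^-1 by rewrite invr_gt0.
pose E := M8 * M8 * N a.
have E0 : 0 <= E by rewrite /E mulr_ge0 ?N_ge0 // mulr_ge0 // ltW.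
pose kp := Order.min kap (1 / 8 / (E + 1)).
have kp0 : 0 < kp by rewrite lt_min kap0 /= !divr_gt0 //; lra.
have kpk : kp <= kap by rewrite ge_min lexx.
have kpE : 2 * kp * E <= 1 / 4.
  have : kp <= 1 / 8 / (E + 1) by rewrite ge_min lexx orbT.
  by rewrite ler_pdivlMr; nra.
have fine t th d : 0 < d -> 0 <= th <= 2 * pi -> `|t - rho^-1| <= kp ->
    exists r, N r <= M8 /\ N (1 - (1 - k (t%:C * expi th) * a) * r) <= d.
  move=> d0 hth ht; have [|r [rM re]] := HM th t hth; first exact: le_trans ht kpk.
  have h78 : 0 <= (7 / 8 : R) < 1 by apply/andP; split; lra.
  have [m Hm] := exprn_le_eventually h78 d0.
  have [r' [r'N r'e]] := @refine_inverse _ r (7 / 8) m re h78.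
  exists r'; split; last by apply: le_trans r'e (Hm _ (leqnn _)).
  by apply: le_trans r'N _; rewrite ler_pM2r // invr_gt0; lra.
pose t1 := rho^-1 - kp; pose t2 := rho^-1 + kp.
have t10 : 0 < t1 by rewrite /t1; lra.
have t20 : 0 < t2 by rewrite /t2; lra.
have rr : rho * rho^-1 = 1 by rewrite divff // gt_eqF.
have rs1 : rho < t1^-1.
  by rewrite -(invrK rho) ltf_pV2 ?qualifE //= /t1; lra.
pose s := (rho + t1^-1) / 2.
have tt : t1 * t1^-1 = 1 by rewrite divff // gt_eqF.
have [|m [m0 ms]] := up s; first by rewrite /s; lra.
have s0 : 0 < s by rewrite /s; lra.
pose x := (t1 * s) ^+ m; pose y := (t2 * rho) ^+ m.
have x01 : 0 <= x < 1.
  have ts0 : 0 <= t1 * s by rewrite mulr_ge0 // ltW.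
  have ts1 : t1 * s < 1 by rewrite /s; nra.
  by rewrite /x exprn_ge0 //= exprn_ilt1 // -lt0n.
have y1 : 1 < y.
  have tr1 : 1 < t2 * rho by rewrite /t2; nra.
  by rewrite /y exprn_egt1 // -lt0n.
have [|j1 Hj1] := @exprn_le_eventually R x (1 / 16 / M8) x01; first by rewrite divr_gt0.
have [j2 Hj2] := @exprn_ge_eventually R y 4 y1.
pose j := (maxn j1 j2).+1; pose n := (m * j)%N.
have n0 : (0 < n)%N by rewrite muln_gt0 m0.
have small : N ((k t1%:C * a) ^+ n) <= 1 / 16 / M8.
  apply: le_trans (Hj1 j _); last by rewrite ltnW // ltnS leq_maxl.
  rewrite exprMn -rmorphXn; apply: le_trans (snZ sN _ _) _.
  rewrite cabsX cabs_real (ger0_norm (ltW t10)) /n /x -exprM exprMn.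
  rewrite ler_wpM2l ?exprn_ge0 ?(ltW t10) // !exprM.
  apply: le_trans (snX sN _ _) _.
  by rewrite lerXn2r ?nnegrE ?N_ge0 ?exprn_ge0 ?(ltW s0) // ltW.
have big : 4 <= N ((k t2%:C * a) ^+ n).
  rewrite exprMn -rmorphXn (snZE sN) cabsX cabs_real (ger0_norm (ltW t20)).
  apply: le_trans (Hj2 j _) _; first by rewrite ltnW // ltnS leq_maxr.
  rewrite /y -exprM exprMn ler_wpM2l ?exprn_ge0 ?(ltW t20) //; exact: lo.
pose B := \sum_(i < n) (t2 * N a) ^+ i + 1.
have B1 : 1 <= B.
  by rewrite /B lerDr sumr_ge0 // => i _; rewrite exprn_ge0 // mulr_ge0 ?N_ge0 ?(ltW t20).
have B0 : 0 < B by lra.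
have geomB t (l : 'I_n) : 0 <= t <= t2 ->
   N (\sum_(i < n) (k (t%:C * omega R n ^+ l) * a) ^+ i) <= B.
  move=> /andP[t0 tt2]; apply: le_trans (sn_sum sN _ _ _) _.
  apply: le_trans (_ : \sum_(i < n) (t2 * N a) ^+ i <= _); last by rewrite lerDl.
  apply: ler_sum => i _; apply: le_trans (snX sN _ _) _.
  rewrite lerXn2r ?nnegrE ?N_ge0 ?mulr_ge0 ?N_ge0 ?(ltW t20) //.
  apply: le_trans (snZ sN _ _) _.
  rewrite cabsM cabsX cabs_omega expr1n mulr1 cabs_real ger0_norm //.
  by rewrite ler_wpM2r ?N_ge0.
(* The precision [d] is chosen after [n], because the bound [B] for the geometric sums grows with
   [n]; this is possible since the bound [M8] for the resolvents does not depend on their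
   precision. *)
pose d := Order.min (1 / 16 / B) (1 / 32 / M8).
have d0 : 0 < d by rewrite lt_min; apply/andP; split; rewrite divr_gt0 //; lra.
have dB : d * B <= 1 / 16.
  have : d <= 1 / 16 / B by rewrite ge_min lexx.
  by rewrite ler_pdivlMr.
have dM : 2 * M8 * d <= 1 / 16.
  have : d <= 1 / 32 / M8 by rewrite ge_min lexx orbT.
  by rewrite ler_pdivlMr // => h; lra.
have pick t : `|t - rho^-1| <= kp -> exists r : 'I_n -> A, forall l : 'I_n, N (r l) <= M8 /\
    N (1 - (1 - k (t%:C * omega R n ^+ l) * a) * r l) <= d.
  move=> ht; suff H (l : 'I_n) : exists r, N r <= M8 /\
    N (1 - (1 - k (t%:C * omega R n ^+ l) * a) * r) <= d.
    by have [r Hr] := choice H; exists r.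
  rewrite omegaX; apply: fine => //.
  have np : 0 < n%:R :> R by rewrite ltr0n.
  have p0 := pi_gt0 R.
  rewrite divr_ge0 ?mulr_ge0 ?ler0n ?(ltW p0) ?(ltW np) //= ler_pdivrMr // ler_pM2l ?mulr_gt0 //.
  by rewrite ler_nat ltnW.
have [|r1 Hr1] := pick t1.
  by rewrite /t1 [rho^-1 - kp]addrC addrK normrN ger0_norm // ltW.
have [|r2 Hr2] := pick t2.
  by rewrite /t2 [rho^-1 + kp]addrC addrK ger0_norm // ltW.
have t12 : 0 <= t1 <= t2 by rewrite (ltW t10) /= /t1 /t2; lra.
have t22 : 0 <= t2 <= t2 by rewrite (ltW t20) /= lexx.
have := mean_resolvent n0 (fun l => (Hr1 l).2) (fun l => geomB t1 l t12).
have := mean_resolvent n0 (fun l => (Hr2 l).2) (fun l => geomB t2 l t22).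
set R1 := _ * \sum_(l < n) r1 l; set R2 := _ * \sum_(l < n) r2 l.
set q1 := (k t1%:C * a) ^+ n in small *; set q2 := (k t2%:C * a) ^+ n in big *.
move=> h2 h1.
have R1M : N R1 <= M8 by apply: (sn_mean sN) => // l; case: (Hr1 l).
have R12 : N (R1 - R2) <= 1 / 4 + 1 / 16.
  rewrite /R1 /R2 -mulrBr -sumrB; apply: (sn_mean sN) => // l.
  apply: le_trans (resolvent_diff (Hr1 l).1 (Hr2 l).1 (Hr1 l).2 (Hr2 l).2) _.
  apply: lerD => //.
  rewrite -mulrBl cabsM cabsX cabs_omega expr1n mulr1 -realcB cabs_real.
  have -> : `|t1 - t2| = 2 * kp.
    by rewrite distrC ger0_norm; rewrite /t1 /t2; lra.
  by apply: le_trans kpE; rewrite /E; lra.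
have h3 : N (R1 - 1) <= 1 / 8.
  have -> : R1 - 1 = R1 * q1 - (1 - R1 * (1 - q1)) by ring.
  apply: le_trans (snB sN _ _) _.
  have : N (R1 * q1) <= M8 * (1 / 16 / M8).
    by apply: le_trans (snM sN _ _) _; apply: ler_pM; rewrite ?N_ge0.
  by rewrite mulrCA divff ?gt_eqF // mulr1; lra.
have h4 : N (1 - R2) <= 7 / 16.
  have -> : 1 - R2 = (R1 - R2) - (R1 - 1) by ring.
  by apply: le_trans (snB sN _ _) _; lra.
have h5 : N (1 - q2) <= 1 + 1 / 16 + 7 / 16 * N (1 - q2).
  have {1}-> : 1 - q2 = 1 - (1 - R2 * (1 - q2)) + (1 - R2) * (1 - q2) by ring.
  apply: le_trans (snD sN _ _) _; apply: lerD.
    by apply: le_trans (snB sN _ _) _; rewrite (sn1 sN); lra.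
  by apply: le_trans (snM sN _ _) _; rewrite ler_wpM2r ?N_ge0.
have : N q2 <= 1 + N (1 - q2).
  have {1}-> : q2 = 1 - (1 - q2) by ring.
  by apply: le_trans (snB sN _ _) _; rewrite (sn1 sN).
lra.
Qed.

End SpectralPoint.

Section JointSpectralPoint.
Variables (R : realType) (A : comPzRingType) (k : {rmorphism R[i] -> A}).
Local Notation C := R[i].
Variable N : A -> R.
Hypothesis sN : seminorm k N.
Implicit Types (x y a c e r : A) (z u : C).

Local Notation N_ge0 := (sn_ge0 sN).

Lemma near1_pow x t m : N x <= t -> t <= 1 -> N ((1 - x) ^+ m - 1) <= (2 ^+ m - 1) * t.
Proof.
move=> xt t1; have x0 := N_ge0 x; have tp : 0 <= t by apply: le_trans xt.
elim: m => [|m IH]; first by rewrite !expr0 subrr (sn0 sN) subrr mul0r.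
have -> : (1 - x) ^+ m.+1 - 1 = ((1 - x) ^+ m - 1) * (1 - x) - x by rewrite exprS; ring.
apply: le_trans (snB sN _ _) _.
have h1 : N (1 - x) <= 2 by apply: le_trans (snB sN _ _) _; rewrite (sn1 sN); lra.
have h2 : N (((1 - x) ^+ m - 1) * (1 - x)) <= (2 ^+ m - 1) * t * 2.
  by apply: le_trans (snM sN _ _) _; apply: ler_pM; rewrite ?N_ge0.
rewrite exprS; lra.
Qed.

(** After refinement [a * c'] is so close to 1 that its power still has norm at least 1/2, while the
    bound [D] on [c'] does not depend on the exponent. So the powers of [a] decay at most
    geometrically. This settles spectral radius 0, which [rickart] excludes. *)
Lemma lower_growth_of_inverse a c : N (1 - a * c) < 1 ->
  exists2 x : R, 0 < x & forall m, x ^+ m <= N (a ^+ m).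
Proof.
move=> ac1; set th := N _ in ac1; have th01 : 0 <= th < 1 by rewrite N_ge0.
pose D := N c / (1 - th) + 1.
have D0 : 0 < D by rewrite ltr_wpDl // divr_ge0 ?N_ge0 //; lra.
exists (1 / 2 / D); first by rewrite !divr_gt0.
case=> [|m]; first by rewrite !expr0 (sn1 sN).
have p2 : 0 < 2 ^+ m.+2 :> R by rewrite exprn_gt0.
have [|j Hj] := @exprn_le_eventually R th (1 / 2 ^+ m.+2) th01; first by rewrite divr_gt0.
have [c' [c'N c'e]] := refine_inverse sN j (lexx (N (1 - a * c))) th01.
have {Hj}c'e := le_trans c'e (Hj _ (leqnn _)).
have e1 : N (1 - (a * c') ^+ m.+1) <= 1 / 2.
  have := near1_pow m.+1 c'e; rewrite subKr -(snN sN) opprB => h.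
  apply: le_trans (h _) _.
    rewrite ler_pdivrMr // mul1r; apply: exprn_ege1; lra.
  rewrite mul1r ler_pdivrMr // [2 ^+ m.+2]exprS; lra.
have h : 1 / 2 <= N ((a * c') ^+ m.+1).
  have : N 1 <= N (1 - (a * c') ^+ m.+1) + N ((a * c') ^+ m.+1).
    by apply: le_trans (snD sN _ _); rewrite subrK.
  by rewrite (sn1 sN); lra.
have h2 : 1 / 2 <= N (a ^+ m.+1) * D ^+ m.+1.
  apply: le_trans h _; rewrite exprMn; apply: le_trans (snM sN _ _) _.
  rewrite ler_wpM2l ?N_ge0 //; apply: le_trans (snX sN _ _) _.
  rewrite lerXn2r ?nnegrE ?N_ge0 ?(ltW D0) //; apply: le_trans c'N _.
  by rewrite lerDl.
rewrite expr_div_n ler_pdivrMr ?exprn_gt0 //; apply: le_trans h2.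
by rewrite -[leRHS]expr1 ler_wiXn2l //; lra.
Qed.

(** The supremum [rho] of all admissible [eta] is $\inf_{m\ge1} N(a^m)^{1/m}$, the spectral radius.
    It is itself admissible, and its maximality is the upper growth condition of [rickart]. *)
Lemma spectral_point a (eta : R) : 0 <= eta -> (forall m, eta ^+ m <= N (a ^+ m)) ->
  exists z, eta <= cabs z /\ forall c, 1 <= N (1 - (k z - a) * c).
Proof.
move=> eta0 Heta.
pose S := [set x : R | 0 <= x /\ forall m, x ^+ m <= N (a ^+ m)].
have Seta : S eta by [].
have hS : has_sup S.
  split; first by exists eta.
  by exists (N a) => x [x0 /(_ 1%N)]; rewrite !expr1.
pose rho := sup S.
have etarho : eta <= rho by apply: sup_upper_bound.
have rho0 : 0 <= rho by apply: le_trans etarho.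
have lo m : rho ^+ m <= N (a ^+ m).
  rewrite leNgt; apply/negP => h.
  case: m h => [|m]; first by rewrite !expr0 (sn1 sN) ltxx.
  move=> h; have rp : 0 < rho.
    rewrite lt_neqAle rho0 andbT; apply/eqP => r0; move: h.
    by rewrite -r0 expr0n /= ltNge N_ge0.
  pose b := N (a ^+ m.+1) / rho ^+ m.+1.
  have b1 : b < 1 by rewrite ltr_pdivrMr ?exprn_gt0 // mul1r.
  (* With this [d], Bernoulli gives $(1-d)^{m+1}\ge(1+b)/2>b$, so a member of [S] above $\rho(1-d)$
     already violates its own defining inequality. *)
  pose d := (1 - b) / (2 * m.+1%:R).
  have m0 : 0 < m.+1%:R :> R by rewrite ltr0n.
  have d0 : 0 < d by rewrite divr_gt0 ?mulr_gt0 //; lra.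
  have md : m.+1%:R * d = (1 - b) / 2 by rewrite /d; field; rewrite gt_eqF.
  have m1 : 1 <= m.+1%:R :> R by rewrite ler1n.
  have b0 : 0 <= b by rewrite divr_ge0 ?N_ge0 // exprn_ge0.
  have d1 : d <= 1 by nra.
  have bern j : 1 - j%:R * d <= (1 - d) ^+ j.
    elim: j => [|j IH]; first by rewrite mul0r subr0 expr0.
    have jd : 0 <= j%:R * (d * d) by apply: mulr_ge0 => //; apply: mulr_ge0; apply: ltW.
    have : (1 - d) * (1 - j%:R * d) <= (1 - d) * (1 - d) ^+ j by rewrite ler_wpM2l //; lra.
    by rewrite -exprS -natr1; lra.
  have [|x [x0 Hx] xr] := sup_adherent (_ : 0 < rho * d) hS; first by rewrite mulr_gt0.
  have xr' : rho * (1 - d) <= x by rewrite mulrBr mulr1; apply: ltW.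
  have : (rho * (1 - d)) ^+ m.+1 <= N (a ^+ m.+1).
    apply: le_trans (Hx _); rewrite lerXn2r ?nnegrE ?mulr_ge0 //; lra.
  rewrite exprMn -ler_pdivlMl ?exprn_gt0 // mulrC -/b.
  by have := bern m.+1; lra.
have [rp|] := ltP 0 rho; last first.
  move=> r0; have {r0}r0 : rho = 0 by apply/eqP; rewrite eq_le r0.
  exists 0; split; first by rewrite cabs0 -r0.
  move=> c; rewrite leNgt; apply/negP; rewrite rmorph0 sub0r -mulrNN opprK.
  move=> /lower_growth_of_inverse [x x0 Hx].
  have : x <= rho by apply: sup_upper_bound => //; split => //; apply: ltW.
  by rewrite r0 leNgt x0.
have [|z [zr Hz]] := rickart sN rp lo; last by exists z; rewrite zr.
move=> s rs; apply: contrapT => nex.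
have : s <= rho.
  apply: sup_upper_bound => //; split; first by lra.
  case=> [|m]; first by rewrite !expr0 (sn1 sN).
  by rewrite leNgt; apply/negP => h; apply: nex; exists m.+1.
lra.
Qed.

(** The quotient seminorm modulo the ideal generated by [b], kept on the original ring so that
    quotients can be iterated without changing type. *)
Definition qnorm b x : R := inf [set N (x + b * c) | c in setT].

Lemma qnorm_has_inf b x : has_inf [set N (x + b * c) | c in setT].
Proof.
split; first by exists (N (x + b * 0)); exists 0.
by exists 0 => _ [c _ <-]; apply: N_ge0.
Qed.

Lemma qnorm_le b x c : qnorm b x <= N (x + b * c).
Proof. by apply: ge_inf; [case: (qnorm_has_inf b x) | exists c]. Qed.

Lemma qnorm_leN b x : qnorm b x <= N x.
Proof. by have := qnorm_le b x 0; rewrite mulr0 addr0. Qed.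

Lemma qnorm_lt b x (t : R) : qnorm b x < t -> exists c, N (x + b * c) < t.
Proof. by move=> /(inf_lt (qnorm_has_inf b x).1) [_ [c _ <-]]; exists c. Qed.

Lemma qnorm_ideal b c : qnorm b (b * c) = 0.
Proof.
apply/eqP; rewrite eq_le; apply/andP; split.
  by have := qnorm_le b (b * c) (- c); rewrite mulrN subrr (sn0 sN).
by apply: lb_le_inf => [|_ [d _ <-]]; [case: (qnorm_has_inf b (b * c)) | apply: N_ge0].
Qed.

(** The hypothesis says that the quotient does not collapse: 1 keeps norm 1. For [b = a - k z] it is
    what [spectral_point] provides. *)
Lemma qnorm_seminorm b : (forall c, 1 <= N (1 + b * c)) -> seminorm k (qnorm b).
Proof.
move=> H; have q0 x : 0 <= qnorm b x.
  by apply: lb_le_inf => [|_ [d _ <-]]; [case: (qnorm_has_inf b x) | apply: N_ge0].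
split => //.
- move=> x y; apply/ler_addgt0Pr => e e0.
  have [|c Hc] := @qnorm_lt b x (qnorm b x + e / 2); first by lra.
  have [|d Hd] := @qnorm_lt b y (qnorm b y + e / 2); first by lra.
  apply: le_trans (qnorm_le b (x + y) (c + d)) _.
  have -> : x + y + b * (c + d) = (x + b * c) + (y + b * d) by ring.
  by apply: le_trans (snD sN _ _) _; lra.
- move=> x y; apply/ler_addgt0Pr => e e0.
  pose D := qnorm b x + qnorm b y + 1; have Dx := q0 x; have Dy := q0 y.
  have D0 : 0 < D by rewrite /D; lra.
  pose d := Order.min 1 (e / D); have d0 : 0 < d by rewrite lt_min ltr01 divr_gt0.
  have d1 : d <= 1 by rewrite ge_min lexx.
  have dD : d * D <= e.
    have : d <= e / D by rewrite ge_min lexx orbT.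
    by rewrite ler_pdivlMr.
  have [|c Hc] := @qnorm_lt b x (qnorm b x + d); first by lra.
  have [|f Hf] := @qnorm_lt b y (qnorm b y + d); first by lra.
  apply: le_trans (qnorm_le b (x * y) (x * f + y * c + b * c * f)) _.
  have -> : x * y + b * (x * f + y * c + b * c * f) = (x + b * c) * (y + b * f) by ring.
  apply: le_trans (snM sN _ _) _.
  apply: le_trans (ler_pM (N_ge0 _) (N_ge0 _) (ltW Hc) (ltW Hf)) _.
  rewrite /D in dD; nra.
- move=> z x; have [->|z0] := eqVneq z 0.
    by rewrite rmorph0 mul0r cabs0 mul0r; apply: le_trans (qnorm_leN _ _) _; rewrite (sn0 sN).
  have zp : 0 < cabs z by rewrite cabs_gt0.
  rewrite -ler_pdivrMl //; apply: lb_le_inf => [|_ [c _ <-]]; first by case: (qnorm_has_inf b x).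
  rewrite ler_pdivrMl //; apply: le_trans (qnorm_le b _ (k z * c)) _.
  have -> : k z * x + b * (k z * c) = k z * (x + b * c) by ring.
  exact: snZ.
apply/eqP; rewrite eq_le; apply/andP; split.
  by apply: le_trans (qnorm_leN _ _) _; rewrite (sn1 sN).
by apply: lb_le_inf => [|_ [d _ <-]]; [case: (qnorm_has_inf b 1) |].
Qed.

End JointSpectralPoint.

Section Characters.
Variables (R : realType) (A : comPzRingType) (k : {rmorphism R[i] -> A}).
Local Notation C := R[i].
Implicit Types (N : A -> R).

Lemma spectral_quotient N a (eta : R) : seminorm k N -> 0 <= eta ->
  (forall m, eta ^+ m <= N (a ^+ m)) ->
  exists z N', [/\ eta <= cabs z, seminorm k N', forall x, N' x <= N x & N' (a - k z) = 0].
Proof.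
move=> sN eta0 H; have [z [ez Hz]] := spectral_point sN eta0 H.
exists z, (qnorm N (a - k z)); split => //.
- by apply: qnorm_seminorm => // c; have := Hz c; rewrite -mulNr opprB.
- by move=> x; apply: (qnorm_leN (sN)).
by rewrite -{2}[a - k z]mulr1 (qnorm_ideal sN).
Qed.

(** A substitute for a maximal ideal: one quotient per element makes it equal to a scalar. Later
    seminorms are smaller, so earlier identifications persist. *)
Lemma joint_spectral_point N (s : seq A) : seminorm k N ->
  exists (zs : seq C) N', [/\ size zs = size s, seminorm k N', forall x, N' x <= N x &
    forall i, (i < size s)%N -> N' (nth 0 s i - k (nth 0 zs i)) = 0].
Proof.
elim: s N => [|a s IH] N sN; first by exists [::], N.
have [|z [N1 [_ sN1 N1N N1a]]] := @spectral_quotient N a 0 sN (lexx 0).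
  by case=> [|m]; rewrite ?expr0 ?(sn1 sN) // expr0n /= (sn_ge0 sN).
have [zs [N2 [sz sN2 N2N N2s]]] := IH N1 sN1.
exists (z :: zs), N2; split => //=; rewrite ?sz //.
  by move=> x; apply: le_trans (N2N x) (N1N x).
case=> [|i] /= hi; last exact: N2s.
by apply/eqP; rewrite eq_le (sn_ge0 sN2) andbT -N1a.
Qed.

End Characters.

(** * Polynomial functions and hulls *)

Section PolynomialFunctions.
Variables (R : realType) (n : nat).
Local Notation C := R[i].
Local Notation Cn := 'rV[C]_n.
Implicit Types (q p : Cn -> C).

Lemma is_poly_cst (c : C) : is_poly (fun _ : Cn => c).
Proof.
exists [:: (c, fun=> 0%N)] => z; rewrite big_seq1 /monom /=.
by rewrite big1 ?mulr1 // => i _; rewrite expr0.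
Qed.

Lemma is_poly_coord (i : 'I_n) : is_poly (fun z : Cn => z 0 i).
Proof.
exists [:: (1, fun j => (j == i) : nat)] => z; rewrite big_seq1 /monom /= mul1r.
rewrite (bigD1 i) //= eqxx expr1 big1 ?mulr1 // => j /negPf ->.
by rewrite expr0.
Qed.

Lemma is_polyD q p : is_poly q -> is_poly p -> is_poly (fun z => q z + p z).
Proof. by move=> [s Hs] [t Ht]; exists (s ++ t) => z; rewrite big_cat Hs Ht. Qed.

Lemma monomM (a b : 'I_n -> nat) (z : Cn) :
  monom a z * monom b z = monom (fun i => (a i + b i)%N) z.
Proof.
by rewrite /monom -big_split; apply: eq_bigr => i _; rewrite /= -exprD.
Qed.

Lemma is_polyM q p : is_poly q -> is_poly p -> is_poly (fun z => q z * p z).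
Proof.
move=> [s Hs] [t Ht].
exists [seq (x.1 * y.1, fun i => (x.2 i + y.2 i)%N) | x <- s, y <- t] => z.
rewrite Hs Ht big_allpairs_dep mulr_suml; apply: eq_bigr => x _ /=.
rewrite mulr_sumr; apply: eq_bigr => y _ /=.
by rewrite -monomM; ring.
Qed.

Lemma is_polyZ (c : C) q : is_poly q -> is_poly (fun z => c * q z).
Proof. by apply: is_polyM; apply: is_poly_cst. Qed.

Lemma is_polyN q : is_poly q -> is_poly (fun z => - q z).
Proof.
move=> /(is_polyZ (-1)); congr is_poly.
by apply/funext => z; rewrite mulN1r.
Qed.

Lemma is_polyB q p : is_poly q -> is_poly p -> is_poly (fun z => q z - p z).
Proof. by move=> hq hp; apply: is_polyD => //; apply: is_polyN. Qed.

Lemma is_poly_sum (I : Type) (s : seq I) (F : I -> Cn -> C) :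
  (forall i, is_poly (F i)) -> is_poly (fun z => \sum_(i <- s) F i z).
Proof.
move=> H; elim: s => [|i s IH].
  by have := is_poly_cst 0; congr is_poly; apply/funext => z; rewrite big_nil.
by have := is_polyD (H i) IH; congr is_poly; apply/funext => z; rewrite big_cons.
Qed.

Lemma is_poly_ind (P : (Cn -> C) -> Prop) :
  (forall c, P (fun=> c)) -> (forall i, P (fun z => z 0 i)) ->
  (forall q p, P q -> P p -> P (fun z => q z + p z)) ->
  (forall q p, P q -> P p -> P (fun z => q z * p z)) ->
  forall q, is_poly q -> P q.
Proof.
move=> Pc Px PD PM q [s Hs].
have PX p m : P p -> P (fun z => p z ^+ m).
  move=> Pp; elim: m => [|m IH].
    by have := Pc 1; congr P; apply/funext => z; rewrite expr0.
  by have := PM _ _ Pp IH; congr P; apply/funext => z; rewrite exprS.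
have Pprod (r : seq 'I_n) (a : 'I_n -> nat) : P (fun z => \prod_(i <- r) z 0 i ^+ a i).
  elim: r => [|i r IH].
    by have := Pc 1; congr P; apply/funext => z; rewrite big_nil.
  by have := PM _ _ (PX _ (a i) (Px i)) IH; congr P; apply/funext => z; rewrite big_cons.
have -> : q = (fun z => \sum_(x <- s) x.1 * monom x.2 z) by apply/funext.
elim: s {Hs} => [|x s IH].
  by have := Pc 0; congr P; apply/funext => z; rewrite big_nil.
have := PD _ _ (PM _ _ (Pc x.1) (Pprod (index_enum _) x.2)) IH; congr P.
by apply/funext => z; rewrite big_cons.
Qed.

Definition poly_pred : {pred Cn -> C} := fun q => `[< is_poly q >].

Lemma poly_predP q : reflect (is_poly q) (q \in poly_pred).
Proof. exact: asboolP. Qed.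

(** Functions rather than formal polynomials: equality is pointwise, so ring laws and evaluation are
    inherited from the complex numbers. *)
Record polyfun := PolyFun { pval : Cn -> C; _ : pval \in poly_pred }.
HB.instance Definition _ := [isSub for pval].
HB.instance Definition _ := [Choice of polyfun by <:].

Lemma pvalP (x : polyfun) : is_poly (pval x).
Proof. by case: x => q h; apply/poly_predP. Qed.

Definition mkpoly q (hq : is_poly q) : polyfun := PolyFun (introT (poly_predP q) hq).

Lemma polyfunP (x y : polyfun) : (forall z, pval x z = pval y z) -> x = y.
Proof. by move=> H; apply: val_inj; apply/funext. Qed.

Definition padd (x y : polyfun) := mkpoly (is_polyD (pvalP x) (pvalP y)).
Definition pmul (x y : polyfun) := mkpoly (is_polyM (pvalP x) (pvalP y)).
Definition popp (x : polyfun) := mkpoly (is_polyN (pvalP x)).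
Definition pcst (c : C) : polyfun := mkpoly (is_poly_cst c).

Local Fact paddA : associative padd.
Proof. by move=> x y w; apply: polyfunP => z /=; rewrite addrA. Qed.
Local Fact paddC : commutative padd.
Proof. by move=> x y; apply: polyfunP => z /=; rewrite addrC. Qed.
Local Fact padd0 : left_id (pcst 0) padd.
Proof. by move=> x; apply: polyfunP => z /=; rewrite add0r. Qed.
Local Fact paddN : left_inverse (pcst 0) popp padd.
Proof. by move=> x; apply: polyfunP => z /=; rewrite addNr. Qed.
HB.instance Definition _ := GRing.isZmodule.Build polyfun paddA paddC padd0 paddN.

Local Fact pmulA : associative pmul.
Proof. by move=> x y w; apply: polyfunP => z /=; rewrite mulrA. Qed.
Local Fact pmulC : commutative pmul.
Proof. by move=> x y; apply: polyfunP => z /=; rewrite mulrC. Qed.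
Local Fact pmul1 : left_id (pcst 1) pmul.
Proof. by move=> x; apply: polyfunP => z /=; rewrite mul1r. Qed.
Local Fact pmulDl : left_distributive pmul padd.
Proof. by move=> x y w; apply: polyfunP => z /=; rewrite mulrDl. Qed.
HB.instance Definition _ := GRing.Zmodule_isComPzRing.Build polyfun pmulA pmulC pmul1 pmulDl.

Lemma pvalD (x y : polyfun) z : pval (x + y) z = pval x z + pval y z.
Proof. by []. Qed.

Lemma pvalN (x : polyfun) z : pval (- x) z = - pval x z.
Proof. by []. Qed.

Lemma pvalB (x y : polyfun) z : pval (x - y) z = pval x z - pval y z.
Proof. by []. Qed.

Lemma pvalM (x y : polyfun) z : pval (x * y) z = pval x z * pval y z.
Proof. by []. Qed.

Lemma pval1 z : pval 1 z = 1.
Proof. by []. Qed.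

Lemma pvalX (x : polyfun) m z : pval (x ^+ m) z = pval x z ^+ m.
Proof. by elim: m => [|m IH]; rewrite ?expr0 ?pval1 // !exprS pvalM IH. Qed.

Lemma pcst_zmod_morphism : zmod_morphism pcst.
Proof. by move=> x y; apply: polyfunP => z; rewrite pvalB. Qed.

Lemma pcst_monoid_morphism : monoid_morphism pcst.
Proof. by split => [|x y]; apply: polyfunP => z; rewrite ?pval1 ?pvalM. Qed.

HB.instance Definition _ := GRing.isZmodMorphism.Build _ _ pcst pcst_zmod_morphism.
HB.instance Definition _ := GRing.isMonoidMorphism.Build _ _ pcst pcst_monoid_morphism.

Definition pcoord (i : 'I_n) : polyfun := mkpoly (is_poly_coord i).

End PolynomialFunctions.

Section Hulls.
Variables (R : realType) (n : nat).
Local Notation C := R[i].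
Local Notation Cn := 'rV[C]_n.
Implicit Types (K : set Cn) (z w : Cn).

Definition nrm z : R := \sum_i cabs (z 0 i).

Lemma nrm_ge0 z : 0 <= nrm z.
Proof. by apply: sumr_ge0 => i _; apply: cabs_ge0. Qed.

Lemma nrmD z w : nrm (z + w) <= nrm z + nrm w.
Proof.
by rewrite /nrm -big_split; apply: ler_sum => i _; rewrite mxE; apply: cabsD.
Qed.

Lemma nrmZ (c : C) z : nrm (c *: z) = cabs c * nrm z.
Proof. by rewrite /nrm mulr_sumr; apply: eq_bigr => i _; rewrite mxE cabsM. Qed.

Lemma nrmN z : nrm (- z) = nrm z.
Proof. by rewrite -scaleN1r nrmZ cabsN cabs1 mul1r. Qed.

Lemma nrm0 : nrm 0 = 0.
Proof. by rewrite /nrm big1 // => i _; rewrite mxE cabs0. Qed.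

Lemma nrmB z w : nrm (z - w) = nrm (w - z).
Proof. by rewrite -nrmN opprB. Qed.

Lemma cabs_le_nrm z i : cabs (z 0 i) <= nrm z.
Proof.
rewrite /nrm (bigD1 i) //= lerDl; apply: sumr_ge0 => j _; exact: cabs_ge0.
Qed.

Definition bounded_nrm K := exists B, forall z, K z -> nrm z <= B.

Lemma is_poly_bounded (q : Cn -> C) (B : R) : is_poly q ->
  exists M, forall z, nrm z <= B -> cabs (q z) <= M.
Proof.
pose P (q : Cn -> C) := exists M, forall z, nrm z <= B -> cabs (q z) <= M.
move: q; apply: (@is_poly_ind R n P).
- by move=> c; exists (cabs c).
- by move=> i; exists B => z; apply: le_trans (cabs_le_nrm _ _).
- move=> q p [M HM] [L HL]; exists (M + L) => z zB.
  by apply: le_trans (cabsD _ _) _; apply: lerD; [apply: HM | apply: HL].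
move=> q p [M HM] [L HL]; exists (M * L) => z zB; rewrite cabsM.
by apply: ler_pM; rewrite ?cabs_ge0 ?HM ?HL.
Qed.

(* The polynomial hull, stated without [ereal_sup] so that it also makes sense (and is empty) for an empty [K]. *)
Definition hull K : set Cn := [set x | forall q, is_poly q -> forall c,
  (forall z, K z -> cabs (q z) <= c) -> cabs (q x) <= c].

Lemma subset_hull K : K `<=` hull K.
Proof. by move=> x Kx q _ c; apply. Qed.

Lemma hull_mono K L : K `<=` hull L -> hull K `<=` hull L.
Proof. by move=> KL x hx q hq c Hc; apply: hx => // z /KL; apply. Qed.

Lemma hull_neq0 K x : hull K x -> K !=set0.
Proof.
move=> hx; apply: contrapT => K0.
have := hx _ (is_poly_cst n (0 : C)) (-1).
move=> H; have : cabs (0 : C) <= -1 by apply: H => z Kz; case: K0; exists z.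
by rewrite cabs0; lra.
Qed.

Section SupNorm.
Variable K : set Cn.
Hypotheses (K0 : K !=set0) (Kb : bounded_nrm K).
Implicit Types (x y : polyfun R n).

Definition supn x : R := sup [set cabs (pval x z) | z in K].

Lemma supn_has_sup x : has_sup [set cabs (pval x z) | z in K].
Proof.
split; first by case: K0 => z Kz; exists (cabs (pval x z)); exists z.
have [B HB] := Kb; have [M HM] := is_poly_bounded B (pvalP x).
by exists M => _ [z Kz <-]; apply: HM; apply: HB.
Qed.

Lemma le_supn x z : K z -> cabs (pval x z) <= supn x.
Proof. by move=> Kz; apply: sup_upper_bound (supn_has_sup x) _ _; exists z. Qed.

Lemma supn_le x c : (forall z, K z -> cabs (pval x z) <= c) -> supn x <= c.
Proof.
move=> H; apply: ge_sup; first by case: (supn_has_sup x).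
by move=> _ [z Kz <-]; apply: H.
Qed.

Lemma hull_supn x z : hull K z -> cabs (pval x z) <= supn x.
Proof. by move=> hz; apply: hz (pvalP x) _ _ => w; apply: le_supn. Qed.

Lemma supn_seminorm : seminorm (@pcst R n) supn.
Proof.
have s0 x : 0 <= supn x.
  by case: K0 => z Kz; apply: le_trans (le_supn x Kz); apply: cabs_ge0.
split => //.
- move=> x y; apply: supn_le => z Kz; rewrite pvalD.
  by apply: le_trans (cabsD _ _) _; apply: lerD; apply: le_supn.
- move=> x y; apply: supn_le => z Kz; rewrite pvalM cabsM.
  by apply: ler_pM; rewrite ?cabs_ge0 ?le_supn.
- move=> c x; apply: supn_le => z Kz; rewrite pvalM cabsM.
  by apply: ler_pM; rewrite ?cabs_ge0 ?le_supn.
apply/eqP; rewrite eq_le; apply/andP; split.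
  by apply: supn_le => z Kz; rewrite pval1 cabs1.
by case: K0 => z Kz; have := le_supn 1 Kz; rewrite pval1 cabs1.
Qed.

End SupNorm.

(** First [q] is identified with a scalar [t] of modulus at least [eta], then every coordinate with
    a scalar; these scalars form [x]. By induction on [p], the final seminorm vanishes on
    [p - p(x)], so evaluation at [x] is dominated by [N] and [q(x) = t]. *)
Lemma seminorm_point (N : polyfun R n -> R) (q : polyfun R n) (eta : R) :
  seminorm (@pcst R n) N -> 0 <= eta -> (forall m, eta ^+ m <= N (q ^+ m)) ->
  exists x : Cn, (forall p, cabs (pval p x) <= N p) /\ eta <= cabs (pval q x).
Proof.
move=> sN eta0 H; have [t [N1 [et sN1 N1N N1q]]] := spectral_quotient sN eta0 H.
have [zs [N2 [sz sN2 N2N1 N2s]]] :=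
  joint_spectral_point [seq pcoord R i | i <- enum 'I_n] sN1.
rewrite size_map size_enum_ord in sz N2s.
pose x : Cn := \row_i nth 0 zs i; exists x.
have coord i : N2 (pcoord R i - pcst n (x 0 i)) = 0.
  have := N2s i (ltn_ord i); rewrite mxE (nth_map i) ?size_enum_ord //.
  by rewrite nth_ord_enum.
have N2ev p : N2 (p - pcst n (pval p x)) = 0.
  pose P (f : Cn -> C) := exists hf : is_poly f, N2 (mkpoly hf - pcst n (f x)) = 0.
  suff [hf Hf] : P (pval p) by rewrite -{}Hf; congr (N2 (_ - _)); apply: polyfunP.
  have le0 y : N2 y <= 0 -> N2 y = 0 by move=> y0; apply/eqP; rewrite eq_le y0 (sn_ge0 sN2).
  apply: (@is_poly_ind R n P) (pvalP p).
  - by move=> c; exists (is_poly_cst n c); rewrite -/(pcst n c) subrr (sn0 sN2).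
  - by move=> i; exists (is_poly_coord R i); apply: coord.
  - move=> f g [hf Hf] [hg Hg]; exists (is_polyD hf hg); apply: le0.
    have -> : mkpoly (is_polyD hf hg) - pcst n (f x + g x) =
        (mkpoly hf - pcst n (f x)) + (mkpoly hg - pcst n (g x)).
      by apply: polyfunP => z; rewrite !(pvalD, pvalN) /=; ring.
    by apply: le_trans (snD sN2 _ _) _; rewrite Hf Hg addr0.
  move=> f g [hf Hf] [hg Hg]; exists (is_polyM hf hg); apply: le0.
  have -> : mkpoly (is_polyM hf hg) - pcst n (f x * g x) =
      (mkpoly hf - pcst n (f x)) * mkpoly hg + pcst n (f x) * (mkpoly hg - pcst n (g x)).
    apply: polyfunP => z; rewrite !(pvalD, pvalN, pvalM) /=; ring.
  apply: le_trans (snD sN2 _ _) _.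
  apply: le_trans (lerD (snM sN2 _ _) (snM sN2 _ _)) _.
  by rewrite Hf Hg mul0r mulr0 addr0.
have ev p : cabs (pval p x) <= N2 p.
  have <- : N2 (pcst n (pval p x)) = cabs (pval p x) := sn_scal sN2 _.
  have -> : pcst n (pval p x) = p - (p - pcst n (pval p x)) by ring.
  by apply: le_trans (snB sN2 _ _) _; rewrite N2ev addr0.
split; first by move=> p; apply: le_trans (ev p) (le_trans (N2N1 p) (N1N p)).
have := le_trans (ev (q - pcst n t)) (N2N1 _); rewrite N1q pvalB /=.
have := cabs_lB t (pval q x); rewrite cabsB; lra.
Qed.

(** Work modulo [b = w - f]. If 1 becomes small in the quotient, then high powers of [1 + b * c],
    which is 1 modulo [b], are small on [K] and exponent 1 suffices. Otherwise the quotient seminorm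
    is genuine: if no power of [q] became small in it, [seminorm_point] would give a point of the
    hull with [f = w] and [|q| >= e]. *)
Lemma small_power_mod K (f q : polyfun R n) (w : C) (e : R) :
  K !=set0 -> bounded_nrm K -> 0 < e ->
  (forall x, hull K x -> pval f x = w -> cabs (pval q x) < e) ->
  exists m H G, [/\ (0 < m)%N, q ^+ m = H + (pcst n w - f) * G & supn K H < e ^+ m].
Proof.
move=> K0 Kb e0 Hq; have sN := supn_seminorm K0 Kb.
set b := pcst n w - f.
have [[c Hc]|nc] := pselect (exists c, supn K (1 + b * c) < 1).
  have t01 : 0 <= supn K (1 + b * c) < 1 by rewrite (sn_ge0 sN).
  have q1 : 0 < supn K q + 1 by rewrite ltr_wpDl // (sn_ge0 sN).
  have [|j Hj] := exprn_le_eventually t01 (_ : 0 < e / 2 / (supn K q + 1)).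
    by rewrite !divr_gt0.
  exists 1%N, (q * (1 + b * c) ^+ j), (- q * (c * \sum_(i < j) (1 + b * c) ^+ i)); split => //.
    have := subrX1 (1 + b * c) j; set S := \sum_(i < j) _ => h.
    have -> : (1 + b * c) ^+ j = 1 + (1 + b * c - 1) * S by rewrite -h; ring.
    by rewrite expr1; ring.
  rewrite expr1; apply: le_lt_trans (_ : e / 2 < e); last by lra.
  apply: le_trans (snM sN _ _) _.
  apply: le_trans (_ : supn K q * (e / 2 / (supn K q + 1)) <= _).
    rewrite ler_wpM2l ?(sn_ge0 sN) //; apply: le_trans (snX sN _ _) (Hj _ _) => //.
  rewrite mulrA ler_pdivrMr //; have := sn_ge0 sN q; nra.
have sQ : seminorm (@pcst R n) (qnorm (supn K) b).
  by apply: qnorm_seminorm => // c; rewrite leNgt; apply/negP => h; apply: nc; exists c.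
have [[m Hm]|nm] := pselect (exists m, qnorm (supn K) b (q ^+ m) < e ^+ m).
  have [c Hc] := qnorm_lt sN Hm.
  exists m, (q ^+ m + b * c), (- c); split => //; last by ring.
  by case: m Hm {Hc} => // ; rewrite !expr0 (sn1 sQ) ltxx.
have [|x [Hx ex]] := seminorm_point sQ (ltW e0) (_ : forall m, e ^+ m <= _ (q ^+ m)).
  by move=> m; rewrite leNgt; apply/negP => h; apply: nm; exists m.
have hx : hull K x.
  move=> p hp c Hc; apply: le_trans (Hx (mkpoly hp)) _.
  by apply: le_trans (qnorm_leN sN _ _) _; apply: supn_le.
have fx : pval f x = w.
  have qb : qnorm (supn K) b b = 0 by rewrite -{2}[b]mulr1 (qnorm_ideal sN).
  have := Hx b; rewrite qb /b pvalB /= => h.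
  by apply/eqP; rewrite eq_sym -subr_eq0 -cabs_eq0 eq_le h cabs_ge0.
by have := Hq x hx fx; rewrite ltNge ex.
Qed.

End Hulls.

Lemma exprn_gt_affine (R : realType) (y c1 c2 : R) : 1 < y -> exists j, c1 + c2 * j%:R < y ^+ j.
Proof.
move=> y1; pose d := y - 1; have d0 : 0 < d by rewrite subr_gt0.
have bern j : 1 + j%:R * d <= y ^+ j.
  elim: j => [|j IH]; first by rewrite mul0r addr0 expr0.
  rewrite exprS -natr1; have j0 : 0 <= j%:R :> R by [].
  have h1 : y * (1 + j%:R * d) <= y * y ^+ j by rewrite ler_pM2l //; lra.
  have h2 : 0 <= j%:R * (d * d) by rewrite !mulr_ge0 // ltW.
  by move: h1; rewrite /d in h2 *; lra.
pose a1 := `|c1|; pose a2 := `|c2|.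
have a10 : 0 <= a1 by apply: normr_ge0.
have a20 : 0 <= a2 by apply: normr_ge0.
pose B := a1 + 2 * a2 / d + 1.
have [i Hi] := exprn_ge_eventually B y1.
have {Hi}Hi := Hi i (leqnn _).
exists (i * 2)%N; rewrite natrM exprM expr2.
have i0 : 0 <= i%:R :> R by [].
have h := bern i.
have h2 : B * (1 + i%:R * d) <= y ^+ i * y ^+ i.
  apply: ler_pM => //; last by rewrite addr_ge0 // mulr_ge0 // ltW.
  by rewrite /B !addr_ge0 // divr_ge0 ?mulr_ge0 // ltW.
apply: lt_le_trans h2.
have e : 2 * a2 / d * (i%:R * d) = 2 * a2 * i%:R by field; rewrite gt_eqF.
have h3 : 0 <= a1 * (i%:R * d) by rewrite !mulr_ge0 // ltW.
have h4 : 0 <= 2 * a2 / d by rewrite divr_ge0 ?mulr_ge0 // ltW.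
have h5 : 0 <= i%:R * d by rewrite mulr_ge0 // ltW.
have h6 : c1 <= a1 by apply: ler_norm.
have h7 : c2 * (i%:R * 2) <= a2 * (i%:R * 2) by rewrite ler_wpM2r ?mulr_ge0 // ler_norm.
have -> : B * (1 + i%:R * d) = a1 + a1 * (i%:R * d) + 2 * a2 / d + 2 * a2 / d * (i%:R * d) + 1 + i%:R * d.
  by rewrite /B; ring.
by rewrite e; lra.
Qed.

(** * The local maximum principle on hulls *)

Section LocalMaximum.
Variables (R : realType) (n : nat).
Local Notation C := R[i].
Local Notation Cn := 'rV[C]_n.
Implicit Types (K : set Cn) (z x : Cn) (f q H G : polyfun R n).

Lemma pow_mod (A : comPzRingType) (q b h g : A) j : q = h + b * g ->
  q ^+ j = h ^+ j + b * (g * \sum_(i < j) q ^+ (j.-1 - i) * h ^+ i).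
Proof.
move=> e; have := subrXX q h j; set S := \sum_(i < j) _ => hS.
have -> : q ^+ j = h ^+ j + (q ^+ j - h ^+ j) by ring.
by rewrite hS {1}e; ring.
Qed.

(* The hypothesis on [v] says that its values are the vertices of a regular [m]-gon of radius [r0]; the sum is a discrete Cauchy integral. *)
Lemma mean_cauchy (r0 : R) (t : C) m (v : 'I_m -> C) : (0 < m)%N -> 0 < r0 ->
  (forall l, v l * omega R m ^+ l = r0%:C) -> (forall l, v l != t) ->
  (m%:R^-1 * \sum_(l < m) v l / (v l - t)) * (1 - (t / r0%:C) ^+ m) = 1.
Proof.
move=> m0 r00 vE vt; rewrite -[RHS](@mean_geometric R C idfun t r0%:C^-1 m m0) /=.
rewrite -mulrA; congr (_ * _); rewrite mulr_suml; apply: eq_bigr => l _.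
have r0n : r0%:C != 0 :> C by rewrite -cabs_gt0 cabs_real gtr0_norm.
have v0 : v l != 0 by apply: contra_neq r0n => v0; rewrite -(vE l) v0 mul0r.
have ow : omega R m ^+ l = r0%:C / v l by rewrite -(vE l) mulrC mulKf.
have -> : r0%:C^-1 * omega R m ^+ l * t = t / v l.
  by rewrite ow; field; rewrite ?r0n ?v0.
have vm : (t / v l) ^+ m = (t / r0%:C) ^+ m.
  have : v l ^+ m = r0%:C ^+ m.
    by rewrite -(vE l) exprMn -exprM mulnC exprM omegaXm // expr1n mulr1.
  by rewrite !expr_div_n => ->.
have := subrX1 (t / v l) m; rewrite vm => h.
have -> : 1 - (t / r0%:C) ^+ m = (1 - t / v l) * \sum_(i < m) (t / v l) ^+ i.
  by rewrite -opprB h; ring.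
have vt' : v l - t != 0 by rewrite subr_eq0 vt.
have -> : v l / (v l - t) * ((1 - t / v l) * \sum_(i < m) (t / v l) ^+ i) =
  ((v l / (v l - t)) * (1 - t / v l)) * \sum_(i < m) (t / v l) ^+ i by ring.
suff -> : (v l / (v l - t)) * (1 - t / v l) = 1 by rewrite mul1r.
by field; rewrite ?v0 ?vt'.
Qed.

(** Run clockwise, so that the node of index [l], taken relative to [a], times [omega R m ^+ l] is
    the constant [r], as [mean_cauchy] wants. *)
Definition circ (a : C) (r th : R) : C := a + r%:C * expi (- th).

(** A decomposition at [w] also serves nearby values, the change going into [H] at the cost of the
    strict inequality there. The exponent varies with [w], but decompositions can be raised to
    powers, so a factorial absorbs all exponents up to a bound. Compactness is used twice: for a
    common exponent, then for a common bound on [G]. *)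
Lemma circle_decomposition K f q (a : C) (r0 e : R) :
  K !=set0 -> bounded_nrm K -> 0 < e -> 0 < r0 ->
  (forall x, hull K x -> cabs (pval f x - a) = r0 -> cabs (pval q x) < e) ->
  exists m M, (0 < m)%N /\ forall th, 0 <= th <= 2 * pi -> exists H G,
    [/\ q ^+ m = H + (pcst n (circ a r0 th) - f) * G, supn K H <= e ^+ m & supn K G <= M].
Proof.
move=> K0 Kb e0 r00 Hq; have sN := supn_seminorm K0 Kb.
have N0 := sn_ge0 sN.
have shift th th' H G p : p = H + (pcst n (circ a r0 th) - f) * G ->
   p = H + pcst n (circ a r0 th - circ a r0 th') * G + (pcst n (circ a r0 th') - f) * G.
  by move=> ->; rewrite rmorphB /=; ring.
have lip th th' H G : supn K (H + pcst n (circ a r0 th - circ a r0 th') * G) <=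
    supn K H + `|th' - th| * (2 * r0 * supn K G).
  apply: le_trans (snD sN _ _) _; rewrite lerD2l.
  apply: le_trans (snZ sN _ _) _; rewrite mulrA ler_wpM2r //.
  have -> : circ a r0 th - circ a r0 th' = r0%:C * (expi (- th) - expi (- th')).
    by rewrite /circ; ring.
  rewrite cabsM cabs_real gtr0_norm // mulrC.
  have := expi_lip (- th) (- th').
  have -> : `|- th - - th'| = `|th' - th| by congr `|_|; ring.
  move=> h; have : cabs (expi (- th) - expi (- th')) * r0 <= 2 * `|th' - th| * r0.
    by rewrite ler_pM2r.
  by lra.
have room th H (B : R) G : supn K H < B -> exists2 d, 0 < d & forall th', `|th' - th| < d ->
    supn K (H + pcst n (circ a r0 th - circ a r0 th') * G) < B.
  move=> HB; pose D := 2 * r0 * supn K G + 1.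
  have D0 : 0 < D by rewrite ltr_wpDl // !mulr_ge0 // ltW.
  exists ((B - supn K H) / D); first by rewrite divr_gt0 // subr_gt0.
  move=> th'; rewrite ltr_pdivlMr // => h.
  apply: le_lt_trans (lip _ _ _ _) _.
  have := normr_ge0 (th' - th); rewrite /D in h; lra.
pose P (M th : R) := forall m : nat, M <= m%:R -> exists H G,
  q ^+ m`! = H + (pcst n (circ a r0 th) - f) * G /\ supn K H < e ^+ m`!.
have [||M1 HM1] := @segment_uniform R P 0 (2 * pi).
- by move=> M M' th MM' h m Mm; apply: h; apply: le_trans Mm.
- move=> th _.
  have [|m [H [G [m0 qm Hm]]]] := @small_power_mod R n K f q (circ a r0 th) e K0 Kb e0.
    move=> x hx fx; apply: Hq => //.
    by rewrite fx /circ addrC addKr cabsM cabs_expi cabs_real mulr1 gtr0_norm.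
  have [d d0 Hd] := room th H _ G Hm.
  exists m%:R, d; split => // th' hth' m'; rewrite ler_nat => mm'.
  have /dvdnP [j hj] : (m %| m'`!)%N by rewrite dvdn_fact // m0.
  have j0 : (0 < j)%N by rewrite lt0n; apply/eqP => j0; have := fact_gt0 m'; rewrite hj j0.
  rewrite hj mulnC !exprM (pow_mod j (shift _ th' _ _ _ qm)).
  eexists; eexists; split; first by reflexivity.
  apply: le_lt_trans (snX sN _ _) _.
  by rewrite ltrXn2r ?nnegrE ?N0 ?exprn_ge0 ?(ltW e0) // -?lt0n ?Hd.
pose m := (Num.truncn M1).+1.
have hm : M1 <= m%:R by apply: ltW; apply: truncnS_gt.
pose P2 (M th : R) := exists H G, [/\ q ^+ m`! = H + (pcst n (circ a r0 th) - f) * G,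
  supn K H <= e ^+ m`! & supn K G <= M].
exists m`!.
have key th : 0 <= th <= 2 * pi -> exists M d, 0 < d /\ forall th', `|th' - th| < d -> P2 M th'.
  move=> hth; have [H [G [qm Hm]]] := HM1 th hth m hm.
  have [d d0 Hd] := room th H _ G Hm.
  exists (supn K G), d; split => // th' hth'.
  by exists (H + pcst n (circ a r0 th - circ a r0 th') * G), G; split;
     [apply: shift | apply/ltW/Hd |].
have [|M HM] := segment_uniform _ key; last by exists M; split; [apply: fact_gt0 |].
move=> M M' th MM' [H [G [h1 h2 h3]]]; exists H, G; split => //.
exact: le_trans h3 MM'.
Qed.

(* The cut-off polynomials [F_j], Cauchy means over the circle [|w - a| = r0] of the quotients
   [(Q^j - H_w^j) / (w - f)], are close to [Q^j] at points with [|f - a| < r0], and small where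
   [|f - a| > r0] or [|Q| <= E]. *)
Theorem strip_maximum K f q (a : C) (r1 r2 e : R) x :
  bounded_nrm K -> 0 <= r1 -> r1 < r2 -> 0 <= e ->
  (forall z, K z -> cabs (pval f z - a) <= r2 -> cabs (pval q z) <= e) ->
  (forall z, hull K z -> r1 <= cabs (pval f z - a) <= r2 -> cabs (pval q z) <= e) ->
  hull K x -> cabs (pval f x - a) <= r2 -> cabs (pval q x) <= e.
Proof.
move=> Kb r10 r12 e0 HK HX hx fx; have K0 := hull_neq0 hx.
have [xr1|xr1] := lerP r1 (cabs (pval f x - a)); first by apply: HX; rewrite ?xr1.
rewrite leNgt; apply/negP => eq.
pose e' := (e + cabs (pval q x)) / 2.
have e'0 : 0 < e' by rewrite /e'; lra.
pose r0 := (r1 + r2) / 2; have r00 : 0 < r0 by rewrite /r0; lra.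
have [|m [M [m0 HM]]] := @circle_decomposition K f q a r0 e' K0 Kb e'0 r00.
  move=> z hz fz; apply: le_lt_trans (_ : e < e'); last by rewrite /e'; lra.
  by apply: HX => //; rewrite fz /r0; lra.
have sN := supn_seminorm K0 Kb; have N0 := sn_ge0 sN.
pose Q := q ^+ m; pose E := e' ^+ m.
have E0 : 0 < E by rewrite exprn_gt0.
have M0 : 0 <= M.
  have [|H [G [_ _]]] := HM 0; last by apply: le_trans.
  by rewrite lexx mulr_ge0 // ltW // pi_gt0.
pose Y := cabs (pval q x) ^+ m / E.
have Y1 : 1 < Y.
  rewrite /Y ltr_pdivlMr // mul1r /E ltrXn2r ?nnegrE ?cabs_ge0 ?(ltW e'0) // -?lt0n //.
  by rewrite /e'; lra.
(* [D] bounds the Cauchy kernel [v / (v - t)] at points whose distance to the circle is at least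
   [(r2 - r1) / 2]. *)
pose D := r0 / ((r2 - r1) / 2).
have D0 : 0 <= D by rewrite divr_ge0 // ?ltW // /r0; lra.
(* The bound for [F] on [K] is $E^j$ times an affine function of [j], the linear term counting the
   summands of [S]; $Y^j$ must beat it. *)
have [j Hj] := @exprn_gt_affine R Y (2 * (1 + D + D)) (2 * (r0 * M / E)) Y1.
pose B := supn K Q.
(* So many nodes are taken that the factor [W] compensates $|Q|^j\le B^j$ at the points of [K] with
   $|f-a|>r2$. *)
have [|N HN] := @exprn_ge_eventually R (r2 / r0) (1 + (B / E) ^+ j).
  by rewrite ltr_pdivlMr // /r0; lra.
pose p := N.+1; have {HN}HN := HN p (leqnSn _).
have p0 : 0 < p%:R :> R by rewrite ltr0n.
pose th (l : 'I_p) : R := 2 * pi * l%:R / p%:R.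
have thr l : 0 <= th l <= 2 * pi.
  have pp := pi_gt0 R.
  rewrite /th divr_ge0 ?mulr_ge0 ?ler0n ?(ltW pp) //= ler_pdivrMr // ler_pM2l ?mulr_gt0 //.
  by rewrite ler_nat ltnW.
have HMl l : exists HG : polyfun R n * polyfun R n,
  [/\ Q = HG.1 + (pcst n (circ a r0 (th l)) - f) * HG.2, supn K HG.1 <= E & supn K HG.2 <= M].
  by have [H [G h]] := HM _ (thr l); exists (H, G).
have [HG HHG] := choice HMl.
pose H l := (HG l).1; pose G l := (HG l).2.
pose v l : C := r0%:C * expi (- th l).
pose S l := \sum_(i < j) Q ^+ (j.-1 - i) * H l ^+ i.
pose F := pcst n p%:R^-1 * \sum_l pcst n (v l) * (G l * S l).
have vE l : v l * omega R p ^+ l = r0%:C.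
  by rewrite omegaX /v -mulrA -expiD addNr expi0 mulr1.
have cv l : cabs (v l) = r0 by rewrite cabsM cabs_real cabs_expi mulr1 gtr0_norm.
have FE z : pval F z = p%:R^-1 * \sum_l v l * pval (G l * S l) z.
  rewrite /F pvalM; congr (_ * _).
  have : forall s : seq 'I_p, pval (\sum_(l <- s) pcst n (v l) * (G l * S l)) z =
     \sum_(l <- s) v l * pval (G l * S l) z.
    elim=> [|l s IH]; last by rewrite !big_cons pvalD pvalM IH.
    by rewrite !big_nil -[0 in LHS](subrr (1 : polyfun R n)) pvalB subrr.
  by move=> ->.
have gS z l : (v l - (pval f z - a)) * pval (G l * S l) z = pval Q z ^+ j - pval (H l) z ^+ j.
  have [Ql _ _] := HHG l.
  have := pow_mod j Ql; rewrite -/(G l) -/(H l) -/(S l) => h.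
  have : pval (Q ^+ j) z = pval (H l ^+ j + (pcst n (circ a r0 (th l)) - f) * (G l * S l)) z by rewrite -h.
  rewrite pvalX pvalD pvalX pvalM pvalB /= => ->.
  by rewrite /circ -/(v l); ring.
have HE z l : hull K z -> cabs (pval (H l) z) <= E.
  by move=> hz; have [_ h _] := HHG l; apply: le_trans h; apply: hull_supn.
have GM z l : hull K z -> cabs (pval (G l) z) <= M.
  by move=> hz; have [_ _ h] := HHG l; apply: le_trans h; apply: hull_supn.
have far z : hull K z -> (r2 - r1) / 2 <= `|cabs (pval f z - a) - r0| ->
   cabs (pval F z * (1 - ((pval f z - a) / r0%:C) ^+ p) - pval Q z ^+ j) <=
   E ^+ j * D * cabs (1 - ((pval f z - a) / r0%:C) ^+ p).
  move=> hz; set t := pval f z - a => ht.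
  have vt l : (r2 - r1) / 2 <= cabs (v l - t).
    apply: le_trans ht _; rewrite ler_norml -{1}(cv l) -(cv l).
    by have := cabs_lB (v l) t; have := cabs_lB t (v l); rewrite (cabsB t); lra.
  have r120 : 0 < (r2 - r1) / 2 by rewrite divr_gt0 //; lra.
  have vt0 l : v l - t != 0 by rewrite -cabs_gt0; apply: lt_le_trans (vt l).
  have vtn l : v l != t by rewrite -subr_eq0.
  have mc := mean_cauchy (ltn0Sn N) r00 vE vtn.
  have -> : pval F z * (1 - (t / r0%:C) ^+ p) - pval Q z ^+ j =
     - (p%:R^-1 * \sum_l v l / (v l - t) * pval (H l) z ^+ j) * (1 - (t / r0%:C) ^+ p).
    have -> : pval F z = p%:R^-1 * \sum_l v l / (v l - t) * (pval Q z ^+ j - pval (H l) z ^+ j).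
      rewrite FE; congr (_ * _); apply: eq_bigr => l _.
      by rewrite -gS -/t; field; rewrite vt0.
    have -> : p%:R^-1 * \sum_l v l / (v l - t) * (pval Q z ^+ j - pval (H l) z ^+ j) =
      (p%:R^-1 * \sum_l v l / (v l - t)) * pval Q z ^+ j -
      p%:R^-1 * \sum_l v l / (v l - t) * pval (H l) z ^+ j.
      rewrite -mulrA -mulrBr; congr (_ * _).
      by rewrite mulr_suml -sumrB; apply: eq_bigr => l _; ring.
    have alg (W c A u : C) : c * W = 1 -> (c * u - A) * W - u = - A * W.
      move=> cW; have -> : (c * u - A) * W - u = (c * W) * u - A * W - u by ring.
      by rewrite cW; ring.
    exact: alg.
  rewrite cabsM cabsN ler_wpM2r ?cabs_ge0 //.
  rewrite cabsM cabsV cabs_nat mulrC ler_pdivrMr //.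
  apply: le_trans (cabs_sum _ _ _) _.
  apply: le_trans (_ : \sum_(l < p) E ^+ j * D <= _); last by rewrite sumr_const card_ord mulr_natr.
  apply: ler_sum => l _; rewrite cabsM mulrC; apply: ler_pM; rewrite ?cabs_ge0 //.
    by rewrite cabsX lerXn2r ?nnegrE ?cabs_ge0 ?(ltW E0) // HE.
  rewrite cabsM cabsV cv /D ler_wpM2l ?(ltW r00) // lef_pV2 ?qualifE //=.
  by rewrite cabs_gt0.
pose bd := E ^+ j * (1 + D + r0 * M / E * j%:R).
have FK z : K z -> cabs (pval F z) <= bd.
  move=> Kz; have hz := subset_hull Kz.
  have Ej : 0 < E ^+ j by rewrite exprn_gt0.
  have cME : 0 <= r0 * M / E * j%:R by apply: mulr_ge0 => //; apply: divr_ge0; [apply: mulr_ge0 => //|]; apply: ltW.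
  have [fz|fz] := lerP (cabs (pval f z - a)) r2.
    (* Close to the circle the kernel is useless. There [F] is bounded through [G l * S l], each of
       the [j] summands of [S l] being at most $E^{j-1}$. *)
    have QE : cabs (pval Q z) <= E.
      rewrite pvalX cabsX /E lerXn2r ?nnegrE ?cabs_ge0 ?(ltW e'0) //.
      by apply: le_trans (HK z Kz fz) _; rewrite /e'; lra.
    apply: le_trans (_ : r0 * M * (E ^+ j.-1 * j%:R) <= _).
      rewrite FE cabsM cabsV cabs_nat mulrC ler_pdivrMr //.
      apply: le_trans (cabs_sum _ _ _) _.
      apply: le_trans (_ : \sum_(l < p) r0 * M * (E ^+ j.-1 * j%:R) <= _); last by rewrite sumr_const card_ord -[X in X <= _]mulr_natr.
      apply: ler_sum => l _; rewrite cabsM cv -mulrA ler_wpM2l ?(ltW r00) //.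
      rewrite pvalM cabsM; apply: ler_pM; rewrite ?cabs_ge0 ?GM //.
      have -> : pval (S l) z = \sum_(i < j) pval Q z ^+ (j.-1 - i) * pval (H l) z ^+ i.
        rewrite /S; elim: (index_enum _) => [|i s IH]; last first.
          by rewrite !big_cons pvalD pvalM [pval (Q ^+ _) z]pvalX [pval (H l ^+ _) z]pvalX IH.
        by rewrite !big_nil -[0 in LHS](subrr (1 : polyfun R n)) pvalB subrr.
      apply: le_trans (cabs_sum _ _ _) _.
      apply: le_trans (_ : \sum_(i < j) E ^+ j.-1 <= _); last by rewrite sumr_const card_ord mulr_natr.
      apply: ler_sum => i _; rewrite cabsM !cabsX.
      have -> : E ^+ j.-1 = E ^+ (j.-1 - i) * E ^+ i.
        by rewrite -exprD subnK // -ltnS; case: (j) i => [|j'] [i Hi].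
      by apply: ler_pM; rewrite ?exprn_ge0 ?cabs_ge0 // lerXn2r ?nnegrE ?cabs_ge0 ?(ltW E0) // HE.
    rewrite /bd; case: (j) => [|j'].
      by rewrite !mulr0 expr0; lra.
    have -> : r0 * M * (E ^+ j'.+1.-1 * j'.+1%:R) = E ^+ j'.+1 * (r0 * M / E * j'.+1%:R).
      by rewrite exprS /=; field; rewrite gt_eqF.
    by rewrite ler_wpM2l ?exprn_ge0 ?(ltW E0) //; lra.
  have := far z hz; set t := pval f z - a in fz *; set W := 1 - _.
  have tr : (B / E) ^+ j <= cabs W.
    have h1 : cabs ((t / r0%:C) ^+ p) - 1 <= cabs W.
      by have := cabs_lB ((t / r0%:C) ^+ p) 1; rewrite cabs1 cabsB.
    apply: le_trans h1; rewrite lerBrDl; apply: le_trans HN _.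
    rewrite cabsX cabsM cabsV cabs_real gtr0_norm // lerXn2r ?nnegrE //.
    - by rewrite divr_ge0 ?(ltW r00) //; lra.
    - by rewrite divr_ge0 ?(ltW r00) ?cabs_ge0.
    by rewrite ler_pM2r ?invr_gt0 // ltW.
  have W0 : 0 < cabs W.
    rewrite lt_neqAle cabs_ge0 andbT; apply/eqP => W0.
    have : 1 < cabs ((t / r0%:C) ^+ p).
      rewrite cabsX exprn_egt1 // cabsM cabsV cabs_real gtr0_norm //.
      by rewrite ltr_pdivlMr // /r0; lra.
    have : 1 = (t / r0%:C) ^+ p by apply/eqP; rewrite -subr_eq0 -cabs_eq0 -/W -W0.
    by move=> <-; rewrite cabs1 ltxx.
  move=> H1; have {}H1 : cabs (pval F z * W - pval Q z ^+ j) <= E ^+ j * D * cabs W.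
    by apply: H1; rewrite ler_normr /r0; apply/orP; left; lra.
  have QB : cabs (pval Q z ^+ j) <= E ^+ j * cabs W.
    have Bz : cabs (pval Q z) <= B by apply: le_supn.
    apply: le_trans (_ : E ^+ j * (B / E) ^+ j <= _); last by rewrite ler_wpM2l ?(ltW Ej).
    by rewrite -exprMn mulrCA divff ?gt_eqF // mulr1 cabsX lerXn2r ?nnegrE ?cabs_ge0 ?N0.
  have : cabs (pval F z) * cabs W <= E ^+ j * (1 + D) * cabs W.
    rewrite -cabsM; have := cabs_lB (pval F z * W) (pval Q z ^+ j).
    lra.
  rewrite ler_pM2r // => h; apply: le_trans h _.
  by rewrite ler_wpM2l ?(ltW Ej) // lerDl.
have Fx : cabs (pval F x) <= bd by apply: hx (pvalP F) _ FK.
have := far x hx; set t := pval f x - a in fx xr1 *; set W := 1 - _.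
have W2 : cabs W <= 2.
  have : cabs W <= cabs 1 + cabs ((t / r0%:C) ^+ p) by rewrite -[X in _ + X]cabsN; apply: cabsD.
  suff : cabs ((t / r0%:C) ^+ p) <= 1 by rewrite cabs1; lra.
  rewrite cabsX exprn_ile1 ?cabs_ge0 // cabsM cabsV cabs_real gtr0_norm //.
  by rewrite ler_pdivrMr // mul1r /r0; lra.
move=> H1; have {}H1 : cabs (pval F x * W - pval Q x ^+ j) <= E ^+ j * D * cabs W.
  by apply: H1; rewrite ler_normr /r0; apply/orP; right; lra.
have Ej : 0 < E ^+ j by rewrite exprn_gt0.
have QY : cabs (pval Q x ^+ j) = Y ^+ j * E ^+ j.
  by rewrite -exprMn /Y divfK ?gt_eqF // cabsX pvalX cabsX.
have h2 : cabs (pval Q x ^+ j) <= (cabs (pval F x) + E ^+ j * D) * cabs W.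
  have := cabs_lB (pval Q x ^+ j) (pval F x * W); rewrite cabsB cabsM; lra.
have h3 : (cabs (pval F x) + E ^+ j * D) * cabs W <= (bd + E ^+ j * D) * 2.
  have FD0 : 0 <= cabs (pval F x) + E ^+ j * D.
    by apply: addr_ge0; [apply: cabs_ge0 | apply: mulr_ge0 => //; apply: ltW].
  by apply: ler_pM; rewrite ?cabs_ge0 // lerD2r.
have h4 : E ^+ j * Y ^+ j <= E ^+ j * (2 * (1 + D + D) + 2 * (r0 * M / E) * j%:R).
  move: (le_trans h2 h3); rewrite QY /bd.
  set u1 := r0 * M / E * j%:R.
  have -> : 2 * (r0 * M / E) * j%:R = 2 * u1 by rewrite /u1; ring.
  by lra.
by move: h4; rewrite ler_pM2l // leNgt Hj.
Qed.

End LocalMaximum.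

Section PolydiscMaximum.
Variables (R : realType) (n : nat).
Local Notation C := R[i].
Local Notation Cn := 'rV[C]_n.
Implicit Types (K L : set Cn) (z x p : Cn).

Lemma hull_bounded K : bounded_nrm K -> bounded_nrm (hull K).
Proof.
move=> [B HB]; exists (\sum_(i < n) B) => z hz.
apply: ler_sum => i _; apply: (hz _ (is_poly_coord R i)) => w Kw.
by apply: le_trans (cabs_le_nrm _ _) (HB _ Kw).
Qed.

Lemma bounded_nrm_sub K L : K `<=` L -> bounded_nrm L -> bounded_nrm K.
Proof. by move=> KL [B HB]; exists B => z /KL /HB. Qed.

(** [strip_maximum] for a coordinate function, rephrased as membership in the hull of a smaller set,
    the form that can be iterated. *)
Lemma hull_strip K p (r1 r2 : R) (i : 'I_n) : bounded_nrm K -> 0 <= r1 -> r1 < r2 -> hull K p ->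
  hull [set z : Cn | cabs (z 0 i - p 0 i) <= r2 /\
                (K z \/ hull K z /\ r1 <= cabs (z 0 i - p 0 i))] p.
Proof.
move=> Kb r10 r12 hp; set L := (X in hull X).
have key q c : 0 <= c -> is_poly q -> (forall z, L z -> cabs (q z) <= c) -> cabs (q p) <= c.
  move=> c0 hq Hc.
  apply: (@strip_maximum R n K (pcoord R i) (mkpoly hq) (p 0 i) r1 r2 c p) => //=.
  - by move=> z Kz zr; apply: Hc; split => //; left.
  - by move=> z hz /andP[zr1 zr2]; apply: Hc; split => //; right.
  by rewrite subrr cabs0; lra.
(* A point of the set forces [0 <= c], which [strip_maximum] requires. *)
have [z Lz] : L !=set0.
  apply: contrapT => L0.
  have : cabs (1 : C) <= 0.
    apply: (@key (fun=> 1)) => //; first exact: is_poly_cst.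
    by move=> z Lz; case: L0; exists z.
  by rewrite cabs1; lra.
move=> q hq c Hc; apply: key => //; apply: le_trans (Hc z Lz).
exact: cabs_ge0.
Qed.

(** One application of [hull_strip] per coordinate, each to the set produced before. Points of [K]
    survive as an alternative to the annulus condition until all coordinates are within [r2]; then
    the last hypothesis excludes them. *)
Theorem polydisc_maximum K p (r1 r2 : R) : bounded_nrm K -> 0 <= r1 -> r1 < r2 -> hull K p ->
  (forall z, K z -> exists i, r2 < cabs (z 0 i - p 0 i)) ->
  exists L, hull L p /\ forall z, L z -> [/\ hull K z,
    forall i, cabs (z 0 i - p 0 i) <= r2 & exists i, r1 <= cabs (z 0 i - p 0 i)].
Proof.
move=> Kb r10 r12 hp Kfar.
suff [L [hL HL]] : exists L, hull L p /\ forall z, L z -> [/\ hull K z,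
    forall i, i \in enum 'I_n -> cabs (z 0 i - p 0 i) <= r2 &
    K z \/ exists i, r1 <= cabs (z 0 i - p 0 i)].
  exists L; split => // z /HL [hz zr Kz].
  have zr2 i : cabs (z 0 i - p 0 i) <= r2 by apply: zr; rewrite mem_enum.
  split => //; case: Kz => [Kz|//]; have [i hi] := Kfar z Kz.
  by move: hi; rewrite ltNge zr2.
elim: (enum 'I_n) => [|i s [L [hL HL]]].
  by exists K; split => // z Kz; split => //; [apply: subset_hull | left].
have Lb : bounded_nrm L.
  by apply: bounded_nrm_sub (hull_bounded Kb) => z /HL [].
have hS := hull_strip (i := i) Lb r10 r12 hL.
exists [set z : Cn | cabs (z 0 i - p 0 i) <= r2 /\ (L z \/ hull L z /\ r1 <= cabs (z 0 i - p 0 i))].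
split; first exact: hS.
have hLK z : hull L z -> hull K z.
  by apply: hull_mono => w /HL [].
move=> z [zr2 [Lz|[hz zr1]]].
  have [hz zr h] := HL z Lz; split => // k; rewrite in_cons => /orP[/eqP ->//|]; exact: zr.
split; [exact: hLK | | by right; exists i].
move=> k; rewrite in_cons => /orP[/eqP ->//|ks].
apply: (hz _ (is_polyB (is_poly_coord R k) (is_poly_cst n (p 0 k)))) => w Lw.
by have [_ h _] := HL w Lw; apply: h.
Qed.

End PolydiscMaximum.

(** * Smoothing of Lipschitz functions *)

Section Averages.
Variables (R : realType) (n : nat).
Local Notation C := R[i].
Local Notation Cn := 'rV[C]_n.
Implicit Types (z p e : Cn) (f g psi : Cn -> R).

Definition avg (N : nat) e psi z : R := N%:R^-1 * \sum_(j < N) psi (z + e *+ j).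

Definition fdiff e psi z : R := psi (z + e) - psi z.

Lemma le_avg N e f g z : (forall j, f (z + e *+ j) <= g (z + e *+ j)) -> avg N e f z <= avg N e g z.
Proof. by move=> fg; rewrite ler_wpM2l ?invr_ge0 //; apply: ler_sum => j _. Qed.

Lemma avg_cst N e (c : R) z : (0 < N)%N -> avg N e (fun=> c) z = c.
Proof.
move=> N0; rewrite /avg sumr_const card_ord -[c *+ N]mulr_natl mulrA mulVf ?mul1r //.
by rewrite pnatr_eq0 -lt0n.
Qed.

Lemma avgD N e f g z : avg N e (fun z => f z + g z) z = avg N e f z + avg N e g z.
Proof. by rewrite /avg big_split mulrDr. Qed.

Lemma avgZ N e (c : R) f z : avg N e (fun z => c * f z) z = c * avg N e f z.
Proof. by rewrite /avg -mulr_sumr mulrCA. Qed.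

Lemma avg_shift N e f y z : avg N e (fun z => f (z + y)) z = avg N e f (z + y).
Proof. by rewrite /avg; congr (_ * _); apply: eq_bigr => j _; rewrite addrAC. Qed.

Lemma avg_bounds N e f (a b : R) z : (0 < N)%N -> (forall z, a <= f z <= b) ->
  a <= avg N e f z <= b.
Proof.
move=> N0 H; apply/andP; split.
  by rewrite -[leLHS](avg_cst e a z N0); apply: le_avg => j; case/andP: (H (z + e *+ j)).
by rewrite -[leRHS](avg_cst e b z N0); apply: le_avg => j; case/andP: (H (z + e *+ j)).
Qed.

(** Telescoping: a short step of the average is an [N]-th of a long difference of [f]. So one
    average acts like one integration, and three of them give bounded third difference quotients. *)
Lemma fdiff_avg N e f z : (0 < N)%N ->
  avg N e f (z + e) - avg N e f z = fdiff (e *+ N) f z / N%:R.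
Proof.
move=> N0; rewrite /avg -mulrBr mulrC; congr (_ / _).
have -> : \sum_(j < N) f (z + e + e *+ j) = \sum_(j < N) f (z + e *+ j.+1).
  by apply: eq_bigr => j _; rewrite -addrA -mulrS.
rewrite -sumrB -(big_mkord xpredT (fun j => f (z + e *+ j.+1) - f (z + e *+ j))).
by rewrite telescope_sumr // mulr0n addr0.
Qed.

(** Newton's forward difference formula to second order. With $x=m/N$ one has $\binom
    m2/N^2=x^2/2-x/(2N)$, the coefficient of [f2 0]. *)
Lemma newton_sequence (N : nat) (f0 f1 f2 : nat -> R) (B : R) : (0 < N)%N -> 0 <= B ->
  (forall m, f0 m.+1 - f0 m = f1 m / N%:R) -> (forall m, f1 m.+1 - f1 m = f2 m / N%:R) ->
  (forall m, `|f2 m.+1 - f2 m| <= B / N%:R) ->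
  forall m, `|f0 m - (f0 0%N + (m%:R / N%:R) * f1 0%N +
     ((m%:R / N%:R) ^+ 2 / 2 - (m%:R / N%:R) / (2 * N%:R)) * f2 0%N)| <= B * (m%:R / N%:R) ^+ 3.
Proof.
move=> N0 B0 H0 H1 H2 m; set i := N%:R^-1 in H0 H1 H2 *.
have i0 : 0 < i by rewrite invr_gt0 ltr0n.
have h2 k : `|f2 k - f2 0%N| <= B * (k%:R * i).
  elim: k => [|k IH]; first by rewrite subrr normr0 mul0r mulr0.
  have -> : f2 k.+1 - f2 0%N = (f2 k.+1 - f2 k) + (f2 k - f2 0%N) by ring.
  apply: le_trans (ler_normD _ _) _; rewrite -natr1.
  by apply: le_trans (lerD (H2 k) IH) _; rewrite mulrDl mul1r mulrDr addrC.
have h1 k : `|f1 k - (f1 0%N + k%:R * i * f2 0%N)| <= B * (k%:R * i) ^+ 2.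
  elim: k => [|k IH]; first by rewrite !mul0r addr0 subrr normr0 expr0n mulr0.
  have -> : f1 k.+1 - (f1 0%N + k.+1%:R * i * f2 0%N) =
     (f1 k - (f1 0%N + k%:R * i * f2 0%N)) + (f2 k - f2 0%N) * i.
    by have := H1 k; rewrite -natr1; lra.
  apply: le_trans (ler_normD _ _) _; rewrite normrM [`|i|]gtr0_norm //.
  have : `|f2 k - f2 0%N| * i <= B * (k%:R * i) * i by rewrite ler_pM2r.
  have k0 : 0 <= B * k%:R * (i * i) by rewrite !mulr_ge0 // ltW.
  have k1 : 0 <= B * (i * i) by rewrite !mulr_ge0 // ltW.
  by move: IH; rewrite -natr1 !expr2; lra.
elim: m => [|k IH]; first by rewrite !mul0r !expr0n /= !mul0r subrr mul0r !addr0 subrr normr0 mulr0.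
have k0 : 0 <= k%:R :> R by [].
rewrite invfM -/i in IH *.
have -> : f0 k.+1 - (f0 0%N + k.+1%:R * i * f1 0%N +
     ((k.+1%:R * i) ^+ 2 / 2 - k.+1%:R * i * (2^-1 * i)) * f2 0%N) =
   (f0 k - (f0 0%N + k%:R * i * f1 0%N + ((k%:R * i) ^+ 2 / 2 - k%:R * i * (2^-1 * i)) * f2 0%N))
   + (f1 k - (f1 0%N + k%:R * i * f2 0%N)) * i.
  by have := H0 k; rewrite -natr1 !expr2; lra.
apply: le_trans (ler_normD _ _) _; rewrite normrM [`|i|]gtr0_norm //.
have : `|f1 k - (f1 0%N + k%:R * i * f2 0%N)| * i <= B * (k%:R * i) ^+ 2 * i by rewrite ler_pM2r.
have e1 : 0 <= B * (k%:R * k%:R) * (i * i * i) by rewrite !mulr_ge0 // ltW.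
have e2 : 0 <= B * k%:R * (i * i * i) by rewrite !mulr_ge0 // ltW.
have e3 : 0 <= B * (i * i * i) by rewrite !mulr_ge0 // ltW.
by move: IH; rewrite -natr1 !exprS !expr0; lra.
Qed.

Variables (N : nat) (E : nat -> Cn).

Fixpoint smooth (k : nat) psi : Cn -> R :=
  if k is k'.+1 then smooth k' (avg N (E k') (avg N (E k') (avg N (E k') psi))) else psi.

Lemma smooth_shift k psi y z : smooth k (fun z => psi (z + y)) z = smooth k psi (z + y).
Proof.
elim: k psi z => //= k IH psi z; rewrite -IH; congr (smooth k _ z).
apply/funext => w; rewrite -avg_shift; congr (avg _ _ _ w).
apply/funext => w'; rewrite -avg_shift; congr (avg _ _ _ w').
by apply/funext => w2; rewrite -avg_shift.
Qed.

Lemma smooth_comb k f g (a : R) z :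
  smooth k (fun z => a * (f z - g z)) z = a * (smooth k f z - smooth k g z).
Proof.
have h e f' g' : avg N e (fun z => a * (f' z - g' z)) = (fun z => a * (avg N e f' z - avg N e g' z)).
  apply/funext => w; rewrite avgZ avgD; congr (_ * (_ + _)).
  by rewrite -mulN1r -avgZ; congr (avg _ _ _ w); apply/funext => w'; rewrite mulN1r.
by elim: k f g z => //= k IH f g z; rewrite !h IH.
Qed.

Hypothesis N0 : (0 < N)%N.

Lemma smooth_bounds k psi (a b : R) : (forall z, a <= psi z <= b) ->
  forall z, a <= smooth k psi z <= b.
Proof.
elim: k psi => //= k IH psi H; apply: IH => z.
by do 3!(apply: avg_bounds => // {}z).
Qed.

Lemma smooth_norm k psi (b : R) : (forall z, `|psi z| <= b) -> forall z, `|smooth k psi z| <= b.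
Proof.
move=> H z; rewrite ler_norml; apply: smooth_bounds => w.
by rewrite -ler_norml.
Qed.

Definition quad (k : nat) (c : R) (a : nat -> R) (b : nat -> nat -> R) (t : nat -> R) : R :=
  c + \sum_(i < k) a i * t i + \sum_(i < k) \sum_(j < k) b i j * t i * t j.

Lemma norm_lin k (a t : nat -> R) D : (forall i, `|a i| <= D) -> (forall i, 0 <= t i) ->
  `|\sum_(i < k) a i * t i| <= D * \sum_(i < k) t i.
Proof.
move=> aD t0; apply: le_trans (ler_norm_sum _ _ _) _; rewrite mulr_sumr.
by apply: ler_sum => i _; rewrite normrM (ger0_norm (t0 _)) ler_wpM2r.
Qed.

Lemma norm_bilin k (b : nat -> nat -> R) (t : nat -> R) D :
  (forall i j, `|b i j| <= D) -> (forall i, 0 <= t i) ->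
  `|\sum_(i < k) \sum_(j < k) b i j * t i * t j| <= D * (\sum_(i < k) t i) ^+ 2.
Proof.
move=> bD t0; apply: le_trans (ler_norm_sum _ _ _) _.
rewrite expr2 mulrA mulr_sumr; apply: ler_sum => i _.
have -> : D * (\sum_(i < k) t i) * t i = t i * (D * \sum_(i < k) t i) by ring.
have -> : \sum_(j < k) b i j * t i * t j = t i * \sum_(j < k) b i j * t j.
  by rewrite mulr_sumr; apply: eq_bigr => j _; ring.
rewrite normrM (ger0_norm (t0 _)) ler_wpM2l //; exact: norm_lin.
Qed.

End Averages.

Section NewtonQuad.
Variables (R : realType) (n : nat).
Local Notation C := R[i].
Local Notation Cn := 'rV[C]_n.

(** What matters is that [D] depends on the number of directions only, not on [N], the steps or
    [psi]. Newton's formula in the last direction has coefficients that are smoothed in the other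
    directions, so induction expands each of them; products of total degree at least three go into
    the remainder. *)
Theorem newton_quad (k : nat) : exists2 D : R, 0 <= D &
  forall (N : nat) (E : nat -> Cn) (B : R) (psi : Cn -> R), (0 < N)%N ->
  (forall z, `|psi z| <= B) -> forall p, exists c a b,
  [/\ `|c| <= D * B, forall i, `|a i| <= D * B, forall i j, `|b i j| <= D * B &
   forall m : nat -> nat, (forall i, m i <= N)%N ->
   `|smooth N E k psi (p + \sum_(i < k) E i *+ m i) - quad k c a b (fun i => (m i)%:R / N%:R)| <=
    D * B * (\sum_(i < k) (m i)%:R / N%:R) ^+ 3].
Proof.
elim: k => [|k [D D0 IH]].
  exists 1 => // N E B psi N0 HB p; exists (psi p), (fun=> 0), (fun _ _ => 0).
  have B0 : 0 <= B by apply: le_trans (HB p).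
  rewrite mul1r normr0; split => // m _.
  by rewrite /quad !big_ord0 !addr0 subrr normr0 expr0n mulr0.
exists (8 + 28 * D); first by rewrite addr_ge0 // mulr_ge0.
move=> N E B psi N0 HB p.
have B0 : 0 <= B by apply: le_trans (HB p).
set e := E k; pose A := avg N e; pose Df := fdiff (e *+ N).
have Ab f b : (forall z, `|f z| <= b) -> forall z : Cn, `|A f z| <= b.
  by move=> H z; rewrite ler_norml; apply: avg_bounds => // w; rewrite -ler_norml.
have Dfb f b : (forall z, `|f z| <= b) -> forall z : Cn, `|Df f z| <= 2 * b.
  by move=> H z; apply: le_trans (ler_normB _ _) _; rewrite mulr_natl mulr2n lerD.
(* [psi0] to [psi3] trade the three averages in direction [e], one by one, for long differences,
   each of which at most doubles the bound. *)
pose psi0 := A (A (A psi)); pose psi1 := Df (A (A psi)); pose psi2 := Df (Df (A psi)).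
pose psi3 := Df (Df (Df psi)).
have b0 z : `|psi0 z| <= 4 * B by apply: le_trans (Ab _ B _ z) _; [do 2!apply: (Ab _ B) | lra].
have b1 z : `|psi1 z| <= 4 * B by apply: le_trans (Dfb _ B _ z) _; [do 2!apply: (Ab _ B) | lra].
have b2 z : `|psi2 z| <= 4 * B by apply: le_trans (Dfb _ (2 * B) _ z) _; [apply: (Dfb _ B); apply: (Ab _ B) | lra].
have b3 z : `|psi3 z| <= 8 * B by apply: le_trans (Dfb _ (4 * B) _ z) _; [move=> w; apply: le_trans (Dfb _ (2 * B) _ w) _; [apply: (Dfb _ B)|lra] | lra].
have d0 z : psi0 (z + e) - psi0 z = psi1 z / N%:R by apply: fdiff_avg.
have gen f g : (forall w, f (w + e) - f w = g w / N%:R) ->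
    forall w, Df f (w + e) - Df f w = Df g w / N%:R.
  move=> fg w; rewrite /Df /fdiff [w + e + _]addrAC mulrBl -(fg (w + e *+ N)) -(fg w).
  by ring.
have d1 := gen _ _ (fun w => fdiff_avg e (A psi) w N0).
have d2 := gen _ _ (gen _ _ (fun w => fdiff_avg e psi w N0)).
rewrite -/psi1 -/psi2 -/psi3 in d1 d2.
have [c0 [a0 [bb0 [c0b a0b bb0b H0]]]] := IH N E (4 * B) psi0 N0 b0 p.
have [c1 [a1 [bb1 [c1b a1b bb1b H1]]]] := IH N E (4 * B) psi1 N0 b1 p.
have [c2 [a2 [bb2 [c2b a2b bb2b H2]]]] := IH N E (4 * B) psi2 N0 b2 p.
(* The lower-order part of Newton's second coefficient, [s ^+ 2 / 2 - s * i2]. It is only linear in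
   [s], so its products with the constant and linear parts of the third expansion enter the new
   coefficients. *)
pose i2 : R := (2 * N%:R)^-1.
have Np : 0 < N%:R :> R by rewrite ltr0n.
have N1 : 1 <= N%:R :> R by rewrite ler1n.
have i20 : 0 < i2 by rewrite invr_gt0 mulr_gt0.
have i21 : i2 <= 1 / 2 by rewrite /i2 invfM mul1r ler_piMr ?invr_ge0 // invf_le1.
pose DB := D * (4 * B).
have pDB : 0 <= D * B by rewrite mulr_ge0.
have DB0 : 0 <= DB by rewrite /DB; lra.
exists c0, (fun i => if i == k then c1 - i2 * c2 else a0 i),
  (fun i j => if i == k then if j == k then c2 / 2 else 0
              else if j == k then a1 i - i2 * a2 i else bb0 i j).
have le1 (x : R) : `|x| <= DB -> `|x| <= (8 + 28 * D) * B by rewrite /DB; lra.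
have le2 (x y : R) : `|x| <= DB -> `|y| <= DB -> `|x - i2 * y| <= (8 + 28 * D) * B.
  move=> hx hy; apply: le_trans (ler_normB _ _) _; rewrite normrM (gtr0_norm i20).
  have : i2 * `|y| <= 1 * DB by apply: ler_pM => //; rewrite ?normr_ge0 ?(ltW i20) //; lra.
  rewrite /DB in hx *; lra.
split.
- exact: le1.
- by move=> i; case: eqP => _; [apply: le2 | apply: le1].
- move=> i j; case: eqP => _; case: eqP => _.
  + rewrite normrM; apply: le_trans (_ : `|c2| * 1 <= _); last by rewrite mulr1; apply: le1.
    rewrite ler_wpM2l // ger0_norm; lra.
  + by rewrite normr0 mulr_ge0 // addr_ge0 // mulr_ge0.
  + exact: le2.
  + exact: le1.
move=> m mN; pose t (i : nat) : R := (m i)%:R / N%:R.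
rewrite -/t.
have t0 i : 0 <= t i by rewrite divr_ge0.
pose T := \sum_(i < k) t i; have T0 : 0 <= T by apply: sumr_ge0.
pose s := t k; have s0 : 0 <= s := t0 k.
have s1 : s <= 1 by rewrite ler_pdivrMr // mul1r ler_nat.
have -> : \sum_(i < k.+1) t i = T + s by rewrite big_ord_recr.
set p' := p + \sum_(i < k) E i *+ m i.
have -> : p + \sum_(i < k.+1) E i *+ m i = p' + e *+ m k by rewrite big_ord_recr /= addrA.
pose S j := smooth N E k j p'.
have key : `|smooth N E k.+1 psi (p' + e *+ m k) -
   (S psi0 + s * S psi1 + (s ^+ 2 / 2 - s * i2) * S psi2)| <= 8 * B * s ^+ 3.
  have step f g : (forall z, f (z + e) - f z = g z / N%:R) -> forall l,
      smooth N E k f (p' + e *+ l.+1) - smooth N E k f (p' + e *+ l) = smooth N E k g (p' + e *+ l) / N%:R.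
    move=> fg l; have -> : p' + e *+ l.+1 = (p' + e *+ l) + e by rewrite mulrSr addrA.
    rewrite -smooth_shift; have := smooth_comb N E k (fun z => f (z + e)) f 1 (p' + e *+ l).
    rewrite mul1r => <-.
    have := smooth_comb N E k g (fun=> 0) N%:R^-1 (p' + e *+ l).
    have -> : smooth N E k (fun=> 0) (p' + e *+ l) = 0.
      apply/eqP; rewrite -normr_le0; apply: smooth_norm => // z; by rewrite normr0.
    rewrite subr0 mulrC => <-; congr (smooth N E k _ _).
    by apply/funext => z; rewrite mul1r fg subr0 mulrC.
  have := @newton_sequence R N (fun l => smooth N E k psi0 (p' + e *+ l))
    (fun l => smooth N E k psi1 (p' + e *+ l)) (fun l => smooth N E k psi2 (p' + e *+ l))
    (8 * B) N0 _ (step _ _ d0) (step _ _ d1) _ (m k).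
  rewrite /= mulr0n addr0 -/(t k) -/s -/i2; apply; first by rewrite mulr_ge0.
  move=> l; rewrite (step _ _ d2) normrM [`|N%:R^-1|]gtr0_norm ?invr_gt0 //.
  by rewrite ler_pM2r ?invr_gt0 //; apply: smooth_norm.
have h0 := H0 m mN; have h1 := H1 m mN; have h2 := H2 m mN.
rewrite -/p' -/(S _) -/t -/T -/DB in h0 h1 h2.
have la := norm_lin k a2b t0.
have lb1 := norm_bilin k bb1b t0.
have lb2 := norm_bilin k bb2b t0.
rewrite -/T -/DB in la lb1 lb2.
have newq : quad k.+1 c0 (fun i => if i == k then c1 - i2 * c2 else a0 i)
  (fun i j => if i == k then if j == k then c2 / 2 else 0
              else if j == k then a1 i - i2 * a2 i else bb0 i j) t =
  quad k c0 a0 bb0 t + s * (c1 + \sum_(i < k) a1 i * t i) + s ^+ 2 / 2 * c2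
   - s * i2 * (c2 + \sum_(i < k) a2 i * t i).
  rewrite /quad big_ord_recr /= eqxx big_ord_recr /= big_ord_recr /= !eqxx.
  have neq (i : 'I_k) : (i == k :> nat) = false by rewrite ltn_eqF.
  have -> : \sum_(i < k) (if i == k :> nat then c1 - i2 * c2 else a0 i) * t i = \sum_(i < k) a0 i * t i.
    by apply: eq_bigr => i _; rewrite neq.
  have -> : \sum_(j < k) (if j == k :> nat then c2 / 2 else 0) * t k * t j = 0.
    by apply: big1 => j _; rewrite neq !mul0r.
  have -> : \sum_(i < k) \sum_(j < k.+1) (if i == k :> nat then if j == k :> nat then c2 / 2 else 0
      else if j == k :> nat then a1 i - i2 * a2 i else bb0 i j) * t i * t j =
     \sum_(i < k) \sum_(j < k) bb0 i j * t i * t j +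
     (s * \sum_(i < k) a1 i * t i - s * i2 * \sum_(i < k) a2 i * t i).
    rewrite !mulr_sumr -sumrB -big_split; apply: eq_bigr => i _ /=.
    rewrite big_ord_recr /= eqxx neq; congr (_ + _); last by rewrite /s; ring.
    by apply: eq_bigr => j _; rewrite neq.
  by rewrite /s; ring.
rewrite newq.
set Q0 := quad k c0 _ _ _ in h0 *; set X1 := \sum_(i < k) a1 i * t i.
set X2 := \sum_(i < k) a2 i * t i in la *.
set Y1 := \sum_(i < k) \sum_(j < k) _ in lb1; set Y2 := \sum_(i < k) \sum_(j < k) _ in lb2.
have e1 : quad k c1 a1 bb1 t = c1 + X1 + Y1 by [].
have e2 : quad k c2 a2 bb2 t = c2 + X2 + Y2 by [].
rewrite e1 in h1; rewrite e2 in h2.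
set V := smooth _ _ _ psi _ in key *.
pose q := s ^+ 2 / 2 - s * i2.
have sq : s ^+ 2 <= s by rewrite expr2 ler_piMl.
have sq0 : 0 <= s ^+ 2 by rewrite exprn_ge0.
have si : 0 <= s * i2 by rewrite mulr_ge0 // ltW.
have si1 : s * i2 <= s / 2 by rewrite ler_wpM2l //; lra.
have q1 : `|q| <= 1 by rewrite ler_norml /q; lra.
have -> : V - (Q0 + s * (c1 + X1) + s ^+ 2 / 2 * c2 - s * i2 * (c2 + X2)) =
   (V - (S psi0 + s * S psi1 + q * S psi2)) + (S psi0 - Q0) + s * (S psi1 - (c1 + X1 + Y1))
   + q * (S psi2 - (c2 + X2 + Y2)) + s * Y1 + s ^+ 2 / 2 * X2 + q * Y2.
  by rewrite /q; ring.
have T3 : 0 <= T ^+ 3 by rewrite exprn_ge0.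
have T2 : 0 <= T ^+ 2 by rewrite exprn_ge0.
have sT : (T + s) ^+ 3 = T ^+ 3 + 3 * (s * T ^+ 2) + 3 * (s ^+ 2 * T) + s ^+ 3 by ring.
have w1 : 0 <= s * T ^+ 2 by rewrite mulr_ge0.
have w2 : 0 <= s ^+ 2 * T by rewrite mulr_ge0.
have w3 : 0 <= s ^+ 3 by rewrite exprn_ge0.
have n1 : `|s * (S psi1 - (c1 + X1 + Y1))| <= DB * T ^+ 3.
  by rewrite normrM (ger0_norm s0); apply: le_trans h1; rewrite ler_piMl.
have n2 : `|q * (S psi2 - (c2 + X2 + Y2))| <= DB * T ^+ 3.
  by rewrite normrM; apply: le_trans h2; rewrite ler_piMl.
have n3 : `|s * Y1| <= DB * (s * T ^+ 2).
  by rewrite normrM (ger0_norm s0) mulrCA ler_wpM2l.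
have n4 : `|s ^+ 2 / 2 * X2| <= DB * (s ^+ 2 * T).
  rewrite normrM (ger0_norm (_ : 0 <= s ^+ 2 / 2)) ?divr_ge0 // mulrCA; apply: ler_pM => //.
    by rewrite divr_ge0.
  by lra.
have n5 : `|q * Y2| <= DB * (s * T ^+ 2).
  rewrite normrM mulrCA; apply: ler_pM => //; rewrite ler_norml /q; lra.
have p1 : 0 <= DB * T ^+ 3 by rewrite mulr_ge0.
have p2 : 0 <= DB * (s * T ^+ 2) by rewrite mulr_ge0.
have p3 : 0 <= DB * (s ^+ 2 * T) by rewrite mulr_ge0.
have p4 : 0 <= DB * s ^+ 3 by rewrite mulr_ge0.
have p5 : 0 <= B * (s * T ^+ 2) by rewrite mulr_ge0.
have p6 : 0 <= B * (s ^+ 2 * T) by rewrite mulr_ge0.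
have p7 : 0 <= B * T ^+ 3 by rewrite mulr_ge0.
have tri (x y X Y : R) : `|x| <= X -> `|y| <= Y -> `|x + y| <= X + Y.
  by move=> hx hy; apply: le_trans (ler_normD _ _) _; apply: lerD.
apply: le_trans (tri _ _ _ _ (tri _ _ _ _ (tri _ _ _ _ (tri _ _ _ _ (tri _ _ _ _
  (tri _ _ _ _ key h0) n1) n2) n3) n4) n5) _.
rewrite sT.
have -> : (8 + 28 * D) * B = 8 * B + 7 * DB by rewrite /DB; ring.
have -> : (8 * B + 7 * DB) * (T ^+ 3 + 3 * (s * T ^+ 2) + 3 * (s ^+ 2 * T) + s ^+ 3) =
  8 * (B * T ^+ 3) + 24 * (B * (s * T ^+ 2)) + 24 * (B * (s ^+ 2 * T)) + 8 * B * s ^+ 3 +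
  7 * (DB * T ^+ 3) + 21 * (DB * (s * T ^+ 2)) + 21 * (DB * (s ^+ 2 * T)) + 7 * (DB * s ^+ 3).
  by ring.
lra.
Qed.

End NewtonQuad.

Section Smoothing.
Variables (R : realType) (n : nat).
Local Notation C := R[i].
Local Notation Cn := 'rV[C]_n.
Implicit Types (z p y e w : Cn) (psi : Cn -> R).

Lemma nrm_sum (I : Type) (s : seq I) (F : I -> Cn) : nrm (\sum_(i <- s) F i) <= \sum_(i <- s) nrm (F i).
Proof.
elim/big_rec2: _ => [|i y1 y2 _ le12]; first by rewrite nrm0.
by apply: le_trans (nrmD _ _) _; rewrite lerD2l.
Qed.

Lemma nrmMn e j : nrm (e *+ j) = j%:R * nrm e.
Proof. by rewrite -scaler_nat nrmZ cabs_nat. Qed.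

Definition lipschitz_nrm (L : R) psi := forall z w, `|psi z - psi w| <= L * nrm (z - w).

(** The sub-mean inequality over regular polygons instead of circles. The error term is that of a
    Riemann sum of a Lipschitz function and disappears as [m] grows; in this form finite averages
    preserve the inequality. *)
Definition submean (rho c0 : R) psi := forall (a b : Cn) m, nrm a + nrm b <= rho -> (0 < m)%N ->
  psi a <= m%:R^-1 * \sum_(l < m) psi (a + omega R m ^+ l *: b) + c0 * nrm b / m%:R.

Lemma mulrn3S (x : R) k : x *+ (3 * k.+1) = x *+ (3 * k) + x + x + x.
Proof. by rewrite mulnS !addSn add0n !mulrSr. Qed.

Section OneDirection.
Variables (N : nat) (N0 : (0 < N)%N) (e : Cn) (h : R) (eh : nrm e * N%:R <= h).

Local Lemma shift_le (j : 'I_N) : nrm (e *+ j) <= h.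
Proof.
rewrite nrmMn mulrC; apply: le_trans eh; rewrite ler_wpM2l ?nrm_ge0 // ler_nat.
exact: ltnW.
Qed.

Lemma avg_lip L psi : lipschitz_nrm L psi -> lipschitz_nrm L (avg N e psi).
Proof.
move=> H z w; rewrite /avg -mulrBr -sumrB normrM ger0_norm ?invr_ge0 //.
rewrite mulrC ler_pdivrMr ?ltr0n //; apply: le_trans (ler_norm_sum _ _ _) _.
apply: le_trans (_ : \sum_(j < N) L * nrm (z - w) <= _); last by rewrite sumr_const card_ord mulr_natr.
apply: ler_sum => j _; apply: le_trans (H _ _) _.
by rewrite opprD addrACA subrr addr0.
Qed.

Lemma avg_close L psi z : 0 <= L -> lipschitz_nrm L psi -> `|avg N e psi z - psi z| <= L * h.
Proof.
move=> L0 H; rewrite -{1}(avg_cst e (psi z) z N0) /avg -mulrBr -sumrB normrM ger0_norm ?invr_ge0 //.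
rewrite mulrC ler_pdivrMr ?ltr0n //; apply: le_trans (ler_norm_sum _ _ _) _.
apply: le_trans (_ : \sum_(j < N) L * h <= _); last by rewrite sumr_const card_ord mulr_natr.
apply: ler_sum => j _; apply: le_trans (H _ _) _.
by rewrite addrC addKr ler_wpM2l // shift_le.
Qed.

(** Translates of [psi] satisfy the same inequality, on a ball that shrinks by the largest
    translation. *)
Lemma avg_submean rho c0 psi : submean rho c0 psi -> submean (rho - h) c0 (avg N e psi).
Proof.
move=> H a b m ab m0.
have -> : m%:R^-1 * (\sum_(l < m) avg N e psi (a + omega R m ^+ l *: b)) + c0 * nrm b / m%:R =
   avg N e (fun a => m%:R^-1 * \sum_(l < m) psi (a + omega R m ^+ l *: b) + c0 * nrm b / m%:R) a.
  rewrite avgD avg_cst // avgZ; congr (_ * _ + _).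
  rewrite /avg -mulr_sumr exchange_big /=; congr (_ * _).
  by apply: eq_bigr => j _; apply: eq_bigr => l _; rewrite addrAC.
rewrite /avg ler_wpM2l ?invr_ge0 //; apply: ler_sum => j _; apply: H => //.
have := nrmD a (e *+ j); have := shift_le j; lra.
Qed.

End OneDirection.

Section AllDirections.
Variables (N : nat) (N0 : (0 < N)%N) (E : nat -> Cn) (h : R).
Hypothesis Eh : forall i, nrm (E i) * N%:R <= h.

Lemma smooth_lip L k psi : lipschitz_nrm L psi -> lipschitz_nrm L (smooth N E k psi).
Proof. by elim: k psi => //= k IH psi H; apply: IH; do 3!apply: (avg_lip N0). Qed.

Lemma smooth_close L k psi z : 0 <= L -> lipschitz_nrm L psi ->
  `|smooth N E k psi z - psi z| <= L * h *+ (3 * k).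
Proof.
move=> L0; elim: k psi => [|k IH] psi H; first by rewrite /= subrr normr0.
rewrite [smooth _ _ _ _]/=.
set f1 := avg N (E k) psi; set f2 := avg N (E k) f1; set f3 := avg N (E k) f2.
have l1 : lipschitz_nrm L f1 by apply: avg_lip.
have l2 : lipschitz_nrm L f2 by apply: avg_lip.
have l3 : lipschitz_nrm L f3 by apply: avg_lip.
have h1 := avg_close N0 (Eh k) z L0 H.
have h2 := avg_close N0 (Eh k) z L0 l1.
have h3 := avg_close N0 (Eh k) z L0 l2.
have -> : smooth N E k f3 z - psi z = (smooth N E k f3 z - f3 z) + (f3 z - f2 z) + (f2 z - f1 z) + (f1 z - psi z) by ring.
have tri (x x' X X' : R) : `|x| <= X -> `|x'| <= X' -> `|x + x'| <= X + X'.
  by move=> hx hy; apply: le_trans (ler_normD _ _) _; apply: lerD.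
apply: le_trans (tri _ _ _ _ (tri _ _ _ _ (tri _ _ _ _ (IH f3 l3) h3) h2) h1) _.
by rewrite mulrn3S.
Qed.

Lemma smooth_submean rho c0 k psi : submean rho c0 psi -> submean (rho - h *+ (3 * k)) c0 (smooth N E k psi).
Proof.
elim: k psi rho => [|k IH] psi rho H; first by rewrite subr0.
have -> : rho - h *+ (3 * k.+1) = (rho - h - h - h) - h *+ (3 * k).
  by rewrite mulrn3S; lra.
by apply: IH; do 3!apply: (avg_submean N0 (Eh k)).
Qed.

End AllDirections.

(** The real basis of $\mathbb C^n$: index $2j$ is $e_j$, index $2j+1$ is $ie_j$, and indices from
    $2n$ on give 0. *)
Definition dir (i : nat) : Cn := \row_j (if (j : nat) == i./2 then (if odd i then 'i else 1) else 0).

(** Complex linear forms whose real parts are the real coordinates dual to [dir]: $\mathrm{Re}\,y_j$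
    and $\mathrm{Re}(-iy_j)=\mathrm{Im}\,y_j$. This exhibits a real quadratic polynomial as one in
    real parts of holomorphic forms. *)
Definition rform (i : nat) y : C := \sum_(j < n) (if (j : nat) == i./2 then (if odd i then - 'i else 1) else 0) * y 0 j.

Lemma is_poly_rform i : is_poly (rform i).
Proof.
by apply: is_poly_sum => j; apply: is_polyZ; apply: is_poly_coord.
Qed.

Lemma rformE (j : 'I_n) y : (rform j.*2 y = y 0 j) * (rform j.*2.+1 y = - 'i * y 0 j).
Proof.
split; rewrite /rform (bigD1 j) //= ?uphalf_double ?doubleK eqxx odd_double /= big1 ?addr0 ?mul1r // => l.
  by rewrite -val_eqE /= => /negPf ->; rewrite mul0r.
by rewrite -val_eqE /= => /negPf ->; rewrite mul0r.
Qed.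

Lemma rformZ i (c : C) y : rform i (c *: y) = c * rform i y.
Proof. by rewrite /rform mulr_sumr; apply: eq_bigr => j _; rewrite mxE; ring. Qed.

Lemma cabs_i : cabs ('i : C) = 1.
Proof. by rewrite /cabs /= expr0n expr1n add0r sqrtr1. Qed.

Lemma rform_le i y (s : R) : 0 <= s -> (forall j, cabs (y 0 j) <= s) -> cabs (rform i y) <= s.
Proof.
move=> s0 ys; have [ilt|ige] := ltnP i./2 n; last first.
  rewrite /rform big1 ?cabs0 // => j _; rewrite ltn_eqF ?mul0r //.
  exact: leq_trans ige.
rewrite /rform (bigD1 (Ordinal ilt)) //= eqxx big1 ?addr0 => [|j]; last first.
  by rewrite -val_eqE /= => /negPf ->; rewrite mul0r.
by rewrite cabsM; case: odd; rewrite ?cabsN ?cabs_i ?cabs1 mul1r.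
Qed.

Lemma nrm_dir i : nrm (dir i) <= 1.
Proof.
have [ilt|ige] := ltnP i./2 n; last first.
  rewrite /nrm big1 // => j _; rewrite mxE ltn_eqF ?cabs0 //.
  exact: leq_trans ige.
rewrite /nrm (bigD1 (Ordinal ilt)) //= mxE eqxx big1 ?addr0 => [|j].
  by case: odd; rewrite ?cabs_i ?cabs1.
by rewrite -val_eqE mxE /= => /negPf ->; rewrite cabs0.
Qed.

Lemma sum_double (V : nmodType) (F : nat -> V) m : \sum_(i < m.*2) F i = \sum_(j < m) (F j.*2 + F j.*2.+1).
Proof.
elim: m => [|m IH]; first by rewrite !big_ord0.
by rewrite doubleS !big_ord_recr /= IH addrA.
Qed.

Lemma dir_rform y : \sum_(i < n.*2) (complex.Re (rform i y))%:C *: dir i = y.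
Proof.
rewrite (sum_double (fun i => (complex.Re (rform i y))%:C *: dir i)).
apply/rowP => l; rewrite summxE (bigD1 l) //= big1 ?addr0 => [|j].
  rewrite !mxE /= uphalf_double doubleK eqxx odd_double !rformE /= mulr1.
  case: (y 0 l) => a b; apply/eqP; rewrite eq_complex /=.
  by apply/andP; split; apply/eqP; ring.
rewrite -val_eqE /= eq_sym => /negPf jl.
by rewrite !mxE /= uphalf_double doubleK jl !mulr0 addr0.
Qed.

Lemma quad_affine k c a b (al be : R) : exists c' a' b', forall t : nat -> R,
  quad k c a b (fun i => al * t i + be) = quad k c' a' b' t.
Proof.
exists (c + \sum_(i < k) a i * be + \sum_(i < k) \sum_(j < k) b i j * be * be),
  (fun i => a i * al + \sum_(j < k) (b i j + b j i) * al * be), (fun i j => b i j * al * al) => t.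
rewrite /quad.
have -> : \sum_(i < k) a i * (al * t i + be) = \sum_(i < k) a i * be + \sum_(i < k) a i * al * t i.
  by rewrite -big_split; apply: eq_bigr => i _ /=; ring.
have -> : \sum_(i < k) (a i * al + \sum_(j < k) (b i j + b j i) * al * be) * t i =
  \sum_(i < k) a i * al * t i + (\sum_(i < k) \sum_(j < k) b i j * al * be * t i +
   \sum_(i < k) \sum_(j < k) b i j * al * be * t j).
  rewrite [X in _ + (_ + X)]exchange_big -!big_split; apply: eq_bigr => i _ /=.
  rewrite mulrDl -big_split; congr (_ + _); rewrite mulr_suml; apply: eq_bigr => j _ /=; ring.
have -> : \sum_(i < k) \sum_(j < k) b i j * (al * t i + be) * (al * t j + be) =
  \sum_(i < k) \sum_(j < k) b i j * be * be + ((\sum_(i < k) \sum_(j < k) b i j * al * be * t i +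
   \sum_(i < k) \sum_(j < k) b i j * al * be * t j) + \sum_(i < k) \sum_(j < k) b i j * al * al * t i * t j).
  rewrite -!big_split; apply: eq_bigr => i _ /=; rewrite -!big_split; apply: eq_bigr => j _ /=; ring.
by ring.
Qed.

Lemma quad_close k c a b (t x : nat -> R) (D d : R) : 0 <= d ->
  (forall i, `|a i| <= D) -> (forall i j, `|b i j| <= D) ->
  (forall i, `|t i - x i| <= d) -> (forall i, 0 <= t i <= 1) -> (forall i, 0 <= x i <= 1) ->
  `|quad k c a b t - quad k c a b x| <= D * d * (k%:R + 2 * k%:R ^+ 2).
Proof.
move=> d0 aD bD txd t1 x1; have D0 : 0 <= D by apply: le_trans (aD 0%N).
have -> : quad k c a b t - quad k c a b x = \sum_(i < k) a i * (t i - x i) +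
   \sum_(i < k) \sum_(j < k) b i j * (t i * t j - x i * x j).
  have -> : \sum_(i < k) a i * (t i - x i) = \sum_(i < k) a i * t i - \sum_(i < k) a i * x i.
    by rewrite -sumrB; apply: eq_bigr => i _; ring.
  have -> : \sum_(i < k) \sum_(j < k) b i j * (t i * t j - x i * x j) =
    \sum_(i < k) \sum_(j < k) b i j * t i * t j - \sum_(i < k) \sum_(j < k) b i j * x i * x j.
    by rewrite -sumrB; apply: eq_bigr => i _; rewrite -sumrB; apply: eq_bigr => j _; ring.
  by rewrite /quad; ring.
apply: le_trans (ler_normD _ _) _; rewrite mulrDr; apply: lerD.
  apply: le_trans (ler_norm_sum _ _ _) _.
  apply: le_trans (_ : \sum_(i < k) D * d <= _); last by rewrite sumr_const card_ord mulr_natr.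
  by apply: ler_sum => i _; rewrite normrM; apply: ler_pM.
apply: le_trans (ler_norm_sum _ _ _) _.
apply: le_trans (_ : \sum_(i < k) 2 * D * d * k%:R <= _); last first.
  rewrite sumr_const card_ord -[X in X <= _]mulr_natr expr2; lra.
apply: ler_sum => i _; apply: le_trans (ler_norm_sum _ _ _) _.
apply: le_trans (_ : \sum_(j < k) 2 * D * d <= _); last by rewrite sumr_const card_ord -[X in X <= _]mulr_natr.
apply: ler_sum => j _; rewrite normrM -mulrA mulrCA; apply: ler_pM => //.
have -> : t i * t j - x i * x j = (t i - x i) * t j + x i * (t j - x j) by ring.
apply: le_trans (ler_normD _ _) _; rewrite !normrM.
have /andP[ti0 ti1] := t1 j; have /andP[xi0 xi1] := x1 i.
rewrite (ger0_norm ti0) (ger0_norm xi0).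
have := txd i; have := txd j; have := normr_ge0 (t i - x i); have := normr_ge0 (t j - x j).
set u := `|_|; set u' := `|_| => u0 u'0 ud ud'.
have : u' * t j <= d * 1 by apply: ler_pM.
have : x i * u <= 1 * d by apply: ler_pM.
lra.
Qed.

End Smoothing.

Section LocalQuadratic.
Variables (R : realType) (n : nat).
Local Notation C := R[i].
Local Notation Cn := 'rV[C]_n.

Lemma scale_realMn (r : R) (d : Cn) j : (r%:C *: d) *+ j = (r * j%:R)%:C *: d.
Proof. by rewrite -scaler_nat scalerA realcM mulrC; congr ((_ * _) *: d); rewrite rmorph_nat. Qed.

(** [newton_quad] speaks of grid points ahead of a base point. The base is moved behind [p], real
    coordinates are rescaled to the unit interval and rounded to the grid; a fine grid makes the
    rounding cost at most [eps]. *)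
Theorem local_quadratic : exists2 D : R, 0 <= D &
  forall (w : Cn -> R) (L B h s eps : R), 0 <= L -> 0 < h -> 0 < s -> s <= h / 8 -> 0 < eps ->
  (forall z, `|w z| <= B) -> lipschitz_nrm L w ->
  exists N E, [/\ (0 < N)%N, forall i, nrm (E i : Cn) * N%:R <= h &
  forall p : Cn, exists c a b, forall y : Cn, (forall j, cabs (y 0 j) <= s) ->
   `|smooth N E n.*2 w (p + y) - quad n.*2 c a b (fun i => complex.Re (rform i y))| <=
     D * B * (s / h) ^+ 3 + eps].
Proof.
have [D0 D00 HD] := @newton_quad R n n.*2; set k := n.*2 in HD *.
exists (D0 * (k%:R * 4) ^+ 3); first by rewrite mulr_ge0 // exprn_ge0 // mulr_ge0.
move=> w L B h s eps L0 h0 s0 sh eps0 wB wL.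
have B0 : 0 <= B by apply: le_trans (wB 0).
pose C2 := L * (k%:R * h) + D0 * B * (k%:R + 2 * k%:R ^+ 2).
have C20 : 0 <= C2.
  rewrite addr_ge0 ?mulr_ge0 ?(ltW h0) // addr_ge0 // mulr_ge0 // exprn_ge0 //.
(* The three summands serve, in order, to keep the indices [m i] below [N], to give $1/N\le s/h$,
   and to make the rounding error $C_2/N$ at most [eps]. *)
pose N := (Num.truncn (8 + h / s + C2 / eps)).+1.
have hN : 8 + h / s + C2 / eps < N%:R by apply: truncnS_gt.
have hs0 : 0 <= h / s by rewrite divr_ge0 ?ltW.
have Ce0 : 0 <= C2 / eps by apply: divr_ge0 => //; apply: ltW.
have N0 : 0 < N%:R :> R by rewrite ltr0n.
pose E i : Cn := (h / N%:R)%:C *: dir R n i.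
have hN0 : 0 <= h / N%:R by rewrite divr_ge0 ?ltW.
have EN i : nrm (E i) * N%:R <= h.
  rewrite nrmZ cabs_real ger0_norm // mulrAC divfK ?gt_eqF //.
  by rewrite ler_piMr ?nrm_dir // ltW.
exists N, E; split => // p.
have iN : N%:R^-1 <= s / h.
  have : h / s < N%:R by lra.
  rewrite ltr_pdivrMr // => h1.
  by rewrite ler_pdivlMr // mulrC ler_pdivrMr // mulrC ltW.
have C2N : C2 / N%:R <= eps.
  have : C2 / eps < N%:R by lra.
  by rewrite ltr_pdivrMr // => h1; rewrite ler_pdivrMr // mulrC ltW.
(* [q] steps of length [h / N] exceed [s], so the grid based at [p0] surrounds [p] by at least [s]
   in every real direction. *)
pose q := (Num.truncn (s * N%:R / h)).+1.
have q1 : s * N%:R / h < q%:R by apply: truncnS_gt.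
have snh : 0 <= s * N%:R / h by rewrite divr_ge0 ?mulr_ge0 ?ltW.
have q2 : q%:R <= s * N%:R / h + 1.
  by rewrite -natr1 lerD2r; have := truncn_itv snh => /andP[].
have snh8 : s * N%:R / h <= N%:R / 8.
  rewrite ler_pdivrMr //; have : s * N%:R <= h / 8 * N%:R by rewrite ler_pM2r.
  lra.
pose p0 := p - \sum_(i < k) E i *+ q.
have [c [a [b [cb ab bb HQ]]]] := HD N E B w (ltn0Sn _) wB p0.
have [c' [a' [b' Hq]]] := quad_affine k c a b h^-1 (q%:R / N%:R).
exists c', a', b' => y ys; rewrite -Hq.
pose sg i := complex.Re (rform i y).
have sgs i : `|sg i| <= s by apply: le_trans (cabs_Re _) (rform_le i (ltW s0) ys).
pose x i := h^-1 * sg i + q%:R / N%:R.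
pose m i := Num.truncn (N%:R * x i).
have NxE i : N%:R * x i = sg i * N%:R / h + q%:R.
  by rewrite /x; field; rewrite !gt_eqF.
have sgN i : `|sg i * N%:R / h| <= s * N%:R / h.
  rewrite normrM normfV (gtr0_norm h0) ler_pM2r ?invr_gt0 //.
  by rewrite normrM (gtr0_norm N0) ler_pM2r.
have Nx0 i : 0 <= N%:R * x i by rewrite NxE; have := sgN i; rewrite ler_norml; lra.
have Nx1 i : N%:R * x i <= s * N%:R / h + q%:R by rewrite NxE; have := sgN i; rewrite ler_norml; lra.
have x0 i : 0 <= x i <= 1.
  have := Nx0 i; rewrite pmulr_rge0 // => -> /=.
  by rewrite -(ler_pM2l N0) mulr1; have := Nx1 i; lra.
have mx i : (m i)%:R <= N%:R * x i < (m i)%:R + 1.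
  have := truncn_itv (Nx0 i); by rewrite -/(m i) -natr1.
have mN i : (m i <= N)%N.
  by rewrite -(ler_nat R); have := mx i; have := Nx1 i; lra.
pose t i : R := (m i)%:R / N%:R.
have tx i : `|t i - x i| <= N%:R^-1.
  have -> : t i - x i = ((m i)%:R - N%:R * x i) / N%:R by rewrite /t; field; rewrite gt_eqF.
  rewrite normrM [`|N%:R^-1|]gtr0_norm ?invr_gt0 // ler_piMl ?invr_ge0 ?(ltW N0) //.
  by have := mx i; rewrite ler_norml; lra.
have t1 i : 0 <= t i <= 1.
  by rewrite /t divr_ge0 //= ler_pdivrMr // mul1r ler_nat.
have tsh i : t i <= 4 * (s / h).
  have := tx i; rewrite ler_norml => /andP[_ h1].
  have h2 : x i <= 2 * (s / h) + N%:R^-1.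
    rewrite -(ler_pM2l N0); apply: le_trans (Nx1 i) _.
    have -> : N%:R * (2 * (s / h) + N%:R^-1) = 2 * (s * N%:R / h) + 1 by field; rewrite !gt_eqF.
    by lra.
  by lra.
have HQm := HQ m mN.
have c1 : `|quad k c a b t - quad k c a b x| <= D0 * B * N%:R^-1 * (k%:R + 2 * k%:R ^+ 2).
  by apply: quad_close => //; rewrite invr_ge0 ltW.
have c2 : `|smooth N E k w (p + y) - smooth N E k w (p0 + \sum_(i < k) E i *+ m i)| <= L * (k%:R * h) / N%:R.
  have sl : lipschitz_nrm L (smooth N E k w) by apply: smooth_lip.
  apply: le_trans (sl _ _) _.
  rewrite -mulrA ler_wpM2l //.
  have -> : p + y - (p0 + \sum_(i < k) E i *+ m i) = \sum_(i < k) (h * (x i - t i))%:C *: dir R n i.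
    rewrite -{1}(dir_rform y) /p0 -/k.
    rewrite -[p - _ + _]addrA opprD addrACA subrr add0r opprD opprK addrC.
    rewrite -[_ - _ + _]addrA [- _ + _]addrC addrA.
    rewrite -big_split -sumrB; apply: eq_bigr => i _ /=.
    rewrite /E !scale_realMn -/(sg i).
    rewrite -[_ *: _ + _]scalerDl -realcD -scalerBl -realcB; congr (_%:C *: _).
    by rewrite /x /t; field; rewrite !gt_eqF.
  apply: le_trans (nrm_sum _ _) _.
  apply: le_trans (_ : \sum_(i < k) h / N%:R <= _); last first.
    by rewrite sumr_const card_ord -[X in X <= _]mulr_natr; lra.
  apply: ler_sum => i _; rewrite nrmZ cabs_real normrM (gtr0_norm h0) -[leRHS]mulr1.
  apply: ler_pM; rewrite ?nrm_ge0 ?mulr_ge0 ?nrm_dir ?(ltW h0) // ler_wpM2l ?(ltW h0) //.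
  by rewrite distrC.
have T0 : 0 <= \sum_(i < k) t i by apply: sumr_ge0 => i _; case/andP: (t1 i).
have T1 : \sum_(i < k) t i <= k%:R * 4 * (s / h).
  apply: le_trans (_ : \sum_(i < k) 4 * (s / h) <= _); first by apply: ler_sum.
  by rewrite sumr_const card_ord -[X in X <= _]mulr_natl; lra.
have T3 : D0 * B * (\sum_(i < k) t i) ^+ 3 <= D0 * (k%:R * 4) ^+ 3 * B * (s / h) ^+ 3.
  have -> : D0 * (k%:R * 4) ^+ 3 * B * (s / h) ^+ 3 = D0 * B * (k%:R * 4 * (s / h)) ^+ 3 by ring.
  rewrite ler_wpM2l ?mulr_ge0 // lerXn2r ?nnegrE //.
  by apply: le_trans T1.
have CE : C2 / N%:R = L * (k%:R * h) / N%:R + D0 * B * N%:R^-1 * (k%:R + 2 * k%:R ^+ 2) by rewrite /C2; ring.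
have tri (z1 z2 z3 z4 X1 X2 X3 : R) : `|z1 - z2| <= X1 -> `|z2 - z3| <= X2 -> `|z3 - z4| <= X3 ->
   `|z1 - z4| <= X1 + X2 + X3.
  move=> h1 h2 h3; have -> : z1 - z4 = (z1 - z2) + (z2 - z3) + (z3 - z4) by ring.
  by do 2!(apply: le_trans (ler_normD _ _) _; apply: lerD => //).
apply: le_trans (tri _ _ _ _ _ _ _ c2 HQm c1) _.
have := T3; rewrite /t; lra.
Qed.

End LocalQuadratic.

(** * The maximum principle for plurisubharmonic functions *)

Section LipschitzMaximum.
Variables (R : realType) (n : nat).
Local Notation C := R[i].
Local Notation Cn := 'rV[C]_n.
Implicit Types (z p y : Cn).

Section QuadSplit.
Variables (k : nat) (c : R) (a : nat -> R) (b : nat -> nat -> R).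

Definition hol1 y : C := \sum_(i < k) (a i)%:C * rform i y.
Definition hol2 y : C := \sum_(i < k) \sum_(j < k) (b i j / 2)%:C * (rform i y * rform j y).
Definition levi y : R := \sum_(i < k) \sum_(j < k) b i j / 2 * complex.Re (rform i y * (rform j y)^*).

(* [Re A * Re B = (Re (A * B) + Re (A * B^* )) / 2] splits a real quadratic form into the real part of a holomorphic one and a circular one. *)
Lemma quad_split y : quad k c a b (fun i => complex.Re (rform i y)) =
  c + complex.Re (hol1 y + hol2 y) + levi y.
Proof.
rewrite ReD [complex.Re (hol1 y)]Re_sum [complex.Re (hol2 y)]Re_sum /quad /levi.
have -> : \sum_(i < k) complex.Re ((a i)%:C * rform i y) = \sum_(i < k) a i * complex.Re (rform i y).
  by apply: eq_bigr => i _; rewrite Re_realM.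
have -> : \sum_(i < k) \sum_(j < k) b i j * complex.Re (rform i y) * complex.Re (rform j y) =
   \sum_(i < k) complex.Re (\sum_(j < k) (b i j / 2)%:C * (rform i y * rform j y)) +
   \sum_(i < k) \sum_(j < k) b i j / 2 * complex.Re (rform i y * (rform j y)^*).
  rewrite -big_split; apply: eq_bigr => i _ /=; rewrite [complex.Re (\sum_(j < k) _)]Re_sum -big_split; apply: eq_bigr => j _ /=.
  rewrite Re_realM.
  by case: (rform i y) => u v; case: (rform j y) => u' v' /=; field.
by ring.
Qed.

Lemma is_poly_hol : is_poly (fun y => hol1 y + hol2 y).
Proof.
apply: is_polyD; first by apply: is_poly_sum => i; apply: is_polyZ; apply: is_poly_rform.
apply: is_poly_sum => i; apply: is_poly_sum => j; apply: is_polyZ.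
by apply: is_polyM; apply: is_poly_rform.
Qed.

Lemma hol1Z (u : C) y : hol1 (u *: y) = u * hol1 y.
Proof. by rewrite /hol1 mulr_sumr; apply: eq_bigr => i _; rewrite rformZ; ring. Qed.

Lemma hol2Z (u : C) y : hol2 (u *: y) = u ^+ 2 * hol2 y.
Proof.
rewrite /hol2 mulr_sumr; apply: eq_bigr => i _; rewrite mulr_sumr.
by apply: eq_bigr => j _; rewrite !rformZ; ring.
Qed.

Lemma leviZ (u : C) y : cabs u = 1 -> levi (u *: y) = levi y.
Proof.
move=> u1; apply: eq_bigr => i _; apply: eq_bigr => j _; rewrite !rformZ.
have uu : u * u^* = 1.
  have := cabs_sqr u; rewrite u1 expr1n; case: (u) => x v /= h.
  by apply/eqP; rewrite eq_complex /=; apply/andP; split; apply/eqP; rewrite ?h; [rewrite mulrN opprK -!expr2 -h | ring].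
have cM (v1 v2 : C) : u * v1 * conjc (u * v2) = v1 * conjc v2.
  have -> : conjc (u * v2) = conjc u * conjc v2 by exact: (rmorphM (@conjc R)).
  by rewrite -[RHS]mul1r -uu; ring.
by rewrite cM.
Qed.

(** More than two roots of unity annihilate the holomorphic parts, which are homogeneous of degree 1
    and 2; the Hermitian part is invariant under rotation. *)
Lemma mean_quad m y : (2 < m)%N ->
  \sum_(l < m) quad k c a b (fun i => complex.Re (rform i (omega R m ^+ l *: y))) =
  (c + levi y) *+ m.
Proof.
move=> m2; rewrite (eq_bigr (fun l : 'I_m => (c + levi y) +
   complex.Re (omega R m ^+ (l * 1) * hol1 y + omega R m ^+ (l * 2) * hol2 y))); last first.
  move=> l _; rewrite quad_split leviZ ?cabsX ?cabs_omega ?expr1n // hol1Z hol2Z.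
  by rewrite muln1 exprM; ring.
rewrite big_split /= sumr_const card_ord -Re_sum big_split /= -!mulr_suml.
rewrite sum_omegaX ?(ltn_trans _ m2) // sum_omegaX // !mul0r addr0.
by rewrite -[complex.Re _]/(0 : R) addr0.
Qed.

End QuadSplit.

Definition sqn z : R := \sum_i cabs (z 0 i) ^+ 2.

Lemma sqn_ge0 z : 0 <= sqn z.
Proof. by apply: sumr_ge0 => i _; rewrite exprn_ge0 // cabs_ge0. Qed.

Definition herm p y : C := \sum_i (p 0 i)^* * y 0 i.

Lemma is_poly_herm p : is_poly (herm p).
Proof. by apply: is_poly_sum => i; apply: is_polyZ; apply: is_poly_coord. Qed.

(** The same shape as [quad_split]: a constant, the real part of a holomorphic polynomial, and a
    rotation invariant form, here a positive one. *)
Lemma sqnD p y : sqn (p + y) = sqn p + 2 * complex.Re (herm p y) + sqn y.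
Proof.
rewrite /sqn /herm Re_sum mulr_sumr -!big_split; apply: eq_bigr => i _ /=.
rewrite mxE !cabs_sqr ReD ImD; case: (p 0 i) => u v; case: (y 0 i) => u' v' /=.
by ring.
Qed.

Lemma sqn_le z (s : R) : nrm z <= s -> sqn z <= s ^+ 2.
Proof.
move=> zs; have s0 : 0 <= s by apply: le_trans zs; apply: nrm_ge0.
apply: le_trans (_ : nrm z * s <= _); last by rewrite expr2 ler_wpM2r.
rewrite /sqn {1}/nrm mulr_suml; apply: ler_sum => i _.
by rewrite expr2 ler_wpM2l ?cabs_ge0 // (le_trans (cabs_le_nrm _ _)).
Qed.

Lemma sqn_lip z p (s : R) : nrm z <= s -> nrm p <= s -> `|sqn z - sqn p| <= 2 * s * nrm (z - p).
Proof.
move=> zs ps; rewrite /sqn -sumrB; apply: le_trans (ler_norm_sum _ _ _) _.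
rewrite /nrm mulr_sumr; apply: ler_sum => i _; rewrite !mxE.
have -> : cabs (z 0 i) ^+ 2 - cabs (p 0 i) ^+ 2 = (cabs (z 0 i) + cabs (p 0 i)) * (cabs (z 0 i) - cabs (p 0 i)) by ring.
rewrite normrM ger0_norm ?addr_ge0 ?cabs_ge0 //; apply: ler_pM => //.
- by rewrite addr_ge0 ?cabs_ge0.
- have := cabs_le_nrm z i; have := cabs_le_nrm p i; lra.
rewrite ler_norml; have := cabs_lB (z 0 i) (p 0 i); have := cabs_lB (p 0 i) (z 0 i).
by rewrite (cabsB (p 0 i)); lra.
Qed.

Lemma near_sup (S : set Cn) (f : Cn -> R) (B e : R) z0 : S z0 -> 0 < e -> (forall z, S z -> f z <= B) ->
  exists2 p, S p & forall z, S z -> f z <= f p + e.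
Proof.
move=> Sz e0 fB.
have hs : has_sup [set f z | z in S].
  by split; [exists (f z0); exists z0 | exists B => _ [z Szz <-]; apply: fB].
have [_ [p Sp <-] hp] := sup_adherent e0 hs.
exists p => // z Szz; have : f z <= sup [set f z | z in S] by apply: sup_upper_bound => //; exists z.
by lra.
Qed.

(* Otherwise [1 + ka * G], for a small [ka > 0], would have modulus 1 at [p] and less than 1 on [S]. *)
Lemma hull_no_peak (S : set Cn) p (G : Cn -> C) (th : R) : bounded_nrm S -> hull S p -> is_poly G ->
  0 < th -> G p = 0 -> ~ (forall z, S z -> complex.Re (G z) <= - th).
Proof.
move=> [B HB] hp hG th0 Gp H.
have [M HM] := is_poly_bounded B hG.
pose M1 := `|M| + 1; have M10 : 0 < M1 by rewrite ltr_wpDl.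
have M1M z : S z -> cabs (G z) <= M1.
  move=> /HB /HM h; apply: le_trans h _; apply: le_trans (ler_norm _) _.
  by rewrite lerDl.
have th1 : 0 < M1 ^+ 2 by rewrite exprn_gt0.
pose ka := Order.min (th / M1 ^+ 2) (1 / (2 * th)).
have ka0 : 0 < ka by rewrite lt_min; apply/andP; split; rewrite divr_gt0 ?mulr_gt0.
have ka1 : ka * M1 ^+ 2 <= th.
  have : ka <= th / M1 ^+ 2 by rewrite ge_min lexx.
  by rewrite ler_pdivlMr.
have ka2 : ka * (2 * th) <= 1.
  have : ka <= 1 / (2 * th) by rewrite ge_min lexx orbT.
  by rewrite ler_pdivlMr ?mulr_gt0.
have hQ : is_poly (fun z => 1 + ka%:C * G z) by apply: is_polyD; [apply: is_poly_cst | apply: is_polyZ].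
have := hp _ hQ (1 - ka * th / 2); rewrite Gp mulr0 addr0 cabs1 => Hc.
suff : 1 <= 1 - ka * th / 2 by have := mulr_gt0 ka0 th0; lra.
apply: Hc => z Sz.
have kt : 0 <= 1 - ka * th / 2 by lra.
rewrite -(ler_pXn2r (ltn0Sn 1)) ?nnegrE ?cabs_ge0 // cabs_sqr.
have h1 := H z Sz; have h2 := M1M z Sz.
have h3 : cabs (G z) ^+ 2 <= M1 ^+ 2 by rewrite lerXn2r ?nnegrE ?cabs_ge0 ?(ltW M10).
have e1 : complex.Re (1 + ka%:C * G z) = 1 + ka * complex.Re (G z) by rewrite ReD Re_realM.
have e2 : complex.Im (1 + ka%:C * G z) = ka * complex.Im (G z).
  by rewrite ImD; case: (G z) => u v /=; ring.
rewrite e1 e2; have := cabs_sqr (G z); set u := complex.Re _ in h1 *; set v := complex.Im _.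
move=> h4.
have h5 : ka * u <= - (ka * th) by rewrite -mulrN ler_pM2l.
have h6 : ka * (ka * cabs (G z) ^+ 2) <= ka * th.
  rewrite ler_pM2l //; apply: le_trans ka1; by rewrite ler_pM2l.
have h7 : 0 <= (ka * th) ^+ 2 by rewrite sqr_ge0.
rewrite h4 in h6; rewrite !expr2 in h6 h7 *; lra.
Qed.

End LipschitzMaximum.

Section MaximumOnHull.
Variables (R : realType) (n : nat).
Local Notation C := R[i].
Local Notation Cn := 'rV[C]_n.
Implicit Types (z p y : Cn).

Lemma is_poly_shift (q : Cn -> C) p : is_poly q -> is_poly (fun z => q (z - p)).
Proof.
pose P (q : Cn -> C) := is_poly (fun z => q (z - p)).
apply: (@is_poly_ind R n P).
- by move=> c; apply: is_poly_cst.
- move=> i; have := is_polyB (is_poly_coord R i) (is_poly_cst n (p 0 i)).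
  by congr is_poly; apply/funext => z; rewrite !mxE.
- by move=> f g; apply: is_polyD.
by move=> f g; apply: is_polyM.
Qed.

Lemma nrm_le_max z (s : R) : (forall i, cabs (z 0 i) <= s) -> nrm z <= n%:R * s.
Proof.
move=> zs; rewrite mulr_natl.
have -> : s *+ n = \sum_(i < n) s by rewrite sumr_const card_ord.
exact: ler_sum.
Qed.

(** On the polygon through [p + y] the quadratic approximation has mean [c + levi k b y]. One [e]
    pays for the approximation, the other for the discretization error, made small by taking many
    vertices. *)
Lemma submean_levi (v : Cn -> R) (rho c0 s e : R) k c a b p y : 0 <= c0 -> 0 < e ->
  submean rho c0 v -> nrm p + nrm y <= rho -> (forall j, cabs (y 0 j) <= s) ->
  (forall y, (forall j, cabs (y 0 j) <= s) ->
    `|v (p + y) - quad k c a b (fun i => complex.Re (rform i y))| <= e) ->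
  v p <= c + levi k b y + 2 * e.
Proof.
move=> c00 e0 sv py ys Hv.
have [m m2 hm] : exists2 m, (2 < m)%N & c0 * nrm y / m%:R <= e.
  have h : c0 * nrm y / e < (Num.truncn (c0 * nrm y / e)).+1%:R by apply: truncnS_gt.
  exists (Num.truncn (c0 * nrm y / e)).+3 => //; set m0 := Num.truncn _ in h *.
  have h3 : m0.+1%:R <= m0.+3%:R :> R.
    by rewrite ler_nat; apply: leq_trans (leqnSn _) (leqnSn _).
  move: h; rewrite ltr_pdivrMr // => h; rewrite ler_pdivrMr ?ltr0n // [e * _]mulrC.
  by apply: le_trans (ltW h) _; rewrite ler_pM2r.
have m0 : (0 < m)%N by apply: ltn_trans m2.
have mp : 0 < m%:R :> R by rewrite ltr0n.
have := sv p y m py m0.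
have : m%:R^-1 * \sum_(l < m) v (p + omega R m ^+ l *: y) <= c + levi k b y + e; last by lra.
rewrite mulrC ler_pdivrMr //.
have -> : (c + levi k b y + e) * m%:R = (c + levi k b y) *+ m + \sum_(l < m) e.
  by rewrite sumr_const card_ord mulrDl !mulr_natr.
have mq := mean_quad k c a b y m2.
rewrite -{}mq -big_split; apply: ler_sum => l _ /=.
have H j : cabs ((omega R m ^+ l *: y) 0 j) <= s.
  by rewrite mxE cabsM cabsX cabs_omega expr1n mul1r.
by have := Hv _ H; rewrite ler_norml => /andP[_ h]; lra.
Qed.

Theorem lip_maximum (w : Cn -> R) (L B c0 R1 t : R) (K : set Cn) x0 :
  0 <= L -> 0 <= c0 -> 0 <= R1 -> (forall z, `|w z| <= B) -> lipschitz_nrm L w ->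
  submean (R1 + 2) c0 w -> (forall z, hull K z -> nrm z <= R1) ->
  (forall z, K z -> w z <= t) -> hull K x0 -> w x0 <= t.
Proof.
move=> L0 c00 R10 wB wL wS KR wK hx0; rewrite leNgt; apply/negP => gap.
(* If [K] met the polydisc around the near-maximum [p], five errors of at most [de] would link
   [w x0] to [t]: smoothing at [x0] and at the point of [K], near-maximality, the passage from [p]
   to that point, and the perturbation. *)
pose de := (w x0 - t) / 6; have de0 : 0 < de by rewrite /de; lra.
have Kb : bounded_nrm K by exists R1 => z Kz; apply: KR; apply: subset_hull.
pose ep := de / (2 * (R1 + 1) ^+ 2).
have R11 : 0 < (R1 + 1) ^+ 2 by rewrite exprn_gt0 //; lra.
have ep0 : 0 < ep by rewrite divr_gt0 // mulr_gt0.
have epR z : nrm z <= R1 -> 2 * ep * sqn z <= de.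
  move=> zR; have h : sqn z <= (R1 + 1) ^+ 2 by apply: sqn_le; lra.
  have : 2 * ep * sqn z <= 2 * ep * (R1 + 1) ^+ 2 by rewrite ler_pM2l // mulr_gt0.
  have -> : 2 * ep * (R1 + 1) ^+ 2 = de by rewrite /ep; field; rewrite gt_eqF //; lra.
  by [].
have [D D0 HD] := local_quadratic R n.
have B0 : 0 <= B by apply: le_trans (wB 0).
pose k3 : R := (3 * n.*2)%:R.
have k30 : 0 <= k3 by [].
pose h := Order.min (1 / (k3 + 1)) (de / ((L + 1) * (k3 + 1))).
have h0 : 0 < h by rewrite lt_min; apply/andP; split; rewrite divr_gt0 ?mulr_gt0 //; lra.
have hk : h * k3 <= 1.
  have : h <= 1 / (k3 + 1) by rewrite ge_min lexx.
  rewrite ler_pdivlMr; [lra | lra].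
have hL : L * h * k3 <= de.
  have : h <= de / ((L + 1) * (k3 + 1)) by rewrite ge_min lexx orbT.
  rewrite ler_pdivlMr ?mulr_gt0 //; try lra.
  have := mulr_ge0 L0 (ltW h0); have := mulr_ge0 (ltW h0) k30; lra.
pose L1 := L + 4 * ep * R1 + 1.
have L10 : 0 < L1.
  have h4 : 0 <= 4 * ep * R1 by rewrite mulr_ge0 // mulr_ge0 ?(ltW ep0).
  by rewrite /L1; lra.
pose DBh := D * B / h ^+ 3.
have DBh0 : 0 <= DBh by rewrite /DBh divr_ge0 ?mulr_ge0 ?exprn_ge0 ?(ltW h0).
have nn : 0 <= n%:R :> R by [].
(* The four bounds: the range of [local_quadratic]; staying within distance 1 of [p]; variation of
   the perturbed function at most [de]; cubic error small against [ep * s ^+ 2]. *)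
pose s := Order.min (Order.min (h / 8) (1 / (n%:R + 1)))
   (Order.min (de / (L1 * (n%:R + 1))) (ep / (24 * (DBh + 1)))).
have s0 : 0 < s.
  have n1 : 0 < n%:R + 1 :> R by lra.
  have D1 : 0 < DBh + 1 by lra.
  have q1 : 0 < h / 8 by apply: divr_gt0.
  have q2 : 0 < 1 / (n%:R + 1) :> R by apply: divr_gt0.
  have q3 : 0 < de / (L1 * (n%:R + 1)) by apply: divr_gt0 => //; apply: mulr_gt0.
  have q4 : 0 < ep / (24 * (DBh + 1)) by apply: divr_gt0 => //; apply: mulr_gt0.
  by rewrite !lt_min q1 q2 q3 q4.
have sh : s <= h / 8 by rewrite /s !ge_min lexx.
have sn : s * (n%:R + 1) <= 1.
  have : s <= 1 / (n%:R + 1) by rewrite /s !ge_min lexx !orbT.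
  by rewrite ler_pdivlMr //; lra.
have sL1 : s * (L1 * (n%:R + 1)) <= de.
  have : s <= de / (L1 * (n%:R + 1)) by rewrite /s !ge_min lexx !orbT.
  by rewrite ler_pdivlMr // mulr_gt0 //; lra.
have sD : s * (24 * (DBh + 1)) <= ep.
  have : s <= ep / (24 * (DBh + 1)) by rewrite /s !ge_min lexx !orbT.
  by rewrite ler_pdivlMr // mulr_gt0 //; lra.
pose e1 := Order.min de (ep * s ^+ 2 / 32).
have s20 : 0 < s ^+ 2 by rewrite exprn_gt0.
have e10 : 0 < e1 by rewrite lt_min de0 /= divr_gt0 // mulr_gt0.
have e1d : e1 <= de by rewrite ge_min lexx.
have e1s : e1 <= ep * s ^+ 2 / 32 by rewrite ge_min lexx orbT.
have [N [E [N0 EN Hq]]] := HD w L B h s e1 L0 h0 s0 sh e10 wB wL.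
set v := smooth N E n.*2 w in Hq.
have vL : lipschitz_nrm L v by apply: smooth_lip.
have vw z : `|v z - w z| <= de.
  apply: le_trans (smooth_close N0 EN n.*2 z L0 wL) _.
  by apply: le_trans hL; rewrite /k3 mulr_natr.
have vS : submean (R1 + 1) c0 v.
  have sS := smooth_submean (k := n.*2) N0 EN wS.
  move=> a b m ab m0; apply: (sS a b m _ m0).
  apply: le_trans ab _; have : h *+ (3 * n.*2) <= 1 by rewrite -mulr_natr.
  by set hh := h *+ _; lra.
pose Ph z := v z + 2 * ep * sqn z.
have [|p hp Hp] := @near_sup R n (hull K) Ph (B + de + de) e1 x0 hx0 e10.
  move=> z hz; have := epR z (KR z hz); have := vw z; have := wB z; rewrite /Ph !ler_norml; lra.
have Phx0 : w x0 - de <= Ph x0.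
  have : 0 <= 2 * ep * sqn x0 by rewrite mulr_ge0 ?sqn_ge0 // mulr_ge0 ?(ltW ep0).
  by have := vw x0; rewrite /Ph ler_norml; lra.
have Php := Hp x0 hx0.
have Kfar z : K z -> exists i, s < cabs (z 0 i - p 0 i).
  move=> Kz; apply: contrapT => nex.
  have zp i : cabs ((z - p) 0 i) <= s.
    by rewrite !mxE leNgt; apply/negP => hh; apply: nex; exists i.
  have hz := subset_hull Kz.
  have zpn := nrm_le_max zp.
  have hv : v p - v z <= L * nrm (z - p).
    by have := vL z p; rewrite ler_norml; lra.
  have hs : sqn p - sqn z <= 2 * R1 * nrm (z - p).
    by have := sqn_lip (KR z hz) (KR p hp); rewrite ler_norml; lra.
  have hs2 : 2 * ep * (sqn p - sqn z) <= 2 * ep * (2 * R1 * nrm (z - p)).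
    by rewrite ler_pM2l // mulr_gt0.
  have hL1 : L1 * nrm (z - p) <= L1 * (n%:R * s) by rewrite ler_pM2l.
  have hL2 : L1 * (n%:R * s) <= de by have := mulr_gt0 s0 L10; lra.
  have := wK z Kz; have := epR z (KR z hz); have := vw z; rewrite ler_norml.
  have := nrm_ge0 (z - p).
  rewrite /Ph in Php Phx0; rewrite /L1 in hL1 hL2; rewrite /de in e1d hL2 Phx0 *; lra.
have [||S [hS HS]] := @polydisc_maximum R n K p (s / 2) s Kb _ _ hp Kfar; [lra | lra |].
have [c [a [b Hquad]]] := Hq p.
pose er := D * B * (s / h) ^+ 3 + e1.
(* In the end one [er] comes from the expansion at [z], two from [submean_levi], and [e1] from
   near-maximality. The gain [2 * ep * sqn y] is at least [ep * s ^+ 2 / 2], so half of it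
   remains. *)
have erE : 3 * er + e1 <= ep * s ^+ 2 / 4.
  have -> : er = DBh * s ^+ 3 + e1 by rewrite /er /DBh; field; rewrite gt_eqF.
  have : s ^+ 2 * (s * (24 * (DBh + 1))) <= s ^+ 2 * ep by rewrite ler_pM2l.
  have := mulr_gt0 s20 s0; rewrite [s ^+ 3]exprS; lra.
have er0 : 0 < er.
  have sh0 : 0 <= s / h by rewrite divr_ge0 ?(ltW s0) ?(ltW h0).
  by rewrite /er ltr_wpDl // mulr_ge0 ?exprn_ge0 // mulr_ge0.
pose G y := hol1 n.*2 a y + hol2 n.*2 b y + (4 * ep)%:C * herm p y.
have hG : is_poly (fun z => G (z - p)).
  apply: (is_poly_shift (q := G)); apply: is_polyD; first exact: is_poly_hol.
  by apply: is_polyZ; apply: is_poly_herm.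
have G0 : G (p - p) = 0.
  rewrite subrr -(scale0r (0 : Cn)) /G hol1Z hol2Z expr0n /= !mul0r !add0r.
  by rewrite /herm big1 ?mulr0 // => i _; rewrite !mxE !mul0r mulr0.
have Sb : bounded_nrm S by exists R1 => z /HS [hz _ _]; apply: KR.
apply: (hull_no_peak Sb hS hG (_ : 0 < ep * s ^+ 2 / 4) G0); first by rewrite divr_gt0 // mulr_gt0.
move=> z /HS [hz zs [i zi]].
pose y := z - p; have zE : z = p + y by rewrite /y addrC subrK.
have ys j : cabs (y 0 j) <= s by rewrite !mxE.
rewrite -/y.
have yi : (s / 2) ^+ 2 <= sqn y.
  rewrite /sqn (bigD1 i) //= -[leLHS]addr0; apply: lerD.
    by rewrite lerXn2r ?nnegrE ?cabs_ge0 ?divr_ge0 ?(ltW s0) // !mxE.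
  by apply: sumr_ge0 => j _; rewrite exprn_ge0 // cabs_ge0.
have py : nrm p + nrm y <= R1 + 1.
  by have := KR p hp; have := nrm_le_max ys; lra.
have lv := submean_levi c00 er0 vS py ys Hquad.
have := Hquad y ys; rewrite -/er quad_split -zE ler_norml => /andP[hq1 _].
have := Hp z hz; rewrite /Ph {2}zE sqnD => hPz.
have eG : complex.Re (G y) = complex.Re (hol1 n.*2 a y + hol2 n.*2 b y) + 4 * ep * complex.Re (herm p y).
  by rewrite /G ReD Re_realM.
rewrite eG.
have hyy : 2 * ep * (s / 2) ^+ 2 <= 2 * ep * sqn y by rewrite ler_pM2l // mulr_gt0.
have sq4 : (s / 2) ^+ 2 = s ^+ 2 / 4 by field.
rewrite sq4 in hyy.
move: hq1 hPz lv erE hyy; set u1 := complex.Re _; set u2 := levi _ _ _; set u3 := complex.Re _.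
set u4 := v z; set u5 := v p; set u6 := sqn p; set u7 := sqn y.
clear -ep0.
move=> *; lra.
Qed.

End MaximumOnHull.

(** * Circle integrals against step functions *)

Section CircleIntegral.
Variable R : realType.
Local Notation mu := (@lebesgue_measure R).
Local Notation D := [set` `[0%R, (2 * pi)%R]].

(* The integral of a nonnegative function, measurable or not, is a supremum over the simple functions below it. *)
Lemma ge0_integral_mono (A : set R) (f g : R -> \bar R) :
  (forall x, A x -> (0 <= f x)%E) -> (forall x, A x -> (f x <= g x)%E) ->
  (\int[mu]_(x in A) f x <= \int[mu]_(x in A) g x)%E.
Proof.
move=> f0 fg; have g0 x : A x -> (0 <= g x)%E by move=> Ax; apply: le_trans (f0 x Ax) (fg x Ax).
rewrite !ge0_integralE //; apply: le_ereal_sup => _ [h hf <-]; exists h => // x.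
apply: le_trans (hf x) _; rewrite /patch; case: ifPn => // xA.
by apply: fg; apply: set_mem.
Qed.

(** [b] selects the type of arc: closed arcs ([false]) cover all of $[0,2\pi]$, as an upper bound
    requires; half-open arcs ([true]) are disjoint, as a lower bound requires. *)
Lemma integral_step m (c : nat -> R) (b : bool) : (0 < m)%N -> (forall j, 0 <= c j) ->
  (\int[mu]_(x in D) (\sum_(j < m) c j * \1_[set` Interval (BLeft (2 * pi * j%:R / m%:R)) (BSide b (2 * pi * j.+1%:R / m%:R))] x)%:E
   = (2 * pi * (m%:R^-1 * \sum_(j < m) c j))%:E)%E.
Proof.
move=> m0 c0; pose I (j : nat) := [set` Interval (BLeft (2 * pi * j%:R / m%:R)) (BSide b (2 * pi * j.+1%:R / m%:R))] : set R.
have mp : 0 < m%:R :> R by rewrite ltr0n.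
have pp := pi_gt0 R.
have mI j : measurable (I j) by apply: measurable_itv.
have le0 (j : nat) : 0 <= 2 * pi * j%:R / m%:R :> R.
  by rewrite divr_ge0 ?mulr_ge0 ?(ltW pp).
have le1 (j : nat) : (j <= m)%N -> 2 * pi * j%:R / m%:R <= 2 * pi :> R.
  by move=> jm; rewrite ler_pdivrMr // ler_pM2l ?mulr_gt0 // ler_nat.
under eq_integral do rewrite -sumEFin.
rewrite ge0_integral_sum //; last 2 first.
- move=> j; apply/measurable_EFinP; exact: measurable_funM.
- by move=> j x _; rewrite lee_fin mulr_ge0 // indicE; case: (_ \in _).
have -> : (2 * pi * (m%:R^-1 * \sum_(j < m) c j))%:E = (\sum_(j < m) (c j * (2 * pi / m%:R))%:E)%E.
  by rewrite sumEFin -mulr_suml; congr _%:E; ring.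
apply: eq_bigr => j _; under eq_integral do rewrite EFinM.
rewrite ge0_integralZl //; last 2 first.
- by apply/measurable_EFinP; apply: measurable_indic.
- by rewrite lee_fin.
rewrite integral_indic // EFinM; congr (_ * _)%E.
have -> : I j `&` D = I j.
  apply/seteqP; split => x /=; first by case.
  move=> xI; split => //; move: xI; rewrite /I /= !in_itv /= => /andP[h1 h2].
  rewrite (le_trans (le0 _) h1) /=.
  have h3 : x <= 2 * pi * j.+1%:R / m%:R by case: (b) h2 => //= /ltW.
  exact: le_trans h3 (le1 _ (ltn_ord j)).
have := @lebesgue_measure_itv R (Interval (BLeft (2 * pi * j%:R / m%:R)) (BSide b (2 * pi * j.+1%:R / m%:R))).
rewrite /= lte_fin => lm; apply: etrans lm _.
have -> : 2 * pi * j%:R / m%:R < 2 * pi * j.+1%:R / m%:R :> R.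
  by rewrite ltr_pM2r ?invr_gt0 // ltr_pM2l ?mulr_gt0 // ltr_nat.
by rewrite -EFinB; congr _%:E; rewrite -natr1; field; rewrite gt_eqF.
Qed.

Lemma circle_mean_le m (f : R -> R) (c : nat -> R) : (0 < m)%N ->
  (forall j, 0 <= c j) -> (forall x, 0 <= f x) ->
  (forall (j : nat) x, (j < m)%N -> 2 * pi * j%:R / m%:R <= x <= 2 * pi * j.+1%:R / m%:R -> f x <= c j) ->
  (((2 * (pi : R))^-1)%:E * \int[mu]_(x in D) (f x)%:E <= (m%:R^-1 * \sum_(j < m) c j)%:E)%E.
Proof.
move=> m0 c0 f0 fc; have p2 : 0 < 2 * pi :> R by rewrite mulr_gt0 // pi_gt0.
have mp : 0 < m%:R :> R by rewrite ltr0n.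
have -> : m%:R^-1 * \sum_(j < m) c j = (2 * pi)^-1 * (2 * pi * (m%:R^-1 * \sum_(j < m) c j)).
  by rewrite mulKf // gt_eqF.
rewrite EFinM lee_wpmul2l ?lee_fin ?invr_ge0 ?(ltW p2) //.
rewrite -(integral_step false m0 c0); apply: ge0_integral_mono => x.
  by rewrite lee_fin.
rewrite /= in_itv /= => /andP[x0 x1]; rewrite lee_fin.
have s0 : 0 <= x * m%:R / (2 * pi) by apply: divr_ge0; [apply: mulr_ge0 | apply: ltW].
have [xlt|xge] := ltrP x (2 * pi).
  pose j := Num.truncn (x * m%:R / (2 * pi)).
  have /andP[j1 j2] : j%:R <= x * m%:R / (2 * pi) < j.+1%:R by apply: truncn_itv.
  have jm : (j < m)%N.
    rewrite -(ltr_nat R); apply: le_lt_trans j1 _.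
    by rewrite ltr_pdivrMr // mulrC ltr_pM2l.
  have xI : 2 * pi * j%:R / m%:R <= x <= 2 * pi * j.+1%:R / m%:R.
    move: (j1) (j2); rewrite ler_pdivlMr // ltr_pdivrMr // => h1 h2.
    by rewrite ler_pdivrMr // ler_pdivlMr // [2 * pi * _]mulrC h1 /= [leRHS]mulrC ltW.
  rewrite (bigD1 (Ordinal jm)) //= indicE mem_set ?mulr1; last by rewrite /= in_itv /= xI.
  apply: le_trans (fc j x jm xI) _; rewrite lerDl; apply: sumr_ge0 => l _.
  by rewrite mulr_ge0 // indicE; case: (_ \in _).
(* At the endpoint truncation would give the index [m], out of range; the point lies in the closed
   last arc. *)
have xe : x = 2 * pi by apply/eqP; rewrite eq_le x1.
have jm : (m.-1 < m)%N by rewrite prednK.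
have xI : 2 * pi * m.-1%:R / m%:R <= x <= 2 * pi * m.-1.+1%:R / m%:R.
  rewrite prednK // mulfK ?gt_eqF // x1 andbT xe ler_pdivrMr // ler_pM2l //.
  by rewrite ler_nat leq_pred.
rewrite (bigD1 (Ordinal jm)) //= indicE mem_set ?mulr1; last by rewrite /= in_itv /= xI.
apply: le_trans (fc _ x jm xI) _; rewrite lerDl; apply: sumr_ge0 => l _.
by rewrite mulr_ge0 // indicE; case: (_ \in _).
Qed.

Lemma circle_mean_ge m (f : R -> R) (c : nat -> R) : (0 < m)%N ->
  (forall j, 0 <= c j) -> (forall x, 0 <= f x) ->
  (forall (j : nat) x, (j < m)%N -> 2 * pi * j%:R / m%:R <= x <= 2 * pi * j.+1%:R / m%:R -> c j <= f x) ->
  ((m%:R^-1 * \sum_(j < m) c j)%:E <= ((2 * (pi : R))^-1)%:E * \int[mu]_(x in D) (f x)%:E)%E.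
Proof.
move=> m0 c0 f0 fc; have p2 : 0 < 2 * pi :> R by rewrite mulr_gt0 // pi_gt0.
have mp : 0 < m%:R :> R by rewrite ltr0n.
have -> : m%:R^-1 * \sum_(j < m) c j = (2 * pi)^-1 * (2 * pi * (m%:R^-1 * \sum_(j < m) c j)).
  by rewrite mulKf // gt_eqF.
rewrite EFinM lee_wpmul2l ?lee_fin ?invr_ge0 ?(ltW p2) //.
rewrite -(integral_step true m0 c0); apply: ge0_integral_mono => x _; rewrite lee_fin.
  by apply: sumr_ge0 => l _; rewrite mulr_ge0 // indicE; case: (_ \in _).
pose I (j : nat) := [set` Interval (BLeft (2 * pi * j%:R / m%:R)) (BSide true (2 * pi * j.+1%:R / m%:R))] : set R.
have [[j [jm xj]]|nj] := pselect (exists j, (j < m)%N /\ I j x); last first.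
  rewrite big1 // => j _; rewrite indicE memNset ?mulr0 // => h; apply: nj.
  by exists j; split.
rewrite (bigD1 (Ordinal jm)) //= big1 ?addr0 => [|l lj].
  rewrite indicE mem_set // mulr1; apply: fc => //.
  by move: xj; rewrite /I /= in_itv /= => /andP[-> /ltW].
rewrite indicE memNset ?mulr0 // => xl.
have lt (u v : nat) : I u x -> I v x -> (u < v.+1)%N.
  rewrite /I /= !in_itv /= => /andP[h1 _] /andP[_ h2].
  rewrite -(ltr_nat R) -(ltr_pM2l p2) -(ltr_pM2r (_ : 0 < m%:R^-1)) ?invr_gt0 //.
  exact: le_lt_trans h1 h2.
move: lj; rewrite -val_eqE /= eqn_leq.
by rewrite -ltnS (lt _ _ xl xj) /= -ltnS (lt _ _ xj xl).
Qed.

End CircleIntegral.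

(** * Compactness and semicontinuity in terms of the l1 norm *)

Section NrmTopology.
Variables (R : realType) (n : nat).
Local Notation C := R[i].
Local Notation Cn := 'rV[C]_n.

Lemma normc_cabs (x : C) : `|x| = (cabs x)%:C.
Proof. by case: x => a b; rewrite normc_def. Qed.

Lemma pos_complexE (e : C) : 0 < e -> e = (complex.Re e)%:C /\ 0 < complex.Re e.
Proof. by case: e => a b; rewrite ltcE /= => /andP[/eqP -> ->]. Qed.

Lemma nbhs_nrmP (a : Cn) (P : set Cn) :
  nbhs a P <-> exists2 d : R, 0 < d & forall z, nrm (z - a) < d -> P z.
Proof.
split=> [/nbhs_ballP [e /= e0 he]|[d d0 Hd]].
  have [eE er0] := pos_complexE e0; exists (complex.Re e) => // z hz.
  apply: he; split => // i j; rewrite (ord1 i) /ball /= normc_cabs eE ltcR.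
  apply: le_lt_trans hz; have := cabs_le_nrm (z - a) j.
  by rewrite !mxE cabsB.
have n1 : 0 < n.+1%:R :> R by rewrite ltr0n.
apply/nbhs_ballP; exists (d / n.+1%:R)%:C => /=; first by rewrite ltcR divr_gt0.
move=> z [_ hz]; apply: Hd.
apply: le_lt_trans (_ : n%:R * (d / n.+1%:R) < _); last first.
  by rewrite mulrC mulrAC ltr_pdivrMr // ltr_pM2l // ltr_nat.
apply: nrm_le_max => j; have := hz 0 j; rewrite /ball /= normc_cabs ltcR cabsB !mxE.
exact: ltW.
Qed.

Lemma compact_uniform (K : set Cn) (P : R -> Cn -> Prop) : compact K ->
  (forall M M' z, M <= M' -> P M z -> P M' z) ->
  (forall a, K a -> exists M d, 0 < d /\ forall z, nrm (z - a) < d -> P M z) ->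
  exists M, forall z, K z -> P M z.
Proof.
rewrite compact_cover => Kc mono loc.
have loc' a : exists Md : R * R, K a -> 0 < Md.2 /\ forall z, nrm (z - a) < Md.2 -> P Md.1 z.
  have [Ka|nKa] := pselect (K a); last by exists (0, 0) => /nKa.
  by have [M [d h]] := loc a Ka; exists (M, d).
have [Md HMd] := choice loc'.
have [|a Ka|D' D'K KD'] := Kc Cn K (fun a => interior [set z | nrm (z - a) < (Md a).2]).
- by move=> a Ka; apply: open_interior.
- exists a => //; apply/nbhs_nrmP; have [d0 _] := HMd a Ka.
  by exists (Md a).2.
have le_max (s : seq Cn) b : b \in s -> (Md b).1 <= \big[Order.max/0]_(a <- s) (Md a).1.
  elim: s => // x s IH; rewrite in_cons big_cons le_max => /orP[/eqP ->|/IH ->].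
    by rewrite lexx.
  by rewrite orbT.
exists (\big[Order.max/0]_(a <- finmap.enum_fset D') (Md a).1) => z Kz.
have [a /= aD hz] := KD' z Kz.
have Ka : K a by have := D'K a aD; rewrite inE.
apply: mono (le_max (finmap.enum_fset D') a aD) _; have [_ h] := HMd a Ka.
by apply: h; apply: interior_subset hz.
Qed.

Lemma compact_bounded_nrm (K : set Cn) : compact K -> bounded_nrm K.
Proof.
move=> Kc; apply: (@compact_uniform K (fun M z => nrm z <= M) Kc).
  by move=> M M' z MM' h; apply: le_trans h MM'.
move=> a _; exists (nrm a + 1), 1; split => // z hz.
by have := nrmD a (z - a); rewrite [a + _]addrC subrK; lra.
Qed.

Lemma usc_near_compact (K : set Cn) (u : Cn -> R) (c : R) : compact K -> usc u ->
  (forall z, K z -> u z < c) ->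
  exists2 rho, 0 < rho & forall z y, K z -> nrm (y - z) < rho -> u y < c.
Proof.
move=> Kc uu uK.
(* The radius is written [M^-1] so that the property is monotone in [M]. *)
have [||M HM] := @compact_uniform K
   (fun M z => 0 < M /\ forall y, nrm (y - z) < M^-1 -> u y < c) Kc.
- move=> M M' z MM' [M0 h]; have M'0 : 0 < M' by apply: lt_le_trans MM'.
  by split => // y hy; apply: h; apply: lt_le_trans hy _; rewrite lef_pV2.
- move=> a Ka; have /nbhs_nrmP [d d0 hd] := uu a c (uK a Ka).
  exists (2 / d), (d / 2); split; first by rewrite divr_gt0.
  move=> z hz; split; first by rewrite divr_gt0.
  move=> y; rewrite invf_div => hy; apply: hd.
  have -> : y - a = (y - z) + (z - a) by rewrite addrA subrK.
  by have := nrmD (y - z) (z - a); lra.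
have [[z0 Kz0]|K0] := pselect (K !=set0); last first.
  by exists 1 => // z y Kz; case: K0; exists z.
exists M^-1; first by rewrite invr_gt0; case: (HM z0 Kz0).
by move=> z y Kz; case: (HM z Kz) => _; apply.
Qed.

Lemma continuous_complex : continuous (fun p : R * R => p.1 +i* p.2 : C).
Proof.
move=> p; apply/cvg_ballP => e e0; have [eE er0] := pos_complexE e0.
have e2 : 0 < complex.Re e / 2 by rewrite divr_gt0.
exists (ball p.1 (complex.Re e / 2), ball p.2 (complex.Re e / 2)) => /=.
  by split; apply: nbhsx_ballx.
move=> q [h1 h2]; rewrite /ball /= normc_cabs eE ltcR.
apply: le_lt_trans (cabs_le_ReIm _) _ => /=.
by move: h1 h2; rewrite /ball /=; lra.
Qed.

Lemma compact_box (B : R) : compact [set z : Cn | forall i,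
  `|complex.Re (z 0 i)| <= B /\ `|complex.Im (z 0 i)| <= B].
Proof.
pose A := (fun p : R * R => p.1 +i* p.2 : C) @` (`[- B, B] `*` `[- B, B]).
have cA : compact A.
  apply: continuous_compact; first by apply: continuous_subspaceT; exact: continuous_complex.
  by apply: compact_setX; exact: segment_compact.
have := @rV_compact C n (fun=> A) (fun=> cA); congr compact.
apply/seteqP; split => z /= hz i; have := hz i.
  by move=> [[x y] /= [] ]; rewrite !in_itv /= => h1 h2 <- /=; rewrite !ler_norml.
case: (z 0 i) => x y /=; rewrite !ler_norml => -[h1 h2]; exists (x, y) => //=.
Qed.

Lemma usc_bounded (u : Cn -> R) (B : R) : usc u -> exists M, forall z, nrm z <= B -> u z <= M.
Proof.
move=> uu; have [||M HM] := @compact_uniform _ (fun M z => u z <= M) (@compact_box B).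
- by move=> M M' z MM' h; apply: le_trans h MM'.
- move=> a _; have a1 : u a < u a + 1 by rewrite ltrDl.
  have /nbhs_nrmP [d d0 hd] := uu a _ a1.
  by exists (u a + 1), d; split => // z /hd /ltW.
exists M => z zB; apply: HM => i.
split; first exact: le_trans (cabs_Re _) (le_trans (cabs_le_nrm z i) zB).
exact: le_trans (cabs_Im _) (le_trans (cabs_le_nrm z i) zB).
Qed.

End NrmTopology.

Lemma arc_length (R : realType) (j m : nat) : (0 < m)%N ->
  2 * (2 * pi * j.+1%:R / m%:R - 2 * pi * j%:R / m%:R) = 4 * pi / m%:R :> R.
Proof. by move=> m0; rewrite -natr1; field; rewrite pnatr_eq0 -lt0n. Qed.

Section PshMaximum.
Variables (R : realType) (n : nat).
Local Notation C := R[i].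
Local Notation Cn := 'rV[C]_n.
Implicit Types (z a b y : Cn).

(** Reduction to [lip_maximum] through the sup-convolution [w] of [u] over a ball. [L] is taken so
    large that only points within [r] of [z] matter, and upper semicontinuity keeps [u] below
    [1 + de] that close to [K]. *)
Theorem psh_maximum (u : Cn -> R) (K : set Cn) x : compact K -> psh u -> (forall z, 0 <= u z) ->
  (forall z, K z -> u z <= 1) -> hull K x -> u x <= 1.
Proof.
move=> Kc [uu su] u0 uK hx; rewrite leNgt; apply/negP => gap.
pose de := (u x - 1) / 2; have de0 : 0 < de by rewrite /de; lra.
have Kb := compact_bounded_nrm Kc.
have [R1' HR1'] := hull_bounded Kb; pose R1 := Order.max R1' 0.
have R10 : 0 <= R1 by rewrite le_max lexx orbT.
have HR1 z : hull K z -> nrm z <= R1 by move=> /HR1' h; rewrite le_max h.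
have [M' HM'] := usc_bounded (R1 + 3) uu; pose M := Order.max M' 1.
have M1 : 1 <= M by rewrite le_max lexx orbT.
have HM z : nrm z <= R1 + 3 -> u z <= M by move=> /HM' h; rewrite le_max h.
have [|rho rho0 Hrho] := @usc_near_compact R n K u (1 + de) Kc uu.
  by move=> z /uK h; lra.
pose r := Order.min rho 1; have r0 : 0 < r by rewrite lt_min rho0 ltr01.
have r1 : r <= 1 by rewrite ge_min lexx orbT.
have rrho : r <= rho by rewrite ge_min lexx.
(* Since [u <= M] on the ball, a point [y] at distance at least [r] from [z] has
   [u y - L * nrm (z - y) <= 0]. *)
pose L := M / r; have L0 : 0 < L by rewrite divr_gt0 //; lra.
have LM : L * r = M by rewrite /L divfK // gt_eqF.
pose g z y := Order.max 0 (u y - L * nrm (z - y)).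
pose S z := [set g z y | y in [set y | nrm y <= R1 + 3]].
have gM z y : nrm y <= R1 + 3 -> 0 <= g z y <= M.
  move=> /HM h; rewrite le_max lexx /= ge_max; apply/andP; split; first by lra.
  by have := mulr_ge0 (ltW L0) (nrm_ge0 (z - y)); lra.
have S0 z : S z (g z 0) by exists 0 => //=; rewrite nrm0; lra.
have hS z : has_sup (S z).
  split; first by exists (g z 0).
  by exists M => _ [y /= hy <-]; case/andP: (gM z y hy).
pose w z := sup (S z).
have gw z y : nrm y <= R1 + 3 -> g z y <= w z.
  by move=> hy; apply: sup_upper_bound => //; exists y.
have w0 z : 0 <= w z.
  by apply: le_trans (gw z 0 _); rewrite ?nrm0 ?le_max ?lexx //; lra.
have wM z : w z <= M.
  by apply: ge_sup; [case: (hS z) | move=> _ [y /= hy <-]; case/andP: (gM z y hy)].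
have wL : lipschitz_nrm L w.
  have half z z' : w z <= w z' + L * nrm (z - z').
    apply: ge_sup; first by case: (hS z).
    move=> _ [y /= hy <-]; rewrite /g ge_max; apply/andP; split.
      by rewrite addr_ge0 // mulr_ge0 ?nrm_ge0 // ltW.
    have h1 := gw z' y hy; have h2 : u y - L * nrm (z' - y) <= g z' y by rewrite le_max lexx orbT.
    have h3 : nrm (z' - y) <= nrm (z - y) + nrm (z - z').
      by have := nrmD (z - y) (z' - z); rewrite (nrmB z') addrC addrA subrK.
    have h4 : L * nrm (z' - y) <= L * (nrm (z - y) + nrm (z - z')) by rewrite ler_pM2l.
    by lra.
  move=> z z'; rewrite ler_norml; have := half z z'; have := half z' z; rewrite (nrmB z').
  by lra.
have uw z : nrm z <= R1 + 3 -> u z <= w z.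
  move=> hz; apply: le_trans (gw z z hz).
  by rewrite /g subrr nrm0 mulr0 subr0 le_max lexx orbT.
have near_only z y : 0 < u y - L * nrm (z - y) -> nrm y <= R1 + 3 -> nrm (z - y) < r.
  by move=> h /HM h2; rewrite -(ltr_pM2l L0) LM; lra.
have wS : submean (R1 + 2) (4 * pi * L) w.
  (* For a contributing [y], the sub-mean inequality of [u] on the circle around [y] is transported
     to the circle around [a]: translation costs [L * nrm (a - y)], exactly the amount subtracted in
     [g], and replacing each arc by a vertex costs the error term. *)
  move=> a b m ab m0; have mp : 0 < m%:R :> R by rewrite ltr0n.
  have pp := pi_gt0 R.
  have e0 : 0 <= 4 * pi * L * nrm b / m%:R.
    by rewrite divr_ge0 // mulr_ge0 ?nrm_ge0 // mulr_ge0 ?(ltW L0) // mulr_ge0 // ltW.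
  apply: ge_sup; first by case: (hS a).
  move=> _ [y /= hy <-]; rewrite /g ge_max; apply/andP; split.
    rewrite addr_ge0 // mulr_ge0 ?invr_ge0 ?ler0n //.
    by apply: sumr_ge0.
  have [h|h] := lerP (u y - L * nrm (a - y)) 0.
    apply: le_trans h _; rewrite addr_ge0 // mulr_ge0 ?invr_ge0 ?ler0n //.
    by apply: sumr_ge0.
  have ar := near_only _ _ h hy.
  pose c (j : nat) := w (a + omega R m ^+ j *: b) + 4 * pi * L * nrm b / m%:R + L * nrm (a - y).
  have c0 j : 0 <= c j.
    by rewrite addr_ge0 ?addr_ge0 // mulr_ge0 ?nrm_ge0 // ltW.
  have := circle_mean_le m0 c0 (fun th : R => u0 (y + expi th *: b)).
  have ya : nrm y <= nrm a + 1.
    by have := nrmD a (y - a); rewrite (nrmB y) [a + _]addrC subrK; lra.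
  move=> H; have {}H := H _.
  have uc (j : nat) th : (j < m)%N -> 2 * pi * j%:R / m%:R <= th <= 2 * pi * j.+1%:R / m%:R ->
     u (y + expi th *: b) <= c j.
    move=> jm /andP[th1 th2].
    have h1 : nrm (y + expi th *: b) <= R1 + 3.
      by have := nrmD y (expi th *: b); rewrite nrmZ cabs_expi mul1r; lra.
    have h2 := uw _ h1.
    have h3 : w (y + expi th *: b) <= w (a + omega R m ^+ j *: b) +
       L * nrm ((y + expi th *: b) - (a + omega R m ^+ j *: b)).
      have := wL (y + expi th *: b) (a + omega R m ^+ j *: b).
      by rewrite ler_norml => /andP[_]; rewrite lerBlDl.
    have h4 : nrm ((y + expi th *: b) - (a + omega R m ^+ j *: b)) <= nrm (a - y) + 4 * pi / m%:R * nrm b.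
      have -> : (y + expi th *: b) - (a + omega R m ^+ j *: b) = (y - a) + (expi th - omega R m ^+ j) *: b.
        by rewrite opprD addrACA scalerBl.
      apply: le_trans (nrmD _ _) _; rewrite (nrmB y) lerD2l nrmZ ler_wpM2r ?nrm_ge0 //.
      rewrite omegaX; apply: le_trans (expi_lip _ _) _.
      rewrite ger0_norm ?subr_ge0 //.
      rewrite -(arc_length R j m0).
      by rewrite ler_pM2l // lerD2r.
    have h5 : L * nrm ((y + expi th *: b) - (a + omega R m ^+ j *: b)) <=
       L * (nrm (a - y) + 4 * pi / m%:R * nrm b) by rewrite ler_pM2l.
    apply: (le_trans h2); apply: (le_trans h3); apply: le_trans (lerD (lexx _) h5) _.
    rewrite /c -addrA lerD2l le_eqVlt; apply/orP; left; apply/eqP; ring.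
  have aux (v m1 E F : R) : v <= m1 + (E + F) -> v - F <= m1 + E by lra.
  have := le_trans (su y b) (H uc); rewrite lee_fin.
  have -> : m%:R^-1 * (\sum_(j < m) c j) = m%:R^-1 * (\sum_(l < m) w (a + omega R m ^+ l *: b)) +
     (4 * pi * L * nrm b / m%:R + L * nrm (a - y)).
    have cst (v : R) : m%:R^-1 * (\sum_(j < m) v) = v.
      by rewrite sumr_const card_ord -[v *+ m]mulr_natl mulKf // gt_eqF.
    by rewrite /c big_split /= mulrDr big_split /= mulrDr !cst addrA.
  exact: aux.
have wK z : K z -> w z <= 1 + de.
  move=> Kz; apply: ge_sup; first by case: (hS z).
  move=> _ [y /= hy <-]; rewrite /g ge_max; apply/andP; split; first by lra.
  have [h|h] := lerP (u y - L * nrm (z - y)) 0; first by lra.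
  have zr := near_only _ _ h hy.
  have zr' : nrm (y - z) < rho by rewrite nrmB; apply: lt_le_trans rrho.
  have := Hrho z y Kz zr'; have := mulr_ge0 (ltW L0) (nrm_ge0 (z - y)); lra.
have := @lip_maximum R n w L M (4 * pi * L) R1 (1 + de) K x (ltW L0) _ R10 _ wL wS HR1 wK hx.
have ux := uw x _; move=> H.
have : w x <= 1 + de.
  apply: H; first by rewrite mulr_ge0 ?(ltW L0) // mulr_ge0 // ltW // pi_gt0.
  by move=> z; rewrite ger0_norm.
have : u x <= w x by apply: ux; have := HR1 x hx; lra.
by rewrite /de; lra.
Qed.

End PshMaximum.

(** * Quasi-homogeneous polynomials *)

Section QuasiHomogeneous.
Variables (R : realType) (n : nat) (lam : 'I_n -> R).
Local Notation C := R[i].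
Local Notation Cn := 'rV[C]_n.
Implicit Types (z : Cn) (t : C).

Definition weight (a : 'I_n -> nat) : R := \sum_i (a i)%:R * lam i.

Definition term (p : C * ('I_n -> nat)) z : C := p.1 * monom p.2 z.

Lemma monom_Phi a z t : monom a (Phi lam z t) = cexp (- ((weight a)%:C * t)) * monom a z.
Proof.
rewrite /monom /Phi.
have -> : cexp (- ((weight a)%:C * t)) = \prod_i cexp (- ((lam i)%:C * t)) ^+ a i.
  rewrite (eq_bigr (fun i => cexp (- ((lam i)%:C * t) *+ a i))); last first.
    by move=> i _; rewrite cexpMn.
  rewrite -cexp_sum; congr cexp; rewrite /weight (rmorph_sum (real_complex R)) mulr_suml -sumrN.
  apply: eq_bigr => i _; rewrite mulNrn; congr (- _); rewrite -[(_ * t) *+ _]mulr_natl mulrA.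
  by congr (_ * _); rewrite (rmorphM (real_complex R)) (rmorph_nat (real_complex R)).
rewrite -big_split; apply: eq_bigr => i _; rewrite mxE exprMn mulrC.
by [].
Qed.

Lemma term_Phi p z t : term p (Phi lam z t) = cexp (- ((weight p.2)%:C * t)) * term p z.
Proof. by rewrite /term monom_Phi; ring. Qed.

Lemma cexp_conj t : conjc (cexp t) = cexp (conjc t).
Proof.
case: t => a b; apply/eqP; rewrite eq_complex /= cosN sinN.
by apply/andP; split; apply/eqP; ring.
Qed.

Lemma monom_conj a z : monom a (map_mx conjc z) = conjc (monom a z).
Proof.
rewrite /monom (rmorph_prod (@conjc R)); apply: eq_bigr => i _.
by rewrite mxE (rmorphXn (@conjc R)).
Qed.

Section Characters.
Variables (I : Type) (A : I -> Cn -> C) (chi : I -> C -> C) (chi0 : C -> C) (Q : Cn -> C).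
Hypothesis chiD : forall i s t, chi i (s + t) = chi i s * chi i t.
Hypothesis chi0D : forall s t, chi0 (s + t) = chi0 s * chi0 t.
Hypothesis chi0_neq0 : forall t, chi0 t != 0.
Let good i := forall t, 0 < complex.Re t -> chi i t = chi0 t.
Let comb (l : seq (C * I)) z t := \sum_(x <- l) x.1 * A x.2 z * chi x.2 t.

(* Dedekind's independence of characters, one character at a time: shifting by [t0] and subtracting [chi x t0] times the relation kills the term [x]. *)
Lemma isolate_character (l2 l1 : seq (C * I)) (kap : C) : kap != 0 ->
  (forall i, List.In i (map snd l1) -> good i) ->
  (forall z t, 0 < complex.Re t -> comb l1 z t + comb l2 z t = kap * Q z * chi0 t) ->
  exists l, (forall i, List.In i (map snd l) -> good i) /\ forall z, Q z = \sum_(x <- l) x.1 * A x.2 z.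
Proof.
move: l1 kap; have [N hN] := ubnP (size l2).
elim: N l2 hN => // N IH l2 hN l1 kap k0 g1 H.
case: l2 hN H => [|x l2] /= hN H.
  have k1 : kap * chi0 1 != 0 by rewrite mulf_neq0.
  exists [seq ((kap * chi0 1)^-1 * x.1 * chi0 1, x.2) | x <- l1]; split.
    move=> i; rewrite -map_comp => hi; apply: g1.
    by move: hi; congr (List.In _ _); apply: eq_map.
  move=> z; have := H z 1 ltr01; rewrite {2}/comb big_nil addr0 => h.
  rewrite big_map /=.
  have -> : Q z = (kap * chi0 1)^-1 * (kap * Q z * chi0 1).
    by rewrite mulrAC mulKf.
  rewrite -h /comb mulr_sumr.
  elim: l1 g1 {H h} => [|y l1 IH1] g1; first by rewrite !big_nil.
  rewrite !big_cons IH1; last by move=> i hi; apply: g1; right.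
  have cy : chi y.2 1 = chi0 1 by apply: (g1 y.2 (or_introl erefl)); exact: ltr01.
  by rewrite cy; congr (_ + _); ring.
have [gx|ngx] := pselect (good x.2).
  apply: (IH l2 _ (x :: l1) kap k0) => //.
    by move=> i /= [<- //|]; apply: g1.
  move=> z t t0; rewrite -(H z t t0) /comb !big_cons; ring.
have [t0 [t00 nt0]] : exists t0, 0 < complex.Re t0 /\ chi x.2 t0 != chi0 t0.
  apply: contrapT => h; apply: ngx => t tp; apply/eqP/negPn/negP => ht.
  by apply: h; exists t.
pose f (y : C * I) := (y.1 * (chi y.2 t0 - chi x.2 t0), y.2).
apply: (IH (map f l2) _ (map f l1) (kap * (chi0 t0 - chi x.2 t0))).
- by rewrite size_map.
- by rewrite mulf_neq0 // subr_eq0 eq_sym.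
- move=> i; rewrite -map_comp => hi; apply: g1.
  by move: hi; congr (List.In _ _); apply: eq_map.
move=> z t tp.
have combf l : comb (map f l) z t = comb l z (t + t0) - chi x.2 t0 * comb l z t.
  rewrite /comb big_map mulr_sumr -sumrB; apply: eq_bigr => y _ /=.
  by rewrite chiD; ring.
rewrite !combf.
have tt0 : 0 < complex.Re (t + t0) by rewrite ReD addr_gt0.
have h1 := H z _ tt0; have h2 := H z t tp.
rewrite /comb !big_cons chiD chi0D in h1 h2; rewrite -/(comb _ _ _) in h1 h2.
have -> : kap * (chi0 t0 - chi x.2 t0) * Q z * chi0 t =
   kap * Q z * (chi0 t * chi0 t0) - chi x.2 t0 * (kap * Q z * chi0 t) by ring.
by rewrite -h1 -h2 /comb; ring.
Qed.

End Characters.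

Hypothesis lam_gt0 : forall i, 0 < lam i.

Lemma weight_ge0 a : 0 <= weight a.
Proof. by apply: sumr_ge0 => i _; rewrite mulr_ge0 // ltW. Qed.

Lemma weight_eq0 a : weight a = 0 -> forall i, a i = 0%N.
Proof.
move=> /eqP; rewrite psumr_eq0 => [/allP h i|i _]; last by rewrite mulr_ge0 // ltW.
have := h i (mem_index_enum _); rewrite /= mulf_eq0 (gt_eqF (lam_gt0 i)) orbF.
by rewrite pnatr_eq0 => /eqP.
Qed.

Lemma monom0 a z : (forall i, a i = 0%N) -> monom a z = 1.
Proof. by move=> a0; rewrite /monom big1 // => i _; rewrite a0 expr0. Qed.

(** Moduli at [t = 1] give the sum. For the difference, comparing [t = 1] with $t=1+i\tau$ gives
    $e^{ie\tau}=1$, where [e] is the discrepancy; $\tau=1/|e|$ makes the angle $\pm1$, which is no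
    multiple of $2\pi$. *)
Lemma character_weights (wa wb d : R) :
  (forall t : C, 0 < complex.Re t -> cexp (- (wa%:C * t) - wb%:C * conjc t) = cexp (- (d%:C * t))) ->
  wa + wb = d /\ wa - wb = d.
Proof.
move=> H; split.
  have := congr1 (@cabs R) (H 1 ltr01); rewrite !cabs_cexp => /expR_inj.
  by rewrite ReD !ReN !Re_realM /= => h; lra.
apply: contrapT => nd; pose e := d - (wa - wb).
have e0 : e != 0 by rewrite subr_eq0 eq_sym; apply/eqP.
have en : 0 < `|e| by rewrite normr_gt0.
pose tau := `|e|^-1; have tau0 : 0 < tau by rewrite invr_gt0.
have := H (1 +i* tau) ltr01; have := H 1 ltr01.
have -> : - (wa%:C * (1 +i* tau)) - wb%:C * conjc (1 +i* tau) =
   (- (wa%:C * 1) - wb%:C * conjc 1) + (- (wa - wb) * tau) *i.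
  by apply/eqP; rewrite eq_complex /=; apply/andP; split; apply/eqP; ring.
have -> : - (d%:C * (1 +i* tau)) = - (d%:C * 1) + (- d * tau) *i.
  by apply/eqP; rewrite eq_complex /=; apply/andP; split; apply/eqP; ring.
rewrite !cexpD -/(expi _) => ->.
move/(mulfI (cexp_neq0 _)) => h.
have e1 : expi (e * tau) = 1.
  have -> : e * tau = - (wa - wb) * tau + d * tau by rewrite /e; ring.
  rewrite expiD; have -> : expi (- (wa - wb) * tau) = expi (- d * tau) by [].
  by rewrite -expiD mulNr addNr expi0.
have pi1 : 1 < 2 * pi :> R by have := pi_ge2 R; lra.
have et : `|e * tau| = 1 by rewrite normrM (gtr0_norm tau0) divff // gt_eqF.
have [ep|en'] := lerP 0 (e * tau).
  rewrite ger0_norm // in et; have := @expi_neq1 R (e * tau).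
  by rewrite e1 et eqxx ltr01 pi1 => /(_ isT).
rewrite ltr0_norm // in et; have := @expi_neq1 R (- (e * tau)).
have -> : expi (- (e * tau)) = 1.
  by have := expiD (e * tau) (- (e * tau)); rewrite subrr expi0 e1 mul1r.
by rewrite et eqxx ltr01 pi1 => /(_ isT).
Qed.

(** A monomial in $z,\bar z$ transforms by a character of [t], and only the terms with the character
    of [q] are kept. For these the weight of the conjugate exponent vanishes, hence so does the
    exponent, all [lam i] being positive. *)
Lemma quasi_hom_holomorphic d q : quasi_hom lam d 0 q ->
  exists s : seq (C * ('I_n -> nat)),
    (forall p, List.In p s -> weight p.2 = d) /\ forall z, q z = \sum_(p <- s) term p z.
Proof.
move=> [[s Hs] Hq].
pose I := (('I_n -> nat) * ('I_n -> nat))%type.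
pose A (i : I) z := monom i.1 z * monom i.2 (map_mx conjc z).
pose chi (i : I) t := cexp (- ((weight i.1)%:C * t) - (weight i.2)%:C * conjc t).
pose chi0 t := cexp (- (d%:C * t)).
have chiD i u t : chi i (u + t) = chi i u * chi i t.
  by rewrite /chi -cexpD; congr cexp; rewrite (rmorphD (@conjc R)); ring.
have chi0D u t : chi0 (u + t) = chi0 u * chi0 t.
  by rewrite /chi0 -cexpD; congr cexp; ring.
have conjM (u v : C) : conjc (u * v) = conjc u * conjc v by apply: rmorphM.
have conjN (u : C) : conjc (- u) = - conjc u by apply: rmorphN.
pose l2 := [seq (x.1.1, (x.1.2, x.2)) | x <- s].
have H z t : 0 < complex.Re t ->
    \sum_(x <- [::]) x.1 * A x.2 z * chi x.2 t + \sum_(x <- l2) x.1 * A x.2 z * chi x.2 t =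
    1 * q z * chi0 t.
  move=> tp; rewrite big_nil add0r big_map mul1r.
  have := Hq t z tp; rewrite rmorph0 mul0r oppr0 cexp0 mulr1 => h.
  rewrite mulrC -/(chi0 t) -h Hs; apply: eq_bigr => x _ /=.
  rewrite /A !monom_conj !monom_Phi /chi cexpD conjM cexp_conj.
  have -> : conjc (- ((weight x.2)%:C * t)) = - ((weight x.2)%:C * conjc t).
    by rewrite conjN conjM conjc_real.
  by ring.
have [l [gl Hl]] := isolate_character chiD chi0D (fun t => cexp_neq0 _)
  (oner_neq0 _) (fun i (h : List.In i (map snd [::])) => False_ind _ h) H.
have gw (i : I) : List.In i (map snd l) -> weight i.1 = d /\ forall j, i.2 j = 0%N.
  move=> /gl gi; have [h1 h2] := character_weights gi.
  have w2 : weight i.2 = 0 by lra.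
  by split; [lra | apply: weight_eq0].
exists [seq (x.1, x.2.1) | x <- l]; split.
  move=> p /List.in_map_iff [x [<- xl]] /=; apply: (gw x.2 _).1.
  exact: List.in_map.
move=> z; rewrite Hl big_map; elim: l gw {gl Hl} => [|x l IH] gw; first by rewrite !big_nil.
rewrite !big_cons IH; last by move=> i hi; apply: gw; right.
congr (_ + _); rewrite /term /A /=; have [_ h] := gw x.2 (or_introl erefl).
by rewrite (monom0 _ h) mulr1.
Qed.

End QuasiHomogeneous.

(** * Homogeneous parts on circular sets *)

Section HomogeneousParts.
Variables (R : realType) (n : nat) (lam : 'I_n -> R).
Local Notation C := R[i].
Local Notation Cn := 'rV[C]_n.
Local Notation wt := (weight lam).
Implicit Types (z w : Cn) (s : seq (C * ('I_n -> nat))) (d : R).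

Definition hom_part s d z : C := \sum_(p <- s | wt p.2 == d) term p z.

Lemma geometric_bounded (x : C) N : cabs x = 1 -> x != 1 ->
  cabs (\sum_(j < N) x ^+ j) <= 2 / cabs (1 - x).
Proof.
move=> x1 xn; have p : 0 < cabs (1 - x) by rewrite cabs_gt0 subr_eq0 eq_sym.
rewrite ler_pdivlMr // mulrC -cabsM -[1 - x]opprB mulNr -subrX1 cabsN.
by apply: le_trans (cabsD _ _) _; rewrite cabsN cabs1 cabsX x1 expr1n.
Qed.

(* Averaging [e^(i d h j) q(Phi(z, i h j))] over [j < N] keeps the terms of weight [d] and damps the others like [1/N], once [h] is so small that no other frequency is resonant. *)
Lemma hom_part_le (K : set Cn) s d (S : R) : lam_circular lam K ->
  (forall z, K z -> cabs (\sum_(p <- s) term p z) <= S) ->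
  forall z, K z -> cabs (hom_part s d z) <= S.
Proof.
move=> Kc KS z Kz.
pose W := 1 + \sum_(p <- s) `|d - wt p.2|; have W0 : 0 < W by rewrite ltr_wpDr // sumr_ge0.
pose h := W^-1; have h0 : 0 < h by rewrite invr_gt0.
pose x (p : C * ('I_n -> nat)) := expi ((d - wt p.2) * h) : C.
have x1 p : wt p.2 == d -> x p = 1 by rewrite /x => /eqP ->; rewrite subrr mul0r expi0.
have xn p : p \in s -> wt p.2 != d -> x p != 1.
  move=> ps pd; pose e := (d - wt p.2) * h.
  have pi1 : 1 < 2 * pi :> R by have := pi_ge2 R; lra.
  have e0 : 0 < `|e| by rewrite normr_gt0 mulf_neq0 ?(gt_eqF h0) // subr_eq0 eq_sym.
  have e1 : `|e| < 2 * pi.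
    apply: le_lt_trans pi1; rewrite normrM (gtr0_norm h0) ler_pdivrMr // mul1r /W.
    rewrite (big_rem p ps) /=.
    have : 0 <= \sum_(y <- rem p s) `|d - wt y.2| by rewrite sumr_ge0.
    by lra.
  have [ep|en] := lerP 0 e.
    by rewrite ger0_norm // in e0 e1; apply: expi_neq1; rewrite e0 e1.
  rewrite ltr0_norm // in e0 e1; have := @expi_neq1 R (- e); rewrite e0 e1 => /(_ isT).
  apply: contra => /eqP xe; have := expiD e (- e).
  by rewrite subrr expi0 [expi e]xe mul1r => <-.
pose T := \sum_(p <- s | wt p.2 != d) cabs (term p z) * (2 / cabs (1 - x p)).
have T0 : 0 <= T.
  by apply: sumr_ge0 => p _; rewrite mulr_ge0 ?divr_ge0 ?cabs_ge0.
have key N : N%:R * cabs (hom_part s d z) <= N%:R * S + T.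
  have -> : N%:R * cabs (hom_part s d z) = cabs (N%:R * hom_part s d z).
    by rewrite cabsM cabs_nat.
  have -> : N%:R * hom_part s d z =
      \sum_(j < N) expi (d * h) ^+ j * (\sum_(p <- s) term p (Phi lam z ((j%:R * h) *i)))
      - \sum_(p <- s | wt p.2 != d) term p z * (\sum_(j < N) x p ^+ j).
    apply/eqP; rewrite eq_sym subr_eq; apply/eqP.
    under eq_bigr do rewrite mulr_sumr.
    rewrite exchange_big /= (bigID (fun p => wt p.2 == d)) /= mulr_sumr.
    have st p (j : 'I_N) : expi (d * h) ^+ j * term p (Phi lam z ((j%:R * h) *i)) =
       term p z * x p ^+ j.
      rewrite term_Phi /x mulrBl expiD [(_ * expi (- _)) ^+ j]exprMn [RHS]mulrC -[RHS]mulrA; congr (_ * (_ * _)).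
      rewrite -expiMn -mulr_natl; congr cexp.
      by apply/eqP; rewrite eq_complex /=; apply/andP; split; apply/eqP; ring.
    congr (_ + _); apply: eq_bigr => p pd.
      under eq_bigr do rewrite st x1 // expr1n mulr1.
      by rewrite sumr_const card_ord mulr_natl.
    by rewrite mulr_sumr; apply: eq_bigr => j _; rewrite st.
  apply: le_trans (cabsD _ _) _; rewrite cabsN; apply: lerD.
    apply: le_trans (cabs_sum _ _ _) _.
    have -> : N%:R * S = \sum_(j < N) S by rewrite sumr_const card_ord mulr_natl.
    apply: ler_sum => j _; rewrite cabsM cabsX cabs_expi expr1n mul1r.
    by apply: KS; apply: Kc.
  apply: le_trans (cabs_sum _ _ _) _; rewrite big_seq_cond [leRHS]big_seq_cond.
  apply: ler_sum => p /andP[ps pd]; rewrite cabsM ler_wpM2l ?cabs_ge0 //.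
  by apply: geometric_bounded; [exact: cabs_expi | exact: xn].
rewrite leNgt; apply/negP => gap.
have g0 : 0 < cabs (hom_part s d z) - S by rewrite subr_gt0.
have := key (Num.truncn (T / (cabs (hom_part s d z) - S))).+1.
rewrite -lerBlDl -mulrBr leNgt => /negP; apply.
by rewrite -ltr_pdivrMr // truncnS_gt.
Qed.

Lemma quasi_hom_hom_part s d : quasi_hom lam d 0 (hom_part s d).
Proof.
split.
  exists [seq (p, fun=> 0%N) | p <- s & wt p.2 == d] => z.
  rewrite big_map big_filter; apply: eq_bigr => p _ /=.
  by rewrite [monom (fun=> 0%N) _]monom0 ?mulr1.
move=> t z _; rewrite rmorph0 mul0r oppr0 cexp0 mulr1 /hom_part mulr_sumr.
by apply: eq_bigr => p /eqP <-; rewrite term_Phi.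
Qed.

Lemma sum_hom_part s z :
  \sum_(p <- s) term p z = \sum_(d <- undup [seq wt p.2 | p <- s]) hom_part s d z.
Proof.
rewrite /hom_part (exchange_big_dep xpredT) //= [LHS]big_seq [RHS]big_seq.
apply: eq_bigr => p ps.
rewrite (eq_bigl (fun d => d == wt p.2)) => [|d]; last by rewrite eq_sym.
rewrite -big_filter filter_pred1_uniq ?undup_uniq ?big_seq1 // mem_undup.
by apply/mapP; exists p.
Qed.

Lemma size_weights s D : (forall p, p \in s -> forall i, (p.2 i <= D)%N) ->
  (size (undup [seq wt p.2 | p <- s]) <= D.+1 ^ n)%N.
Proof.
move=> sD.
have -> : (D.+1 ^ n)%N = size [seq wt (fun i => f i : nat) | f : {ffun 'I_n -> 'I_D.+1} <- enum {ffun 'I_n -> 'I_D.+1}].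
  by rewrite size_map -cardE card_ffun !card_ord.
apply: uniq_leq_size; first exact: undup_uniq.
move=> d; rewrite mem_undup => /mapP [p ps ->]; apply/mapP.
exists [ffun i => inord (p.2 i)]; first by rewrite mem_enum.
by apply: eq_bigr => i _; rewrite ffunE inordK // ltnS sD.
Qed.

Lemma lam_hull_hom_part (K : set Cn) s d (S : R) z : lam_circular lam K -> lam_hull lam K z ->
  (forall w, K w -> cabs (\sum_(p <- s) term p w) <= S) ->
  d \in [seq wt p.2 | p <- s] -> cabs (hom_part s d z) <= S.
Proof.
move=> Kc hz KS /mapP [p ps dE]; rewrite -lee_fin.
apply: le_trans (hz d _ _ (quasi_hom_hom_part s d)) _; first by exists p.2.
by apply: ge_ereal_sup => _ [w Kw <-]; rewrite lee_fin; apply: (hom_part_le d Kc KS).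
Qed.

Lemma lam_hull_degree (K : set Cn) s D (S : R) z : lam_circular lam K -> 0 <= S -> lam_hull lam K z ->
  (forall p, p \in s -> forall i, (p.2 i <= D)%N) ->
  (forall w, K w -> cabs (\sum_(p <- s) term p w) <= S) ->
  cabs (\sum_(p <- s) term p z) <= (D.+1 ^ n)%:R * S.
Proof.
move=> Kc S0 hz sD KS; rewrite sum_hom_part; apply: le_trans (cabs_sum _ _ _) _.
apply: (@le_trans _ _ (\sum_(d <- undup [seq wt p.2 | p <- s]) S)).
  rewrite big_seq [leRHS]big_seq; apply: ler_sum => d; rewrite mem_undup => ds.
  exact: (lam_hull_hom_part Kc hz KS).
rewrite big_const_seq count_predT iter_addr_0 -[S *+ _]mulr_natl ler_wpM2r // ler_nat.
exact: size_weights.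
Qed.

Lemma power_terms s D k : (forall p, p \in s -> forall i, (p.2 i <= D)%N) ->
  exists s', (forall p, p \in s' -> forall i, (p.2 i <= k * D)%N) /\
    forall z, \sum_(p <- s') term p z = (\sum_(p <- s) term p z) ^+ k.
Proof.
move=> sD; elim: k => [|k [t [tD Ht]]].
  exists [:: (1, fun=> 0%N)]; split; first by move=> p; rewrite inE => /eqP ->.
  by move=> z; rewrite big_seq1 expr0 /term mul1r monom0.
exists [seq (x.1 * y.1, fun i => (x.2 i + y.2 i)%N) | x <- s, y <- t]; split.
  move=> p /allpairsP [[x y] /= [xs yt ->]] i /=; rewrite mulSn.
  by apply: leq_add; [apply: sD | apply: tD].
move=> z; rewrite exprS -Ht big_allpairs_dep mulr_suml; apply: eq_bigr => x _ /=.
rewrite mulr_sumr; apply: eq_bigr => y _ /=.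
by rewrite /term /= -monomM; ring.
Qed.

(* The number of weights of [q^k] grows only polynomially in [k], so the constant of [lam_hull_degree] disappears after taking [k]-th roots. *)
Lemma lam_hull_sub_hull (K : set Cn) : lam_circular lam K -> K !=set0 ->
  lam_hull lam K `<=` hull K.
Proof.
move=> Kc [w0 Kw0] z hz q [s Hs] S KS; have S0 : 0 <= S by apply: le_trans (cabs_ge0 _) (KS _ Kw0).
pose D := (\max_(p <- s) \max_i p.2 i)%N.
have sD p : p \in s -> forall i, (p.2 i <= D)%N.
  move=> ps i; apply: leq_trans (leq_bigmax_seq _ ps _) => //.
  exact: (leq_bigmax i).
have Hs' w : \sum_(p <- s) term p w = q w by rewrite Hs.
have bound k : cabs (q z) ^+ k <= ((k * D).+1 ^ n)%:R * S ^+ k.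
  have [t [tD Ht]] := power_terms k sD.
  have := lam_hull_degree Kc (exprn_ge0 k S0) hz tD _; rewrite Ht Hs' cabsX; apply.
  move=> w Kw; rewrite Ht Hs' cabsX.
  by apply: lerXn2r; rewrite ?nnegrE ?cabs_ge0 // KS.
have [S1|S1] := eqVneq S 0.
  by have := bound 1%N; rewrite !expr1 S1 mulr0.
have Sp : 0 < S by rewrite lt0r S1.
rewrite leNgt; apply/negP => gap; pose y := cabs (q z) / S.
have y1 : 1 < y by rewrite /y ltr_pdivlMr // mul1r.
(* With exponent $(n+1)j$ the number of weights is at most the $(n+1)$-th power of $1+(n+1)Dj$, so
   it suffices that $y^j$ exceed this affine function. *)
have [j hj] := exprn_gt_affine 1 (n.+1%:R * D%:R) y1.
have := bound (n.+1 * j)%N; apply/negP; rewrite -ltNge.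
rewrite -ltr_pdivlMr ?exprn_gt0 // -expr_div_n -/y [(n.+1 * j)%N]mulnC exprM.
apply: (@le_lt_trans _ _ (((j * n.+1 * D).+1)%:R ^+ n.+1)).
  by rewrite -natrX ler_nat leq_pexp2l.
rewrite ltrXn2r //.
by apply: le_lt_trans hj; rewrite -natr1 !natrM; rewrite le_eqVlt; apply/orP; left; apply/eqP; ring.
Qed.

End HomogeneousParts.

Section HullEqualities.
Variables (R : realType) (n : nat) (lam : 'I_n -> R).
Local Notation C := R[i].
Local Notation Cn := 'rV[C]_n.
Implicit Types (z w : Cn) (K : set Cn) (q : Cn -> C).

Lemma le_supnorm K q w : K w -> ((cabs (q w))%:E <= supnorm K q)%E.
Proof. by move=> Kw; apply: ereal_sup_ubound; exists w. Qed.

Lemma supnorm_le K q c : (forall w, K w -> cabs (q w) <= c) -> (supnorm K q <= c%:E)%E.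
Proof. by move=> h; apply: ge_ereal_sup => _ [w Kw <-]; rewrite lee_fin; apply: h. Qed.

Lemma poly_hullE K : K !=set0 -> poly_hull K = hull K.
Proof.
move=> [w Kw]; apply/seteqP; split => z hz q hq.
  by move=> c /supnorm_le h; rewrite -lee_fin; apply: le_trans (hz q hq) h.
case E : (supnorm K q) => [r||]; rewrite ?leey //.
  by rewrite lee_fin; apply: hz => // y Ky; rewrite -lee_fin -E; apply: le_supnorm.
by have := le_supnorm q Kw; rewrite E.
Qed.

Hypothesis lam_gt0 : forall i, 0 < lam i.

Lemma poly_hull_sub_lam_hull K : poly_hull K `<=` lam_hull lam K.
Proof.
move=> z hz d _ q /(quasi_hom_holomorphic lam_gt0) [s [_ Hs]].
by apply: hz; exists s.
Qed.

Lemma poly_hull_lam_hull K : lam_circular lam K -> K !=set0 -> poly_hull K = lam_hull lam K.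
Proof.
move=> Kc K0; apply/seteqP; split; first exact: poly_hull_sub_lam_hull.
by rewrite (poly_hullE K0); apply: lam_hull_sub_hull.
Qed.

Lemma quasi_hom_weight0 q z w : quasi_hom lam 0 0 q -> q z = q w.
Proof.
move=> /(quasi_hom_holomorphic lam_gt0) [s [sd Hs]]; rewrite !Hs {Hs}.
elim: s sd => [|p s IH] sd; first by rewrite !big_nil.
rewrite !big_cons IH; last by move=> y ys; apply: sd; right.
have /(weight_eq0 lam_gt0) p0 := sd p (or_introl erefl).
by rewrite /term !monom0.
Qed.

Lemma quasi_hom_origin d q : d != 0 -> quasi_hom lam d 0 q -> q 0 = 0.
Proof.
move=> d0 [_ Hq]; have := Hq 1 0 ltr01.
have -> : Phi lam 0 1 = 0 :> Cn by apply/rowP => i; rewrite !mxE mul0r.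
rewrite rmorph0 mul0r oppr0 cexp0 !mulr1 => h.
have [//|q0] := eqVneq (q 0) 0.
have := congr1 (@cabs R) h; rewrite cabsM cabs_cexp /= => h2.
have : expR (- d) = 1.
  apply: (@mulIf _ (cabs (q 0))); first by rewrite gt_eqF // cabs_gt0.
  by rewrite mul1r [RHS]h2.
by rewrite -expR0 => /expR_inj /eqP; rewrite oppr_eq0 (negPf d0).
Qed.

Lemma lam_hull_origin K : K !=set0 -> lam_hull lam K 0.
Proof.
move=> [w Kw] d _ q hq; apply: le_trans (le_supnorm q Kw); rewrite lee_fin.
have [d0|d0] := eqVneq d 0.
  by rewrite d0 in hq; rewrite (quasi_hom_weight0 0 w hq).
by rewrite (quasi_hom_origin d0 hq) cabs0 cabs_ge0.
Qed.

Lemma Psi_le1 K z : compact K -> hull K z -> (Psi lam K z <= 1%:E)%E.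
Proof.
move=> Kc hz; apply: ge_ereal_sup => _ [u [[pu _ u0 _] uK] <-]; rewrite lee_fin.
exact: psh_maximum Kc pu u0 uK hz.
Qed.

End HullEqualities.

(** * Powers of the modulus of a polynomial *)

Section PowerContinuity.
Variables (R : realType) (al : R).
Hypothesis al_gt0 : 0 < al.
Implicit Types (x y s c e B : R).

Lemma powRK x : 0 <= x -> (x `^ al^-1) `^ al = x.
Proof. by move=> x0; rewrite -powRrM mulVf ?gt_eqF // powRr1. Qed.

Lemma powR_invlt x y : 0 <= x -> 0 <= y -> x `^ al < y -> x < y `^ al^-1.
Proof.
move=> x0 y0; rewrite !ltNge; apply: contra => h; rewrite -[leLHS]powRK //.
by apply: ge0_ler_powR; rewrite ?nnegrE ?powR_ge0 ?(ltW al_gt0).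
Qed.

Lemma powR_lt_inv x y : 0 <= x -> 0 <= y -> x < y `^ al^-1 -> x `^ al < y.
Proof.
move=> x0 y0 h; rewrite -[ltRHS]powRK //.
by apply: gt0_ltr_powR; rewrite ?nnegrE ?powR_ge0.
Qed.

Lemma powR_inv_lt x y : 0 <= x -> 0 <= y -> y `^ al^-1 < x -> y < x `^ al.
Proof.
move=> x0 y0 h; rewrite -[ltLHS]powRK //.
by apply: gt0_ltr_powR; rewrite ?nnegrE ?powR_ge0.
Qed.

(** Obtained from monotonicity and the inverse power, which treats the point 0, where small
    exponents have infinite slope, on the same footing. When $x^{al}\le e$ only the upper estimate
    has content. *)
Lemma powR_continuous_ge0 x e : 0 <= x -> 0 < e ->
  exists2 d, 0 < d & forall y, 0 <= y -> `|y - x| < d -> `|y `^ al - x `^ al| <= e.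
Proof.
move=> x0 e0; have xa0 := powR_ge0 x al.
have up0 : 0 <= x `^ al + e by rewrite addr_ge0 // ltW.
have up : x < (x `^ al + e) `^ al^-1 by apply: powR_invlt; rewrite // ltrDl.
have [lo|lo] := lerP (x `^ al) e.
  exists ((x `^ al + e) `^ al^-1 - x); first by rewrite subr_gt0.
  move=> y y0; rewrite ltr_norml ltrBlDr subrK => /andP[_ h].
  have := powR_lt_inv y0 up0 h; have := powR_ge0 y al.
  by rewrite ler_norml => h1 h2; apply/andP; split; lra.
have lo0 : 0 <= x `^ al - e by rewrite subr_ge0 ltW.
have dn : (x `^ al - e) `^ al^-1 < x.
  rewrite ltNge; apply/negP => h.
  have : x `^ al <= x `^ al - e.
    by rewrite -[leRHS]powRK //; apply: ge0_ler_powR; rewrite ?nnegrE ?powR_ge0 ?(ltW al_gt0).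
  by lra.
exists (Order.min ((x `^ al + e) `^ al^-1 - x) (x - (x `^ al - e) `^ al^-1)).
  by rewrite lt_min !subr_gt0 up.
move=> y y0; rewrite lt_min !ltr_norml => /andP[/andP[_ h1] /andP[h2 _]].
have h3 : y < (x `^ al + e) `^ al^-1 by move: h1; rewrite ltrBlDr subrK.
have h4 : (x `^ al - e) `^ al^-1 < y by move: h2; rewrite opprB ltrBrDr subrK.
have := powR_lt_inv y0 up0 h3; have := powR_inv_lt y0 lo0 h4.
by rewrite ler_norml => h5 h6; apply/andP; split; lra.
Qed.

Lemma powR_uniform B e : 0 < e -> exists2 d, 0 < d &
  forall x y, 0 <= x <= B -> 0 <= y -> `|y - x| < d -> `|y `^ al - x `^ al| <= e.
Proof.
move=> e0; have e2 : 0 < e / 2 by rewrite divr_gt0.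
have [||M HM] := @segment_uniform R (fun M x => 0 < M /\ (0 <= x -> forall y, 0 <= y ->
    `|y - x| < M^-1 -> `|y `^ al - x `^ al| <= e)) 0 B.
- move=> M M' x MM' [M0 h]; have M'0 : 0 < M' by apply: lt_le_trans MM'.
  by split => // x0 y y0 hy; apply: h => //; apply: lt_le_trans hy _; rewrite lef_pV2.
- move=> x /andP[x0 _]; have [d d0 hd] := powR_continuous_ge0 x0 e2.
  exists (2 / d), (d / 2); split; first by rewrite divr_gt0.
  move=> x' hx'; split; first by rewrite divr_gt0.
  move=> x'0 y y0; rewrite invf_div => hy.
  have h1 := hd x' x'0; have h2 := hd y y0.
  have {}h1 : `|x' `^ al - x `^ al| <= e / 2 by apply: h1; lra.
  have {}h2 : `|y `^ al - x `^ al| <= e / 2.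
    by apply: h2; have := ler_normD (y - x') (x' - x); rewrite addrA subrK; lra.
  have := ler_normD (y `^ al - x `^ al) (x `^ al - x' `^ al); rewrite addrA subrK.
  by rewrite [`|x `^ al - _|]distrC; lra.
have [B0|B0] := lerP 0 B; last first.
  by exists 1 => // x y /andP[h1 h2]; lra.
have [M0 _] := HM 0 (introT andP (conj (lexx 0) B0)).
exists M^-1; first by rewrite invr_gt0.
by move=> x y xB y0; have [_] := HM x xB; apply => //; case/andP: xB.
Qed.

End PowerContinuity.

Section PowerModulus.
Variables (R : realType) (n : nat).
Local Notation C := R[i].
Local Notation Cn := 'rV[C]_n.
Implicit Types (z w a b : Cn) (q : Cn -> C).

Lemma is_poly_lipschitz q (B : R) : is_poly q -> exists2 L, 0 <= L &
  forall z w, nrm z <= B -> nrm w <= B -> cabs (q z - q w) <= L * nrm (z - w).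
Proof.
pose P q := is_poly q /\ exists2 L, 0 <= L &
  forall z w, nrm z <= B -> nrm w <= B -> cabs (q z - q w) <= L * nrm (z - w).
move=> hq; suff : P q by case.
move: q hq; apply: (@is_poly_ind R n P).
- move=> c; split; first exact: is_poly_cst.
  by exists 0 => // z w _ _; rewrite subrr cabs0 mul0r.
- move=> i; split; first exact: is_poly_coord.
  by exists 1 => // z w _ _; rewrite mul1r; have := cabs_le_nrm (z - w) i; rewrite !mxE.
- move=> q p [hq [L L0 HL]] [hp [L' L'0 HL']]; split; first exact: is_polyD.
  exists (L + L'); first exact: addr_ge0.
  move=> z w zB wB; rewrite opprD addrACA mulrDl; apply: le_trans (cabsD _ _) _.
  by apply: lerD; [apply: HL | apply: HL'].
move=> q p [hq [L L0 HL]] [hp [L' L'0 HL']]; split; first exact: is_polyM.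
have [M HM] := is_poly_bounded B hq; have [M' HM'] := is_poly_bounded B hp.
exists (`|M| * L' + `|M'| * L); first by rewrite addr_ge0 // mulr_ge0.
move=> z w zB wB.
have -> : q z * p z - q w * p w = q z * (p z - p w) + p w * (q z - q w) by ring.
apply: le_trans (cabsD _ _) _; rewrite !cabsM mulrDl -!mulrA; apply: lerD.
  apply: ler_pM; rewrite ?cabs_ge0 ?HL' //.
  exact: le_trans (HM z zB) (ler_norm _).
apply: ler_pM; rewrite ?cabs_ge0 ?HL //.
exact: le_trans (HM' w wB) (ler_norm _).
Qed.

Lemma is_poly_line q a b : is_poly q -> exists P : {poly C}, forall x, q (a + x *: b) = P.[x].
Proof.
move: q; apply: (@is_poly_ind R n (fun q => exists P : {poly C}, forall x, q (a + x *: b) = P.[x])).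
- by move=> c; exists c%:P => x; rewrite hornerC.
- by move=> i; exists ((a 0 i)%:P + 'X * (b 0 i)%:P) => x; rewrite !mxE !hornerE.
- by move=> q p [P HP] [Q HQ]; exists (P + Q) => x; rewrite hornerD HP HQ.
by move=> q p [P HP] [Q HQ]; exists (P * Q) => x; rewrite hornerM HP HQ.
Qed.

End PowerModulus.

Section DiscreteJensen.
Variable R : realType.
Local Notation C := R[i].
Implicit Types (P G : {poly C}).

Lemma sum_horner_omega G m : (size G <= m)%N ->
  \sum_(j < m) G.[omega R m ^+ j] = m%:R * G.[0].
Proof.
move=> Gm; under eq_bigr do rewrite (horner_coef_wide _ Gm).
rewrite exchange_big /= horner_coef0; case: m Gm => [|m] Gm.
  by rewrite big_ord0 mul0r.
rewrite (bigD1 ord0) //= [X in _ + X]big1 ?addr0 => [|i i0].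
  under eq_bigr do rewrite expr0 mulr1.
  by rewrite sumr_const card_ord mulr_natl.
under eq_bigr do rewrite -exprM; rewrite -mulr_sumr sum_omegaX ?mulr0 //.
by rewrite lt0n ltn_ord andbT; move: i0; rewrite -val_eqE.
Qed.

(** A discrete maximum principle: with more nodes than the degree, the mean over the roots of unity
    is [G(0)] exactly. *)
Lemma horner_omega_ge G m : (0 < m)%N -> (size G <= m)%N ->
  exists j : nat, cabs G.[0] <= cabs G.[omega R m ^+ j].
Proof.
move=> m0 Gm; apply: contrapT => h.
have lt (j : 'I_m) : cabs G.[omega R m ^+ j] < cabs G.[0].
  by rewrite ltNge; apply/negP => hj; apply: h; exists j.
have : \sum_(j < m) cabs G.[omega R m ^+ j] < \sum_(j < m) cabs G.[0].
  by apply: ltr_sum => //; apply/hasP; exists (Ordinal m0); rewrite ?mem_index_enum.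
rewrite sumr_const card_ord -[_ *+ m]mulr_natl -[X in X * cabs _](cabs_nat R m) -cabsM -sum_horner_omega //.
by rewrite ltNge cabs_sum.
Qed.

Lemma periodic_prod (g : nat -> R) N (l' : nat) : (forall l, g (l + N)%N = g l) ->
  \prod_(l < N) g (l + l')%N = \prod_(l < N) g l.
Proof.
move=> gN; elim: l' => [|l' IH]; first by under eq_bigr do rewrite addn0.
rewrite -IH; case: N gN {IH} => [|N] gN; first by rewrite !big_ord0.
rewrite big_ord_recr [RHS]big_ord_recl /= mulrC; congr (_ * _).
  by rewrite addnS -addSn addnC gN.
by apply: eq_bigr => i _; rewrite /bump /= add1n addnS addSn.
Qed.

(* The product of [P] over the [N]-th roots of unity rotated by [x] is a polynomial in [x], so it is at least [P(0)^N] in modulus at some point of the circle; it is invariant under the [N]-th roots of unity, which brings the angle into the first arc. *)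
Lemma prod_roots_ge P N : (0 < N)%N -> exists2 ph : R, 0 <= ph <= 2 * pi / N%:R &
  cabs P.[0] ^+ N <= \prod_(l < N) cabs P.[expi (ph + 2 * pi * l%:R / N%:R)].
Proof.
move=> N0; pose G := \prod_(l < N) (P \Po (omega R N ^+ l *: 'X)).
have GE x : G.[x] = \prod_(l < N) P.[omega R N ^+ l * x].
  by rewrite horner_prod; apply: eq_bigr => l _; rewrite horner_comp !hornerE.
pose k := (size G).+1; have Nk0 : (0 < N * k)%N by rewrite muln_gt0 N0.
have Gs : (size G <= N * k)%N by apply: leq_trans (leqnSn _) _; apply: leq_pmull.
have [j hj] := horner_omega_ge Nk0 Gs.
have NR : 0 < N%:R :> R by rewrite ltr0n.
have kR : 0 < k%:R :> R by rewrite ltr0n.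
have p2 : 0 < 2 * pi :> R by rewrite mulr_gt0 // pi_gt0.
pose ph : R := 2 * pi * (j %% k)%:R / (N * k)%:R.
pose g (l : nat) := cabs P.[expi (ph + 2 * pi * l%:R / N%:R)].
have gN l : g (l + N)%N = g l.
  rewrite /g; have -> : ph + 2 * pi * (l + N)%:R / N%:R = ph + 2 * pi * l%:R / N%:R + 2 * pi.
    by rewrite natrD; field; rewrite gt_eqF.
  by rewrite expiD expi2pi mulr1.
exists ph.
  apply/andP; split; first by apply: divr_ge0 => //; apply: mulr_ge0 => //; apply: ltW.
  rewrite /ph ler_pdivrMr ?ltr0n // natrM mulrA divfK ?gt_eqF // ler_pM2l // ler_nat.
  by rewrite ltnW // ltn_mod.
rewrite -(periodic_prod (j %/ k) gN).
have -> : \prod_(l < N) g (l + j %/ k)%N = cabs G.[omega R (N * k) ^+ j].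
  rewrite GE cabs_prod; apply: eq_bigr => l _; rewrite /g; congr (cabs P.[_]).
  rewrite !omegaX -expiD; congr expi; rewrite {2}(divn_eq j k) /ph !natrD !natrM.
  by field; rewrite !gt_eqF.
apply: le_trans hj; rewrite GE cabs_prod.
under eq_bigr do rewrite mulr0.
by rewrite prodr_const card_ord.
Qed.

End DiscreteJensen.

Section PowerPsh.
Variables (R : realType) (n : nat) (al : R).
Hypothesis al_gt0 : 0 < al.
Local Notation C := R[i].
Local Notation Cn := 'rV[C]_n.
Implicit Types (z w a b : Cn) (q : Cn -> C).

Lemma powR_prod (I : Type) (s : seq I) (F : I -> R) : (forall i, 0 <= F i) ->
  (\prod_(i <- s) F i) `^ al = \prod_(i <- s) F i `^ al.
Proof.
move=> F0; elim: s => [|i s IH]; first by rewrite !big_nil powR1.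
by rewrite !big_cons powRM ?IH // prodr_ge0.
Qed.

Lemma powRXn (x : R) N : 0 <= x -> (x `^ al) ^+ N = (x ^+ N) `^ al.
Proof. by move=> x0; rewrite -(powR_mulrn N (powR_ge0 x al)) -(powR_mulrn N x0) powRAC. Qed.

(** The arithmetic-geometric mean inequality turns the product bound, a discrete Jensen inequality,
    into a sub-mean inequality for any positive power. *)
Lemma powR_mean_ge (P : {poly C}) N : (0 < N)%N -> exists2 ph : R, 0 <= ph <= 2 * pi / N%:R &
  cabs P.[0] `^ al <= N%:R^-1 * \sum_(l < N) cabs P.[expi (ph + 2 * pi * l%:R / N%:R)] `^ al.
Proof.
move=> N0; have [ph phN H] := prod_roots_ge P N0; exists ph => //.
pose g (l : 'I_N) := cabs P.[expi (ph + 2 * pi * l%:R / N%:R)].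
have g0 (l : 'I_N) : 0 <= g l `^ al by apply: powR_ge0.
have m0 : 0 <= N%:R^-1 * \sum_(l < N) g l `^ al.
  by rewrite mulr_ge0 ?invr_ge0 ?ler0n //; apply: sumr_ge0.
rewrite -(ler_pXn2r N0) ?nnegrE ?powR_ge0 //.
have [h _] := leif_AGM (I := 'I_N) (A := xpredT) (E := fun l => g l `^ al) (fun l _ => g0 l).
rewrite card_ord in h; rewrite [N%:R^-1 * _]mulrC; apply: le_trans h.
rewrite -powR_prod; last by move=> l; apply: cabs_ge0.
rewrite powRXn ?cabs_ge0 //.
apply: ge0_ler_powR; rewrite ?nnegrE ?exprn_ge0 ?cabs_ge0 ?(ltW al_gt0) //.
by apply: prodr_ge0 => l _; apply: cabs_ge0.
Qed.

Lemma usc_powR q : is_poly q -> usc (fun z => cabs (q z) `^ al).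
Proof.
move=> hq a c hc; have c0 : 0 < c by apply: le_lt_trans hc; apply: powR_ge0.
have := powR_invlt al_gt0 (cabs_ge0 _) (ltW c0) hc; set c' := c `^ _ => hc'.
have [L L0 HL] := is_poly_lipschitz (nrm a + 1) hq.
pose d := (c' - cabs (q a)) / (L + 1).
have L1 : 0 < L + 1 by lra.
have d0 : 0 < d by rewrite divr_gt0 // subr_gt0.
apply/nbhs_nrmP; exists (Order.min 1 d); first by rewrite lt_min ltr01.
move=> z; rewrite lt_min => /andP[z1 zd]; apply: powR_lt_inv => //; first exact: cabs_ge0.
  exact: ltW.
rewrite -/c'.
have zB : nrm z <= nrm a + 1.
  by have := nrmD a (z - a); rewrite [a + _]addrC subrK; lra.
have aB : nrm a <= nrm a + 1 by lra.
have h1 := HL z a zB aB.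
have h2 : cabs (q z) <= cabs (q a) + cabs (q z - q a).
  by have := cabsD (q a) (q z - q a); rewrite [q a + _]addrC subrK.
have h3 : nrm (z - a) * (L + 1) < c' - cabs (q a) by rewrite -ltr_pdivlMr.
have := nrm_ge0 (z - a); lra.
Qed.

(** The offset [ph] of the sample points is unknown but stays in the first arc, so each sample lies
    in the same closed arc as the points it is compared with. Uniform continuity then makes the
    samples minus [e] a lower step function. *)
Lemma psh_powR q : is_poly q -> psh (fun z => cabs (q z) `^ al).
Proof.
move=> hq; split; first exact: usc_powR.
move=> a b; set I := (X in (_ <= X)%E); apply/lee_addgt0Pr => e e0.
pose f (th : R) := cabs (q (a + expi th *: b)) `^ al.
pose B := nrm a + nrm b.
have fB (th : R) : nrm (a + expi th *: b) <= B.
  by apply: le_trans (nrmD _ _) _; rewrite nrmZ cabs_expi mul1r.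
have [L L0 HL] := is_poly_lipschitz B hq.
have [M HM] := is_poly_bounded B hq.
have [d d0 Hd] := powR_uniform al_gt0 M e0.
pose T := L * (2 * (2 * pi) * nrm b).
pose N := (Num.truncn (T / d)).+1; have N0 : (0 < N)%N by [].
have NR : 0 < N%:R :> R by rewrite ltr0n.
have TN : T / N%:R < d.
  by rewrite ltr_pdivrMr // mulrC -ltr_pdivrMr //; apply: truncnS_gt.
have [P HP] := is_poly_line a b hq.
have [ph /andP[ph0 ph1] Hph] := powR_mean_ge P N0.
pose th (j : nat) := ph + 2 * pi * j%:R / N%:R.
pose c (j : nat) := Order.max 0 (f (th j) - e).
have c0 j : 0 <= c j by rewrite le_max lexx.
have fc (j : nat) x : (j < N)%N -> 2 * pi * j%:R / N%:R <= x <= 2 * pi * j.+1%:R / N%:R -> c j <= f x.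
  move=> jN /andP[x0 x1]; rewrite ge_max powR_ge0 /= lerBlDr.
  have x2 : `|x - th j| <= 2 * pi / N%:R.
    have h : 2 * pi * j.+1%:R / N%:R = 2 * pi * j%:R / N%:R + 2 * pi / N%:R :> R.
      by rewrite -natr1; ring.
    by rewrite h in x1; rewrite ler_norml /th; apply/andP; split; lra.
  have h1 : cabs (q (a + expi x *: b) - q (a + expi (th j) *: b)) <= T / N%:R.
    apply: le_trans (HL _ _ (fB _) (fB _)) _; rewrite /T -mulrA ler_wpM2l //.
    rewrite opprD addrACA subrr add0r -scalerBl nrmZ mulrAC ler_wpM2r ?nrm_ge0 //.
    by apply: le_trans (expi_lip _ _) _; rewrite -mulrA ler_pM2l.
  have h2 : `|cabs (q (a + expi x *: b)) - cabs (q (a + expi (th j) *: b))| < d.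
    apply: le_lt_trans TN; apply: le_trans h1.
    rewrite ler_norml cabs_lB andbT cabsB lerNl opprB.
    exact: cabs_lB.
  have h3 : 0 <= cabs (q (a + expi (th j) *: b)) <= M by rewrite cabs_ge0 HM.
  have := Hd _ _ h3 (cabs_ge0 _) h2; rewrite ler_norml => /andP[+ _].
  by rewrite lerNl opprB lerBlDl.
have := circle_mean_ge N0 c0 (fun x => powR_ge0 _ _ : 0 <= f x) fc.
rewrite -/I => H.
have h : cabs (q a) `^ al - e <= N%:R^-1 * \sum_(j < N) c j.
  have -> : cabs (q a) `^ al = cabs P.[0] `^ al by rewrite -HP scale0r addr0.
  apply: le_trans (lerB Hph (lexx e)) _.
  have -> : N%:R^-1 * (\sum_(l < N) cabs P.[expi (ph + 2 * pi * l%:R / N%:R)] `^ al) - e =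
     N%:R^-1 * \sum_(l < N) (cabs P.[expi (ph + 2 * pi * l%:R / N%:R)] `^ al - e).
    rewrite sumrB mulrBr sumr_const card_ord -[e *+ N]mulr_natl mulKf // gt_eqF //.
  rewrite ler_pM2l ?invr_gt0 //; apply: ler_sum => l _.
  by rewrite /c /f HP le_max lexx orbT.
have -> : (cabs (q a) `^ al)%:E = ((cabs (q a) `^ al - e)%:E + e%:E)%E.
  by rewrite -EFinD subrK.
by apply: leeD => //; apply: le_trans H; rewrite lee_fin.
Qed.

End PowerPsh.

(** * Competitors for the extremal function *)

Section HomogeneousExtremal.
Variables (R : realType) (n : nat) (lam : 'I_n -> R).
Hypothesis lam_gt0 : forall i, 0 < lam i.
Local Notation C := R[i].
Local Notation Cn := 'rV[C]_n.
Implicit Types (z w a b : Cn) (q : Cn -> C) (K : set Cn).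

(** The root [d^-1] normalizes the homogeneity to degree 1. Holomorphy extends the transformation
    law from $\mathrm{Re}\,t>0$ to all [t], and the function is nonconstant because it vanishes at
    the origin but not at [z]. *)
Lemma quasi_hom_H_lam d q z (S : R) : 0 < d -> 0 < S -> quasi_hom lam d 0 q -> q z != 0 ->
  H_lam lam (fun w => (cabs (q w) / S) `^ d^-1).
Proof.
move=> d0 S0 hq qz; have d'0 : 0 < d^-1 by rewrite invr_gt0.
have [s [sd Hs]] := quasi_hom_holomorphic lam_gt0 hq.
have qPhi w t : q (Phi lam w t) = cexp (- (d%:C * t)) * q w.
  rewrite !Hs mulr_sumr; elim: s sd {Hs} => [|p s IH] sd; first by rewrite !big_nil.
  rewrite !big_cons IH; last by move=> y ys; apply: sd; right.
  by rewrite term_Phi (sd p (or_introl erefl)).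
have cS w : cabs (q w) / S = cabs (S^-1%:C * q w).
  by rewrite cabsM cabs_real ger0_norm ?invr_ge0 ?ltW // mulrC.
split.
- have := psh_powR d'0 (is_polyZ (S^-1)%:C (ex_intro _ s Hs : is_poly q)).
  by congr psh; apply/funext => w; rewrite cS.
- exists z, 0; rewrite (quasi_hom_origin _ hq) ?gt_eqF // cabs0 mul0r.
  rewrite powR0 ?gt_eqF //; apply/eqP; rewrite gt_eqF // powR_gt0 // divr_gt0 //.
  by rewrite cabs_gt0.
- by move=> w; apply: powR_ge0.
move=> w t; rewrite qPhi cabsM cabs_cexp ReN Re_realM -mulrA powRM ?expR_ge0 //; last first.
  by rewrite divr_ge0 ?cabs_ge0 // ltW.
by congr (_ * _); rewrite -expRM mulNr mulrAC mulfV ?mul1r ?gt_eqF.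
Qed.

Lemma Psi_sub_lam_hull K z : K !=set0 -> (Psi lam K z <= 1%:E)%E -> lam_hull lam K z.
Proof.
move=> [w Kw] hz d [k dE] q hq.
case E : (supnorm K q) => [r||]; rewrite ?leey //; last first.
  by have := le_supnorm q Kw; rewrite E.
have Kr y : K y -> cabs (q y) <= r by move=> Ky; rewrite -lee_fin -E; apply: le_supnorm.
have r0 : 0 <= r := le_trans (cabs_ge0 _) (Kr w Kw).
rewrite lee_fin leNgt; apply/negP => gap.
have [d0|d0] := eqVneq d 0.
  rewrite d0 in hq; move: gap; rewrite (quasi_hom_weight0 lam_gt0 z w hq).
  by rewrite ltNge Kr.
have dp : 0 < d by rewrite lt0r d0 dE weight_ge0.
have d'p : 0 < d^-1 by rewrite invr_gt0.
(* Dividing by a number strictly between [r] and [|q z|] allows [r = 0], and makes the competitor at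
   most 1 on [K] but larger than 1 at [z]. *)
pose S := (r + cabs (q z)) / 2; have Sr : r < S by rewrite /S; lra.
have Sq : S < cabs (q z) by rewrite /S; lra.
have S0 : 0 < S by lra.
have qz : q z != 0 by rewrite -cabs_gt0; lra.
have uH := quasi_hom_H_lam dp S0 hq qz.
have : ((((cabs (q z) / S) `^ d^-1))%:E <= 1%:E)%E.
  apply: le_trans hz; apply: ereal_sup_ubound.
  exists (fun y => (cabs (q y) / S) `^ d^-1) => //; split => // y Ky.
  have h : cabs (q y) / S <= 1.
    by rewrite ler_pdivrMr // mul1r; apply: le_trans (Kr y Ky) (ltW Sr).
  have y0 : cabs (q y) / S \is Num.nneg by rewrite nnegrE divr_ge0 ?cabs_ge0 ?(ltW S0).
  by have := ge0_ler_powR (ltW d'p) y0 (rpred1 _) h; rewrite powR1.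
rewrite lee_fin leNgt => /negP; apply.
have h : 1 < cabs (q z) / S by rewrite ltr_pdivlMr // mul1r.
have y0 : cabs (q z) / S \is Num.nneg by rewrite nnegrE divr_ge0 ?cabs_ge0 ?(ltW S0).
by have := gt0_ltr_powR d'p (rpred1 _) y0 h; rewrite powR1.
Qed.

End HomogeneousExtremal.

Theorem mainTheorem16 (R : realType) (n : nat) (lam : 'I_n.+1 -> R)
  (K : set 'rV[R[i]]_n.+1) :
  lam ord0 = 1 -> (forall k, 0 < lam k) ->
  compact K -> K !=set0 -> lam_circular lam K ->
  poly_hull K = lam_hull lam K /\
  lam_hull lam K = [set z | (Psi lam K z <= 1%:E)%E] /\
  poly_hull K 0.
Proof.
move=> _ lam_gt0 Kcpt K0 Kcirc; have hullE := poly_hull_lam_hull lam_gt0 Kcirc K0.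
split=> //; split; last by rewrite hullE; apply: lam_hull_origin.
apply/seteqP; split=> z; last exact: Psi_sub_lam_hull.
by move=> hz; apply: Psi_le1 => //; apply: lam_hull_sub_hull hz.
Qed.
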